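(* Let $p_0>0$, $q_0>0$ and let $u_0(x)=\frac12 p_0\left(e^{-|x+q_0|}-e^{-|x-q_0|}\right)$ for $x\in\mathbb{R}$. Then the dissipative solution $u=u(t,x)$, $(t,x)\in[0,\infty)\times\mathbb{R}$, of the Camassa--Holm equation $$u_t+\left(\frac{u^2}{2}\right)_x=-P_x,\qquad u(0,x)=u_0(x),\qquad P=\frac12 e^{-|x|}*\left(u^2+\frac{u_x^2}{2}\right),$$ is unique; that is, any two dissipative solutions with this same initial datum $u_0$ coincide on $[0,\infty)\times\mathbb{R}$.
   Context: Consider the Cauchy problem for the Camassa--Holm equation $u_t+(u^2/2)_x=-P_x$, $u(0,x)=u_0(x)\in H^1(\mathbb{R})$, where $P(t,x)=\frac12\int_{\mathbb{R}}e^{-|x-y|}\left(u^2(t,y)+\frac12u_x^2(t,y)\right)dy$. A function $u=u(t,x)$ defined on $[0,\infty)\times\mathbb{R}$ is called a (global) solution if it is Hölder continuous, $u(t,\cdot)\in H^1(\mathbb{R})$ at every $t\ge 0$, the map $t\mapsto u(t,\cdot)$ is Lipschitz continuous from $[0,\infty)$ to $L^2(\mathbb{R})$, $u(0,x)=u_0(x)$, and the following equality between functions in $L^2(\mathbb{R})$ holds for a.e. $t\ge0$: $$\frac{d}{dt}u=-uu_x-P_x .$$ A solution $u$ is called dissipative if, in addition: (i) there is a constant $C$ such that $u_x(t,x)\le C(1+t^{-1})$ for all $t>0$, $x\in\mathbb{R}$ (since $u_x(t,\cdot)\in L^2(\mathbb{R})$, the inequality is understood for a.e. $x$); (ii) the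 total energy $E(t):=\int_{\mathbb{R}}\left(u^2(t,x)+u_x^2(t,x)\right)dx$ satisfies $E(t)\le E(0)=:E_0$ for every $t\ge0$. *)

(* Defs.v *)
From mathcomp Require Import all_boot all_order all_algebra.
From mathcomp Require Import all_classical all_reals all_analysis.
Set Implicit Arguments.
Unset Strict Implicit.
Unset Printing Implicit Defensive.
Import Order.TTheory GRing.Theory Num.Theory.
Import numFieldNormedType.Exports.
Local Open Scope classical_set_scope.
Local Open Scope ring_scope.

Section CamassaHolm.
Context {R : realType}.
Local Notation mu := (@lebesgue_measure R).

Definition L2 (f : R -> R) : Prop := f \in Lfun mu 2%:E.

Definition L2norm (f : R -> R) : \bar R := ('N[mu]_2%:E[EFin \o f])%E.

Definition test_function (phi : R -> R) : Prop :=
  (forall (n : nat) (x : R), derivable (derive1n n phi) x 1) /\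
  compact (closure [set x | phi x != 0]).

Definition is_weak_derivative (f g : R -> R) : Prop :=
  [/\ locally_integrable setT f, locally_integrable setT g &
      forall phi, test_function phi ->
        \int[mu]_x (f x * derive1 phi x) = - \int[mu]_x (g x * phi x)].

(* A chosen representative of the weak derivative of [f], which is determined
   only up to a null set; it is the zero function when [f] has none. *)
Definition Dx (f : R -> R) : R -> R :=
  xget (fun=> 0) [set g | is_weak_derivative f g].

Definition H1 (f : R -> R) : Prop :=
  L2 f /\ exists2 g, is_weak_derivative f g & L2 g.

(* Functions on [0, +oo[ x R are represented by total functions u : R -> R -> R,
   with u t x standing for u(t, x); the values at t < 0 are never constrained. *)

Definition hoelder_continuous (u : R -> R -> R) : Prop :=
  exists a C : R, [/\ 0 < a, a <= 1 &
    forall t s x y : R, 0 <= t -> 0 <= s ->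
      `|u t x - u s y| <= C * (Num.max `|t - s| `|x - y|) `^ a].

Definition L2_lipschitz (u : R -> R -> R) : Prop :=
  exists C : R, forall t s : R, 0 <= t -> 0 <= s ->
    (L2norm (fun x => u t x - u s x)%R <= (C * `|t - s|)%:E)%E.

Definition CH_P (u : R -> R -> R) (t x : R) : R :=
  2^-1 * \int[mu]_y (expR (- `|x - y|) *
                     (u t y ^+ 2 + 2^-1 * Dx (u t) y ^+ 2)).

Definition has_L2_derivative (u : R -> R -> R) (t : R) (v : R -> R) : Prop :=
  L2norm (fun x => (u (t + h) x - u t x) / h - v x) @[h --> 0^'] --> 0%E.

(* The evolution equation is required at almost every t > 0: the point t = 0
   is a null set, and the two-sided quotient there would involve t < 0. *)
Definition CH_solution (u0 : R -> R) (u : R -> R -> R) : Prop :=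
  [/\ hoelder_continuous u,
      forall t : R, 0 <= t -> H1 (u t),
      L2_lipschitz u,
      forall x, u 0 x = u0 x &
      {ae mu, forall t : R, 0 < t ->
         has_L2_derivative u t
           (fun x => - (u t x * Dx (u t) x) - Dx (CH_P u t) x)}].

Definition CH_energy (u : R -> R -> R) (t : R) : \bar R :=
  (\int[mu]_x ((u t x ^+ 2 + Dx (u t) x ^+ 2)%R)%:E)%E.

Definition dissipative_solution (u0 : R -> R) (u : R -> R -> R) : Prop :=
  [/\ CH_solution u0 u,
      exists C : R, forall t : R, 0 < t ->
        {ae mu, forall x, Dx (u t) x <= C * (1 + t^-1)} &
      forall t : R, 0 <= t -> (CH_energy u t <= CH_energy u 0)%E].

Definition peakon_antipeakon (p0 q0 x : R) : R :=
  2^-1 * p0 * (expR (- `|x + q0|) - expR (- `|x - q0|)).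

End CamassaHolm.

(* Main.v *)
Require Import Defs.
From mathcomp Require Import all_boot all_order all_algebra.
From mathcomp Require Import all_classical all_reals all_analysis.
From mathcomp Require Import measurable_realfun.
From mathcomp Require Import ring lra.
Set Implicit Arguments.
Unset Strict Implicit.
Unset Printing Implicit Defensive.
Import Order.TTheory GRing.Theory Num.Theory.
Import numFieldNormedType.Exports.
Local Open Scope classical_set_scope.
Local Open Scope ring_scope.

(** Why the solution is unique.

    A solution u is Hölder continuous, so that Peano's theorem
    ([characteristic_exists]) provides characteristics X' = u(t, X), forwards
    and backwards in time, possibly not unique. Along each of them u(t, X(t))
    is absolutely continuous and its derivative is - P_x
    ([characteristic_acceleration]): the mass of u in a thin strip on the
    right of X obeys an inequality, since the transport terms leave a negative
    square, and the strip on the left gives the opposite inequality.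

    Let X1 < X2 be characteristics from the two crests of the datum, l = X2 -
    X1 and D = u(t, X2) - u(t, X1). Among all functions w with w(X2) - w(X1) =
    D, the antisymmetric pair of peakons at X1 and X2 has the least energy,
    namely J = D^2 / (1 - exp(-l)). The key is [odd_gap]: completing the
    square pointwise shows that J' >= - 2 M (E - J), where E bounds the total
    energy and M is bounded while l stays away from 0. Since the energy does
    not exceed its initial value, and the gap E - J is closed initially,
    Gronwall's inequality keeps it closed; so u(t) is the pair of peakons
    ([peakon_before]). There remains l' = - sqrt (E (1 - exp(-l))), whose
    right-hand side decreases with l, and the centre of the pair stays at
    rest. This determines l, and with it u ([peakon_run_unique]).

    When l reaches 0, so does D, and D bounds u: the solution vanishes
    identically ([vanishing_at_collision]). From then on, the one-sided bound
    on u_x forbids that two backward characteristics meet. On the slope D / l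
    between two of them, u_x^2 acts as a favourable Riccati term, which yields
    a lower bound for u_x as well, over a time that depends only on the
    constants ([slope_lower_bound]). Once u is known to be Lipschitz
    continuous in space, the equation contracts the bounds of u and u_x over
    short times ([zero_on_short_interval]), and u stays zero for ever
    ([zero_after]).

    As two solutions agree while both are before their collisions, neither can
    collide while the crests of the other are still apart
    ([no_early_collision]); after both collisions they vanish. *)

(** * Integrals over compact intervals *)

Section Calculus.
Context {R : realType}.
Local Notation mu := (@lebesgue_measure R).
Implicit Types (a b c d e k lo hi r x y z : R) (f g F G : R -> R).

(** Real induction for an additive property of intervals: it suffices to have it
    on the short intervals that contain a given point. The point is kept as a
    parameter, so that the local argument may use what is known there. *)
Lemma interval_induction (P : R -> R -> Prop) a b : a <= b ->
  (forall x y z, a <= x -> x <= y -> y <= z -> z <= b ->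
     P x y -> P y z -> P x z) ->
  (forall c, a <= c -> c <= b -> exists2 d, 0 < d &
     forall x y, a <= x -> c - d < x -> x <= c -> c <= y -> y < c + d ->
       y <= b -> P x y) ->
  P a b.
Proof.
move=> ab Ptr Ploc.
pose E := [set x | [/\ a <= x, x <= b & P a x]].
have Ea : E a.
  have [d d0 H] := Ploc a (lexx a) ab.
  by split => //; apply: H => //; rewrite ?ltrBlDr ?ltrDl.
have Eub : ubound E b by move=> x [].
have hE : has_sup E by split; [exists a|exists b].
set s := sup E.
have as_ : a <= s by apply: ub_le_sup => //; exists b.
have sb : s <= b by apply: ge_sup => //; exists a.
have [d d0 H] := Ploc s as_ sb.
have [e [ae eb Pae] se] := sup_adherent d0 hE.
have es : e <= s by apply: ub_le_sup => //; exists b.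
have Pas : P a s.
  by apply: (Ptr a e s) => //; apply: H => //; rewrite ltrDl.
have [sltb|bs] := ltP s b; last by have <- : s = b by apply/eqP; rewrite eq_le sb.
pose y := Num.min (s + d / 2) b.
have sy : s < y by rewrite lt_min sltb andbT ltrDl divr_gt0.
have yb : y <= b by rewrite ge_min lexx orbT.
have ysd : y < s + d.
  rewrite gt_min; apply/orP; left; rewrite ltrD2l ltr_pdivrMr//; lra.
have : E y.
  split => //; first exact: le_trans (ltW sy).
  apply: (Ptr a s y) => //; first exact: ltW.
  by apply: H => //; [rewrite ltrBlDr ltrDl|exact: ltW].
move=> /(ub_le_sup (ex_intro _ b Eub)); rewrite -/s leNgt sy; by [].
Qed.

Definition integrable_on a b f := mu.-integrable `[a, b] (EFin \o f).
Definition integ a b f : R := \int[mu]_(x in `[a, b]) f x.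

Let mitv a b : measurable (`[a, b]%classic : set R).
Proof. exact: measurable_itv. Qed.
Hint Resolve mitv : core.

Lemma integrable_onS a b a' b' f : a <= a' -> b' <= b ->
  integrable_on a b f -> integrable_on a' b' f.
Proof.
move=> aa bb; apply: integrableS => //.
by apply: subset_itv; rewrite bnd_simp.
Qed.

Lemma eq_integrable_on a b f g : (forall x, a <= x -> x <= b -> f x = g x) ->
  integrable_on a b f -> integrable_on a b g.
Proof.
move=> fg; apply: eq_integrable => // x /[!inE]/=; rewrite in_itv/= => /andP[? ?].
by rewrite fg.
Qed.

Lemma eq_integ a b f g : (forall x, a <= x -> x <= b -> f x = g x) ->
  integ a b f = integ a b g.
Proof.
move=> fg; apply: eq_Rintegral => x /[!inE]/=; rewrite in_itv/= => /andP[? ?].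
by rewrite fg.
Qed.

Lemma integrable_onD a b f g : integrable_on a b f -> integrable_on a b g ->
  integrable_on a b (fun x => f x + g x).
Proof. by move=> fi gi; apply: (integrableD _ fi gi). Qed.

Lemma integrable_onZ a b k f : integrable_on a b f ->
  integrable_on a b (fun x => k * f x).
Proof. by move=> fi; apply: (integrableZl _ k fi). Qed.

Lemma integrable_onN a b f : integrable_on a b f ->
  integrable_on a b (fun x => - f x).
Proof. by move=> fi; apply: (integrableN fi). Qed.

Lemma integrable_onB a b f g : integrable_on a b f -> integrable_on a b g ->
  integrable_on a b (fun x => f x - g x).
Proof. by move=> fi gi; apply: integrable_onD => //; apply: integrable_onN. Qed.

Lemma integrable_on_norm a b f : integrable_on a b f ->
  integrable_on a b (fun x => `|f x|).
Proof. by move=> fi; apply: (integrable_norm fi). Qed.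

Lemma within_continuous_integrable_on a b f :
  {within `[a, b], continuous f} -> integrable_on a b f.
Proof.
move=> fc; apply: continuous_compact_integrable => //; exact: segment_compact.
Qed.

Lemma continuous_integrable_on a b f : continuous f -> integrable_on a b f.
Proof.
by move=> fc; apply: within_continuous_integrable_on; exact: continuous_subspaceT.
Qed.

Lemma integrable_on_cst a b k : integrable_on a b (fun=> k).
Proof. by apply: continuous_integrable_on => x; exact: cvg_cst. Qed.

Lemma integ_cat a b c f : a <= b -> b <= c -> integrable_on a c f ->
  integ a c f = integ a b f + integ b c f.
Proof.
move=> ab bc fi; apply/eqP; rewrite addrC -subr_eq; apply/eqP.
rewrite /integ (@Rintegral_itvB _ f (BLeft a) (BRight c) b) ?bnd_simp//.
rewrite Rintegral_itv_obnd_cbnd//.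
apply: integrableS fi => //; apply: subset_itvr; by rewrite bnd_simp.
Qed.

Lemma integ_pt a f : integ a a f = 0.
Proof. by rewrite /integ set_itv1 Rintegral_set1. Qed.

Lemma integ_lt a b f : b < a -> integ a b f = 0.
Proof.
by move=> ba; rewrite /integ set_itv_ge ?Rintegral_set0// bnd_simp -ltNge.
Qed.

Lemma integD a b f g : integrable_on a b f -> integrable_on a b g ->
  integ a b (fun x => f x + g x) = integ a b f + integ a b g.
Proof. by move=> fi gi; apply: RintegralD. Qed.

Lemma integB a b f g : integrable_on a b f -> integrable_on a b g ->
  integ a b (fun x => f x - g x) = integ a b f - integ a b g.
Proof. by move=> fi gi; apply: RintegralB. Qed.

Lemma integZ a b k f : integrable_on a b f ->
  integ a b (fun x => k * f x) = k * integ a b f.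
Proof. by move=> fi; apply: RintegralZl. Qed.

Lemma integN a b f : integrable_on a b f ->
  integ a b (fun x => - f x) = - integ a b f.
Proof.
move=> fi; rewrite -mulN1r -integZ//.
by apply: eq_integ => x _ _; rewrite mulN1r.
Qed.

Lemma integ_cst a b k : a <= b -> integ a b (fun=> k) = k * (b - a).
Proof.
move=> ab; rewrite /integ Rintegral_cst//; congr (_ * _).
have := lebesgue_measure_itv `[a, b]; rewrite /= => ->; rewrite lte_fin.
move: ab; rewrite le_eqVlt => /predU1P[->|->]; last by rewrite -EFinB.
by rewrite ltxx subrr.
Qed.

Lemma le_integ a b f g : integrable_on a b f -> integrable_on a b g ->
  (forall x, a <= x -> x <= b -> f x <= g x) -> integ a b f <= integ a b g.
Proof.
move=> fi gi fg; apply: le_Rintegral => // x /=.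
by rewrite in_itv/= => /andP[? ?]; exact: fg.
Qed.

Lemma integ_ge0 a b f : (forall x, a <= x -> x <= b -> 0 <= f x) ->
  0 <= integ a b f.
Proof.
move=> f0; apply: Rintegral_ge0 => x /=.
by rewrite in_itv/= => /andP[? ?]; exact: f0.
Qed.

Lemma le_norm_integ a b f : integrable_on a b f ->
  `|integ a b f| <= integ a b (fun x => `|f x|).
Proof. by move=> fi; apply: le_normr_Rintegral. Qed.

Lemma le_norm_integ_cst a b k f : a <= b -> integrable_on a b f ->
  (forall x, a <= x -> x <= b -> `|f x| <= k) -> `|integ a b f| <= k * (b - a).
Proof.
move=> ab fi fk; rewrite -integ_cst//; apply: (le_trans (le_norm_integ _)) => //.
apply: le_integ => //; [exact: integrable_on_norm|exact: integrable_on_cst].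
Qed.

(** * Primitives of integrable functions *)

(** Absolute continuity of F on [lo, hi], in the only form in which it is used. *)
Definition primitive_on lo hi F f := integrable_on lo hi f /\
  forall a b, lo <= a -> a <= b -> b <= hi -> F b - F a = integ a b f.

Lemma primitive_onS lo hi lo' hi' F f : lo <= lo' -> hi' <= hi ->
  primitive_on lo hi F f -> primitive_on lo' hi' F f.
Proof.
move=> l h [fi FE]; split; first exact: integrable_onS fi.
by move=> a b la ab bh; apply: FE => //; [exact: le_trans la|exact: le_trans h].
Qed.

Lemma eq_primitive_on lo hi F f G g :
  (forall x, lo <= x -> x <= hi -> F x = G x) ->
  (forall x, lo <= x -> x <= hi -> f x = g x) ->
  primitive_on lo hi F f -> primitive_on lo hi G g.
Proof.
move=> FG fg [fi FE]; split; first exact: eq_integrable_on fi.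
move=> a b la ab bh; rewrite -!FG ?FE//.
- apply: eq_integ => x ax xb; apply: fg; first exact: le_trans ax.
  exact: le_trans bh.
- exact: le_trans bh.
- exact: le_trans ab.
Qed.

Lemma primitive_onD lo hi F f G g : primitive_on lo hi F f ->
  primitive_on lo hi G g ->
  primitive_on lo hi (fun x => F x + G x) (fun x => f x + g x).
Proof.
move=> [fi FE] [gi GE]; split; first exact: integrable_onD.
move=> a b la ab bh; rewrite integD.
- by rewrite -FE// -GE//; ring.
- exact: integrable_onS fi.
- exact: integrable_onS gi.
Qed.

Lemma primitive_onZ lo hi k F f : primitive_on lo hi F f ->
  primitive_on lo hi (fun x => k * F x) (fun x => k * f x).
Proof.
move=> [fi FE]; split; first exact: integrable_onZ.
move=> a b la ab bh; rewrite integZ; last exact: integrable_onS fi.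
by rewrite -FE//; ring.
Qed.

Lemma primitive_onN lo hi F f : primitive_on lo hi F f ->
  primitive_on lo hi (fun x => - F x) (fun x => - f x).
Proof.
move=> Ff; apply: eq_primitive_on (primitive_onZ (-1) Ff) => x _ _; ring.
Qed.

Lemma primitive_onB lo hi F f G g : primitive_on lo hi F f ->
  primitive_on lo hi G g ->
  primitive_on lo hi (fun x => F x - G x) (fun x => f x - g x).
Proof. by move=> Ff Gg; apply: primitive_onD => //; exact: primitive_onN. Qed.

Lemma primitive_on_cst lo hi k : primitive_on lo hi (fun=> k) (fun=> 0).
Proof.
split; first exact: integrable_on_cst.
by move=> a b la ab bh; rewrite integ_cst// subrr mul0r.
Qed.

Lemma within_continuousP lo hi F : {within `[lo, hi], continuous F} <->
  (forall c, lo <= c -> c <= hi -> forall e, 0 < e -> exists2 d, 0 < d &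
     forall x, lo <= x -> x <= hi -> `|x - c| < d -> `|F x - F c| < e).
Proof.
split.
- move=> Fc c lc ch e e0.
  have cI : `[lo, hi]%classic c by rewrite /= in_itv/= lc.
  have /subspace_continuousP/(_ c cI)/cvgrPdist_lt/(_ _ e0) := Fc.
  rewrite near_withinE => /nbhs_ballP[d /= d0 H]; exists d => // x lx xh xc.
  by rewrite distrC; apply: H; [rewrite /ball/= distrC|rewrite /= in_itv/= lx].
- move=> H; apply/subspace_continuousP => c /=; rewrite in_itv/= => /andP[lc ch].
  apply/cvgrPdist_lt => e e0; have [d d0 Hd] := H c lc ch e e0.
  rewrite near_withinE; apply/nbhs_ballP; exists d => //= x.
  rewrite /ball/= => xc; rewrite in_itv/= => /andP[lx xh].
  by rewrite distrC; apply: Hd => //; rewrite distrC.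
Qed.

Lemma primitive_on_continuous lo hi F f : primitive_on lo hi F f ->
  {within `[lo, hi], continuous F}.
Proof.
move=> [fi FE]; apply/within_continuousP => c lc ch e e0.
have lh := le_trans lc ch.
have /within_continuousP/(_ c lc ch e e0)[d d0 H] :=
  parameterized_integral_continuous lh fi.
exists d => // x lx xh /(H x lx xh); rewrite -![parameterized_integral _ _ _ _]/(integ _ _ _).
by rewrite -!FE//; congr (`|_| < _); ring.
Qed.

Lemma primitive_onP lo hi F f : primitive_on lo hi F f ->
  forall c, lo <= c -> c <= hi -> forall e, 0 < e -> exists2 d, 0 < d &
     forall x, lo <= x -> x <= hi -> `|x - c| < d -> `|F x - F c| < e.
Proof. by move=> /primitive_on_continuous/within_continuousP. Qed.

Lemma within_continuous_bounded lo hi F : {within `[lo, hi], continuous F} ->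
  [bounded F x | x in `[lo, hi]].
Proof.
move=> Fc; have := continuous_compact Fc (segment_compact (a := lo) (b := hi)).
move/compact_bounded; rewrite /bounded_set /bounded_near.
by apply: filterS => M H x xI; apply: H; exists x.
Qed.

Lemma integrable_onM lo hi F f : {within `[lo, hi], continuous F} ->
  integrable_on lo hi f -> integrable_on lo hi (fun x => F x * f x).
Proof.
move=> Fc fi; apply: (integrableMr _ _ _ fi) => //.
  exact: subspace_continuous_measurable_fun.
exact: within_continuous_bounded.
Qed.

Lemma MVT_ball (phi dphi : R -> R) c r p q :
  (forall z, `|z - c| < r -> is_derive z 1 phi (dphi z)) ->
  `|p - c| < r -> `|q - c| < r ->
  exists2 z, `|z - c| < r & phi q - phi p = dphi z * (q - p).
Proof.
wlog pq : p q / p <= q => [H dphi_ pc qc|dphi_ pc qc].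
  have [pq|qp] := leP p q; first exact: H.
  have [z zc E] := H _ _ (ltW qp) dphi_ qc pc; exists z => //.
  by rewrite -opprB E -mulrN opprB.
have inb z : p <= z -> z <= q -> `|z - c| < r.
  by move: pc qc; rewrite !ltr_norml => /andP[p1 p2] /andP[q1 q2] pz zq; lra.
have cph : {within `[p, q], continuous phi}.
  apply: derivable_within_continuous => z; rewrite in_itv/= => /andP[pz zq].
  by case: (dphi_ z (inb z pz zq)).
have D z : z \in `]p, q[ -> is_derive z 1 phi (dphi z).
  by rewrite in_itv/= => /andP[pz zq]; apply: dphi_; apply: inb; exact: ltW.
have [z + ->] := MVT_segment pq D cph.
by rewrite in_itv/= => /andP[pz zq]; exists z => //; exact: inb.
Qed.

Lemma le0_eps_mul (x k : R) : (forall e, 0 < e -> x <= e * k) -> x <= 0.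
Proof.
move=> H; rewrite leNgt; apply/negP => x0.
have k1 : 0 < `|k| + 1 by rewrite ltr_pwDr.
have := H (x / (`|k| + 1) / 2); rewrite !divr_gt0// => /(_ isT).
have : x / (`|k| + 1) / 2 * k <= x / 2.
  have kk : k / (`|k| + 1) <= 1.
    by rewrite ler_pdivrMr// mul1r (le_trans (ler_norm _))// lerDl.
  have -> : x / (`|k| + 1) / 2 * k = x / 2 * (k / (`|k| + 1)).
    by field; exact: lt0r_neq0.
  by rewrite ler_piMr// divr_ge0// ltW.
lra.
Qed.

(** On a short interval around c the increment of phi o F is dphi (F c) times the
    increment of F, up to a small multiple of the integral of |f|; real induction
    adds these errors up. The product rule follows by polarization. *)
Lemma primitive_on_comp lo hi F f (phi dphi : R -> R) :
  primitive_on lo hi F f ->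
  (forall c, lo <= c -> c <= hi ->
     \forall z \near F c, is_derive (z : R) (1 : R) phi (dphi z)) ->
  (forall c, lo <= c -> c <= hi -> {for F c, continuous dphi}) ->
  primitive_on lo hi (fun x => phi (F x)) (fun x => dphi (F x) * f x).
Proof.
move=> Ff Hd Hc; have [fi FE] := Ff.
have gi : integrable_on lo hi (fun x => dphi (F x) * f x).
  apply: integrable_onM => //; apply/within_continuousP => c lc ch e e0.
  have /cvgrPdist_lt/(_ _ e0)/nbhs_ballP[r /= r0 Hr] := Hc c lc ch.
  have [d d0 H] := primitive_onP Ff lc ch r0.
  exists d => // x lx xh xc; rewrite distrC; apply: Hr.
  by rewrite /ball/= distrC; apply: H.
split => // a b la ab bh.
apply/eqP; rewrite -subr_eq0 -normr_le0.
suff : forall e, 0 < e ->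
    `|phi (F b) - phi (F a) - integ a b (fun x => dphi (F x) * f x)| <=
    e * integ a b (fun x => `|f x|) by move=> /le0_eps_mul.
move=> e e0.
pose Q x y := `|phi (F y) - phi (F x) - integ x y (fun x => dphi (F x) * f x)|
  <= e * integ x y (fun x => `|f x|).
apply: (@interval_induction Q) => // [x y z ax xy yz zb|c ac cb]; rewrite /Q.
  have xz := le_trans xy yz.
  rewrite (@integ_cat x y z)//; last first.
    by apply: integrable_onS gi; [exact: le_trans ax|exact: le_trans zb bh].
  rewrite (@integ_cat x y z)//; last first.
    apply: integrable_onS (integrable_on_norm fi); [exact: le_trans ax|exact: le_trans zb bh].
  move=> h1 h2; rewrite mulrDr.
  apply: le_trans (lerD h1 h2); apply: le_trans (ler_normD _ _).
  by rewrite le_eqVlt; apply/orP; left; apply/eqP; congr `|_|; ring.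
have lc := le_trans la ac; have ch := le_trans cb bh.
have e20 : 0 < e / 2 by rewrite divr_gt0.
have := Hd c lc ch; near_simpl => /nbhs_ballP[r1 /= r10 Hr1].
have /cvgrPdist_lt/(_ _ e20)/nbhs_ballP[r2 /= r20 Hr2] := Hc c lc ch.
pose r := Num.min r1 r2.
have r0 : 0 < r by rewrite lt_min r10.
have [d d0 H] := primitive_onP Ff lc ch r0.
exists d => // x y ax cx xc cy yc yb.
have lx := le_trans la ax; have yh := le_trans yb bh.
have xy := le_trans xc cy; have xh := le_trans xy yh; have ly := le_trans lx xy.
have Hn z : x <= z -> z <= y -> `|F z - F c| < r.
  move=> xz zy; apply: H; [exact: le_trans xz|exact: le_trans yh|].
  rewrite ltr_norml; apply/andP; split; lra.
have D z : `|z - F c| < r -> is_derive z 1 phi (dphi z).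
  move=> zc; apply: Hr1; rewrite /ball/= distrC; apply: lt_le_trans zc _.
  by rewrite ge_min lexx.
have [z zc ->] := MVT_ball D (Hn x (lexx x) xy) (Hn y xy (lexx y)).
have fixy : integrable_on x y f by apply: integrable_onS fi.
have gixy : integrable_on x y (fun x => dphi (F x) * f x) by apply: integrable_onS gi.
rewrite FE// -integZ// -integB//; last exact: integrable_onZ.
rewrite -integZ; last exact: integrable_on_norm.
apply: (le_trans (le_norm_integ _)).
  by apply: integrable_onB => //; exact: integrable_onZ.
apply: le_integ.
- by apply: integrable_on_norm; apply: integrable_onB => //; exact: integrable_onZ.
- by apply: integrable_onZ; exact: integrable_on_norm.
- move=> w xw wy; rewrite -mulrBl normrM ler_wpM2r//.
  have := Hr2 z; rewrite /ball/= distrC => /(_ (lt_le_trans zc _))/=.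
  rewrite ge_min lexx orbT => /(_ isT) h1.
  have := Hr2 (F w); rewrite /ball/= distrC => /(_ (lt_le_trans (Hn w xw wy) _))/=.
  rewrite ge_min lexx orbT => /(_ isT) h2.
  move: h1 h2; rewrite !ltr_norml ler_norml => /andP[? ?] /andP[? ?].
  by apply/andP; split; lra.
Unshelve. all: by end_near. Qed.

Lemma primitive_on_sqr lo hi F f : primitive_on lo hi F f ->
  primitive_on lo hi (fun x => F x ^+ 2) (fun x => 2 * F x * f x).
Proof.
move=> Ff; apply: (primitive_on_comp (phi := fun z => z ^+ 2) (dphi := fun z => 2 * z)) => //.
- move=> c _ _; near=> z; have := is_deriveX 2 (is_derive_id z (1 : R)).
  by move=> h; apply: (is_derive_eq h); rewrite /= expr1 [_%:A]mulr1.
- move=> c _ _; apply: cvgM; [exact: cvg_cst|exact: cvg_id].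
Unshelve. all: by end_near. Qed.

Lemma primitive_onM lo hi F f G g : primitive_on lo hi F f ->
  primitive_on lo hi G g ->
  primitive_on lo hi (fun x => F x * G x) (fun x => f x * G x + F x * g x).
Proof.
move=> Ff Gg.
have h1 := primitive_on_sqr (primitive_onD Ff Gg).
have h2 := primitive_on_sqr Ff.
have h3 := primitive_on_sqr Gg.
have := primitive_onZ 2^-1 (primitive_onB (primitive_onB h1 h2) h3).
by apply: eq_primitive_on => x _ _; field.
Qed.

Lemma C1_primitive_on lo hi F f : (forall x, is_derive x 1 F (f x)) ->
  continuous f -> primitive_on lo hi F f.
Proof.
move=> dF cf; split; first exact: continuous_integrable_on.
move=> a b la; rewrite le_eqVlt => /predU1P[->|ab] bh.
  by rewrite subrr integ_pt.
have cF x : {for x, continuous F}.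
  by apply/differentiable_continuous/derivable1_diffP; case: (dF x).
rewrite /integ /Rintegral (@continuous_FTC2 _ f F)//.
- exact: continuous_subspaceT.
- split => //.
  + exact: cvg_at_right_filter (cF a).
  + exact: cvg_at_left_filter (cF b).
- by move=> x _; rewrite derive1E; have [_ h] := dF x; exact: h.
Qed.

Lemma primitive_on_le lo hi F f : primitive_on lo hi F f -> lo <= hi ->
  (forall x, lo <= x -> x <= hi -> f x <= 0) -> F hi <= F lo.
Proof.
move=> [fi FE] lh f0; rewrite -subr_le0 FE//.
have -> : 0 = integ lo hi (fun=> 0) by rewrite integ_cst// mul0r.
apply: le_integ => //; exact: integrable_on_cst.
Qed.

Lemma affine_primitive lo hi k c : primitive_on lo hi (fun x => k * (x - c)) (fun=> k).
Proof.
apply: C1_primitive_on => [x|x]; last exact: cvg_cst.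
have := is_deriveZ k (is_deriveB (is_derive_id x (1 : R)) (is_derive_cst c x (1 : R))).
by move=> H; apply: (is_derive_eq H); rewrite subr0 /GRing.scale/= mulr1.
Qed.

Lemma primitive_continuous F f : (forall lo hi, primitive_on lo hi F f) -> continuous F.
Proof.
move=> Ff x; apply/cvgrPdist_lt => e e0.
have [||d d0 Hd] := primitive_onP (Ff (x - 1) (x + 1)) (c := x) _ _ e0; try lra.
apply/nbhs_ballP; exists (Num.min d 1) => /=; first by rewrite lt_min d0 ltr01.
move=> y; rewrite /ball/= lt_min => /andP[h1 h2]; rewrite distrC; apply: Hd.
- by move: h2; rewrite ltr_norml => /andP[]; lra.
- by move: h2; rewrite ltr_norml => /andP[]; lra.
- by rewrite distrC.
Qed.

End Calculus.

(** * Weak derivatives of continuous functions *)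

Section WeakDerivative.
Context {R : realType}.
Local Notation mu := (@lebesgue_measure R).
Implicit Types (a b c d e k lo hi r x y z : R) (f g F G : R -> R).

(** The functions P(1/x) exp(-1/x), extended by 0 to x <= 0. Differentiation
    replaces P by X^2 (P - P'), so they are smooth, and they are the source of
    all the test functions below. *)
Definition flat (p : {poly R}) (x : R) : R :=
  if 0 < x then p.[x^-1] * expR (- x^-1) else 0.

Lemma horner_expRN_bounded (p : {poly R}) :
  exists2 K, 0 <= K & forall y, 0 <= y -> `|p.[y] * expR (- y)| <= K.
Proof.
exists (\sum_(i < size p) `|p`_i| * (i`!)%:R); first by apply: sumr_ge0 => i _; rewrite mulr_ge0.
move=> y y0; rewrite horner_coef mulr_suml.
apply: (le_trans (ler_norm_sum _ _ _)); apply: ler_sum => i _.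
rewrite -mulrA normrM ler_wpM2l// normrM !ger0_norm ?expR_ge0 ?exprn_ge0//.
rewrite expRN ler_pdivrMr ?expR_gt0//.
case: (nat_of_ord i) => [|n]; first by rewrite expr0 fact0 mul1r -expR0 ler_expR.
have := expR_ge1Dxn n y0; rewrite -ler_pdivrMl ?ltr0n ?fact_gt0//.
by move=> /(le_trans _); apply; rewrite mulrC lerDr.
Qed.

Lemma is_derive0_sqr_bound f k : (forall x, `|f x| <= k * x ^+ 2) ->
  is_derive (0 : R) (1 : R) f 0.
Proof.
move=> fk; have f0 : f 0 = 0.
  by apply/eqP; rewrite -normr_le0; have := fk 0; rewrite expr0n/= mulr0.
have k0 : 0 <= k by have := fk 1; rewrite expr1n mulr1; exact: le_trans.
have H : h^-1 *: ((f \o shift 0) (h *: (1 : R)) - f 0) @[h --> 0^'] --> (0 : R).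
  apply/cvgrPdist_lt => e e0; near=> h.
  have h0 : h != 0 by near: h; exact: nbhs_dnbhs_neq.
  rewrite sub0r normrN f0 subr0 /= /GRing.scale/= addr0 mulr1 normrM normfV.
  rewrite mulrC ltr_pdivrMr ?normr_gt0//; apply: le_lt_trans (fk h) _.
  rewrite -real_normK ?num_real// expr2 mulrA ltr_pM2r ?normr_gt0//.
  have hk : `|h| < e / (k + 1).
    near: h; apply: dnbhs0_lt; rewrite divr_gt0// ltr_pwDr//.
  apply: (@le_lt_trans _ _ ((k + 1) * `|h|)); first by rewrite ler_wpM2r// lerDl.
  by rewrite mulrC -ltr_pdivlMr// ltr_pwDr.
by split; [apply/cvg_ex; exists 0|exact: cvg_lim H].
Unshelve. all: by end_near. Qed.

Lemma is_derive_flat p x :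
  is_derive x (1 : R) (flat p) (flat ('X^2 * (p - p^`())) x).
Proof.
have [x0|x0|<-] := ltgtP 0 x.
- rewrite {2}/flat x0.
  have xn : x != 0 by exact: lt0r_neq0.
  have dV : is_derive x (1 : R) (fun y : R => y^-1) (- x ^- 2).
    by have := is_deriveV xn (is_derive_id x (1 : R)); rewrite [_ *: _]mulr1.
  have dp : is_derive x (1 : R) (fun y : R => p.[y^-1]) (p^`().[x^-1] * - x ^- 2).
    apply: (@is_derive1_comp _ (horner p) (fun y : R => y^-1)) => //.
  have de : is_derive x (1 : R) (fun y : R => expR (- y^-1)) (expR (- x^-1) * x ^- 2).
    apply: (@is_derive1_comp _ expR (fun y : R => - y^-1)).
    by have := is_deriveN dV; rewrite opprK.
  have := is_deriveM dp de; rewrite /GRing.scale/= => H.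
  have E : \near x, p.[x^-1] * expR (- x^-1) = flat p x.
    near=> y; rewrite /flat ifT//; near: y; exact: lt_nbhsr.
  apply: (is_derive_eq (near_eq_is_derive E H)); rewrite !hornerE/= exprVn; ring.
- have -> : flat ('X^2 * (p - p^`())) x = 0 by rewrite /flat ltNge ltW.
  apply: (@near_eq_is_derive _ _ _ (cst 0)).
  near=> y; rewrite /flat ltNge ifF//; apply/negbF; apply: ltW.
  by near: y; exact: lt_nbhsl.
- have -> : flat ('X^2 * (p - p^`())) 0 = 0 by rewrite /flat ltxx.
  have [K K0 HK] := horner_expRN_bounded ('X^2 * p).
  apply: (@is_derive0_sqr_bound _ K) => z; rewrite /flat.
  case: ltP => z0; last by rewrite normr0 mulr_ge0// sqr_ge0.
  have := HK z^-1; rewrite invr_ge0 ltW// => /(_ isT).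
  have -> : ('X^2 * p).[z^-1] * expR (- z^-1) = p.[z^-1] * expR (- z^-1) / z ^+ 2.
    by rewrite !hornerE exprVn; ring.
  by rewrite normrM normfV (ger0_norm (sqr_ge0 z)) ler_pdivrMr// exprn_gt0.
Unshelve. all: by end_near. Qed.

(** A class of smooth functions closed under differentiation by construction. *)
Inductive flat_algebra : (R -> R) -> Prop :=
| flat_algebra_flat p : flat_algebra (flat p)
| flat_algebra_cst k : flat_algebra (fun=> k)
| flat_algebra_comp f k c : flat_algebra f ->
    flat_algebra (fun x => f (k * x + c))
| flat_algebraD f g : flat_algebra f -> flat_algebra g ->
    flat_algebra (fun x => f x + g x)
| flat_algebraM f g : flat_algebra f -> flat_algebra g ->
    flat_algebra (fun x => f x * g x).

Lemma is_derive_affine k c x : is_derive x (1 : R) (fun y : R => k * y + c) k.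
Proof.
have := is_deriveD (is_deriveZ k (is_derive_id x (1 : R))) (is_derive_cst c x (1 : R)).
by rewrite addr0 [_ *: _]mulr1.
Qed.

Lemma is_derive_comp_affine f k c x l : is_derive (k * x + c) (1 : R) f l ->
  is_derive x (1 : R) (fun y : R => f (k * y + c)) (l * k).
Proof.
move=> H; apply: (@is_derive1_comp _ f (fun y : R => k * y + c)) => //.
exact: is_derive_affine.
Qed.

Lemma flat_algebra_derive f : flat_algebra f ->
  exists2 g, flat_algebra g & forall x, is_derive x (1 : R) f (g x).
Proof.
elim=> {f} [p|k|f k c _ [g gs H]|f g fs [f' f's Hf] gs [g' g's Hg]
           |f g fs [f' f's Hf] gs [g' g's Hg]].
- exists (flat ('X^2 * (p - p^`()))); [exact: flat_algebra_flat|].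
  by move=> x; exact: is_derive_flat.
- exists (fun=> 0); [exact: flat_algebra_cst|] => x; exact: is_derive_cst.
- exists (fun x => g (k * x + c) * k).
    by apply: flat_algebraM; [exact: flat_algebra_comp|exact: flat_algebra_cst].
  by move=> x; exact: is_derive_comp_affine.
- exists (fun x => f' x + g' x); first exact: flat_algebraD.
  by move=> x; exact: is_deriveD.
- exists (fun x => f x * g' x + g x * f' x).
    by apply: flat_algebraD; exact: flat_algebraM.
  by move=> x; exact: (is_deriveM (Hf x) (Hg x)).
Qed.

Lemma is_derive_derive1 f g : (forall x, is_derive x (1 : R) f (g x)) ->
  f^`()%classic = g.
Proof. by move=> H; apply/funext => x; rewrite derive1E; have [_ h] := H x; exact: h. Qed.

Lemma flat_algebra_derivable f n x : flat_algebra f -> derivable (f^`(n)%classic) x 1.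
Proof.
move=> fs; have : flat_algebra (f^`(n)%classic).
  elim: n => [|n IH]; first by rewrite derive1n0.
  by have [g gs H] := flat_algebra_derive IH; rewrite derive1nS (is_derive_derive1 H).
by move=> /flat_algebra_derive[g _ H]; have [h _] := H x; exact: h.
Qed.

Definition bump x := flat 1 x * flat 1 (- 1 * x + 1).

Lemma flat_algebra_bump : flat_algebra bump.
Proof.
apply: flat_algebraM; first exact: flat_algebra_flat.
by apply: flat_algebra_comp; exact: flat_algebra_flat.
Qed.

Lemma flat1E x : flat 1 x = if 0 < x then expR (- x^-1) else 0.
Proof. by rewrite /flat hornerC mul1r. Qed.

Lemma bump_ge0 x : 0 <= bump x.
Proof. by rewrite /bump !flat1E mulr_ge0//; case: ifP => // _; exact: expR_ge0. Qed.

Lemma bump_out x : x <= 0 \/ 1 <= x -> bump x = 0.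
Proof.
rewrite /bump !flat1E; case=> h.
  by rewrite ifF ?mul0r// ltNge h.
by rewrite [X in _ * X]ifF ?mulr0//; apply/negbTE; rewrite -leNgt; lra.
Qed.

Lemma bump_continuous : continuous bump.
Proof.
move=> x; have [g _ H] := flat_algebra_derive flat_algebra_bump.
by apply/differentiable_continuous/derivable1_diffP; case: (H x).
Qed.

Definition bump_mass := integ 0 1 bump.

Lemma bump_mass_gt0 : 0 < bump_mass.
Proof.
have ci a b : integrable_on a b bump by apply: continuous_integrable_on; exact: bump_continuous.
rewrite /bump_mass (@integ_cat _ 0 (4^-1) 1)//; try by lra.
rewrite (@integ_cat _ (4^-1) (2^-1) 1)//; try by lra.
apply: (@lt_le_trans _ _ (integ 4^-1 2^-1 bump)); last first.
  rewrite addrCA lerDl addr_ge0//; apply: integ_ge0 => x _ _; exact: bump_ge0.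
apply: (@lt_le_trans _ _ (integ (4^-1) (2^-1) (fun=> expR (-4) * expR (-4)))).
  rewrite integ_cst; last by lra.
  by rewrite !mulr_gt0 ?expR_gt0//; lra.
apply: le_integ => //; first exact: integrable_on_cst.
move=> x x1 x2; rewrite /bump !flat1E !ifT; try by lra.
have V y : 4^-1 <= y -> expR (-4) <= expR (- y^-1).
  move=> y4; rewrite ler_expR lerN2 invf_ple ?posrE//; lra.
by rewrite ler_pM ?expR_ge0//; apply: V; lra.
Qed.

Definition step x := integ (-1) x bump.

Lemma step0 x : x <= 0 -> step x = 0.
Proof.
move=> x0; rewrite /step; have [xl|xl] := ltP x (-1); first by rewrite integ_lt.
rewrite (@eq_integ _ _ _ _ (fun=> 0)) ?integ_cst ?mul0r// => y _ yx.
by rewrite bump_out//; left; lra.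
Qed.

Lemma step_cat x y : -1 <= x -> x <= y -> step y = step x + integ x y bump.
Proof.
move=> x1 xy; rewrite /step -integ_cat//.
by apply: continuous_integrable_on; exact: bump_continuous.
Qed.

Lemma step1 x : 1 <= x -> step x = bump_mass.
Proof.
move=> x1; rewrite (@step_cat 1 x)//; try by lra.
rewrite (@step_cat 0 1)//; try by lra.
rewrite step0// add0r -[RHS]addr0; congr (_ + _).
rewrite (@eq_integ _ _ _ _ (fun=> 0)) ?integ_cst ?mul0r// => y ? ?.
by rewrite bump_out//; right; lra.
Qed.

Lemma is_derive_step x : is_derive x (1 : R) step (bump x).
Proof.
have [x0|x0] := ltP x 0.
  rewrite bump_out; last by left; lra.
  apply: (@near_eq_is_derive _ _ _ (cst 0)).
  near=> y; rewrite step0//; apply: ltW; near: y; exact: lt_nbhsl.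
have := @continuous_FTC1_closed _ bump (-1) x (x + 1).
rewrite ltrDl => /(_ ltr01); case.
- by apply: continuous_integrable_on; exact: bump_continuous.
- lra.
- exact: bump_continuous.
- by move=> h1 h2; split; [exact: h1|rewrite -derive1E].
Unshelve. all: by end_near. Qed.

Lemma step_bounds x : 0 <= step x /\ step x <= bump_mass.
Proof.
have I a b : integrable_on a b bump by apply: continuous_integrable_on; exact: bump_continuous.
have I0 a b : 0 <= integ a b bump by apply: integ_ge0 => *; exact: bump_ge0.
split; first exact: I0.
have [x1|x1] := leP 1 x; first by rewrite step1.
have [xl|xl] := ltP x (-1); first by rewrite step0 ?ltW ?bump_mass_gt0//; lra.
by rewrite -(@step1 1)// (@step_cat x 1)// ?lerDl//; exact: ltW.
Qed.

Lemma scaled_bump_out n p x : 0 < n -> x <= p \/ p + n^-1 <= x ->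
  bump (n * (x - p)) = 0.
Proof.
move=> n0 [h|h]; rewrite bump_out//; [left|right].
  by rewrite pmulr_rle0// subr_le0.
by rewrite -ler_pdivrMl// mulr1 lerBrDl.
Qed.

Lemma scaled_step0 n p x : 0 < n -> x <= p -> step (n * (x - p)) = 0.
Proof. by move=> n0 h; rewrite step0// pmulr_rle0// subr_le0. Qed.

Lemma scaled_step1 n p x : 0 < n -> p + n^-1 <= x -> step (n * (x - p)) = bump_mass.
Proof. by move=> n0 h; rewrite step1// -ler_pdivrMl// mulr1 lerBrDl. Qed.

Lemma is_derive_scaled_step n p x :
  is_derive x (1 : R) (fun y => step (n * (y - p))) (n * bump (n * (x - p))).
Proof.
have E y : n * (y - p) = n * y + (- (n * p)) by ring.
have -> : (fun y => step (n * (y - p))) = (fun y => step (n * y + (- (n * p)))).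
  by apply/funext => y; rewrite E.
apply: (is_derive_eq (is_derive_comp_affine (is_derive_step _))).
by rewrite E mulrC.
Qed.

Lemma scaled_bump_continuous n p : continuous (fun x => n * bump (n * (x - p))).
Proof.
move=> x; apply: cvgM; first exact: cvg_cst.
apply: (@continuous_comp _ _ _ (fun x : R => n * (x - p)) bump); last exact: bump_continuous.
apply: cvgM; first exact: cvg_cst.
by apply: cvgB; [exact: cvg_id|exact: cvg_cst].
Qed.

(** The rescaled bumps are an approximate identity of mass [bump_mass]. *)
Lemma integ_scaled_bump F lo hi n p e : continuous F -> 0 < n -> 0 <= e ->
  lo <= p -> p + n^-1 <= hi ->
  (forall x, p <= x -> x <= p + n^-1 -> `|F x - F p| <= e) ->
  `|integ lo hi (fun x => F x * (n * bump (n * (x - p)))) - bump_mass * F p| <=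
  e * bump_mass.
Proof.
move=> cF n0 e0 lop phi Fe.
have w0 x : 0 <= n * bump (n * (x - p)) by rewrite mulr_ge0 ?bump_ge0// ltW.
have cw := @scaled_bump_continuous n p.
have iw : integrable_on lo hi (fun x => n * bump (n * (x - p))) by exact: continuous_integrable_on.
have iFw : integrable_on lo hi (fun x => F x * (n * bump (n * (x - p)))).
  by apply: integrable_onM => //; exact: continuous_subspaceT.
have lh : lo <= hi by apply: le_trans phi; rewrite (le_trans lop)// lerDl invr_ge0 ltW.
have M : integ lo hi (fun x => n * bump (n * (x - p))) = bump_mass.
  have [_ /(_ lo hi) <-//] := C1_primitive_on lo hi (is_derive_scaled_step n p) cw.
  by rewrite scaled_step1// scaled_step0// subr0.
rewrite -{1 2}M [_ * F p]mulrC -(integZ (F p) iw) -integB//; last exact: integrable_onZ.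
apply: (le_trans (le_norm_integ _)).
  by apply: integrable_onB => //; exact: integrable_onZ.
rewrite -integZ//; apply: le_integ.
- by apply: integrable_on_norm; apply: integrable_onB => //; exact: integrable_onZ.
- exact: integrable_onZ.
- move=> x _ _; rewrite -mulrBl normrM [X in _ * X]ger0_norm//.
  have [xp|xp] := leP p x; last by rewrite scaled_bump_out ?mulr0//; left; exact: ltW.
  have [xn|xn] := leP x (p + n^-1); first by rewrite ler_wpM2r// Fe.
  by rewrite scaled_bump_out ?mulr0//; right; exact: ltW.
Qed.

Lemma Rintegral_supp lo hi f : (forall x, ~~ (lo <= x <= hi) -> f x = 0) ->
  \int[mu]_x f x = integ lo hi f.
Proof.
move=> H; rewrite /integ [RHS]Rintegral_mkcond; apply: eq_Rintegral => x _.
rewrite patchE; case: ifPn => // /negP xI; apply: H; apply/negP => h; apply: xI.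
by rewrite inE/= in_itv.
Qed.

Lemma locally_integrable_integrable_on f a b : locally_integrable setT f ->
  integrable_on a b f.
Proof.
move=> [mf _ H]; apply/integrableP; split.
  by apply/measurable_EFinP; exact: measurable_funS mf.
by apply: (H `[a, b]%classic) => //; exact: segment_compact.
Qed.

Lemma integrable_on_locally_integrable f : measurable_fun setT f ->
  (forall a b, integrable_on a b f) -> locally_integrable setT f.
Proof.
move=> mf fi; split => //; first exact: openT.
move=> K _ cK; have /compact_bounded[M [Mr HM]] := cK.
have KI : K `<=` `[- (M + 1), M + 1].
  move=> x Kx; have := HM (M + 1); rewrite ltrDl => /(_ ltr01 x Kx)/=.
  by rewrite in_itv/= -ler_norml.
have := fi (- (M + 1)) (M + 1) => /integrableP[_]; apply: le_lt_trans.
apply: ge0_subset_integral => //.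
- by apply: compact_measurable.
- by apply/measurable_EFinP; apply: measurableT_comp => //; exact: measurable_funS mf.
Qed.

(** A smoothed indicator function of [a, b]. *)
Lemma test_function_step_diff a b n : 0 < n -> a <= b ->
  test_function (fun x => step (n * (x - a)) - step (n * (x - b))).
Proof.
move=> n0 ab.
pose dphi x := n * bump (n * (x - a)) - n * bump (n * (x - b)).
have D x : is_derive x (1 : R) (fun x => step (n * (x - a)) - step (n * (x - b))) (dphi x).
  by apply: is_deriveB; exact: is_derive_scaled_step.
have dphiS : flat_algebra dphi.
  have -> : dphi = fun x => n * bump (n * x + - (n * a)) + (- n) * bump (n * x + - (n * b)).
    by apply/funext => x; rewrite /dphi !mulrBr mulNr.
  by apply: flat_algebraD; apply: flat_algebraM; try exact: flat_algebra_cst;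
     apply: flat_algebra_comp; exact: flat_algebra_bump.
split.
- case=> [|m] x; first by rewrite derive1n0; have [h _] := D x; exact: h.
  by rewrite derive1Sn (is_derive_derive1 D); exact: flat_algebra_derivable.
- apply: (@subclosed_compact _ _ `[a, b + n^-1]).
  + exact: closed_closure.
  + exact: segment_compact.
  + have cl : closed (`[a, b + n^-1]%classic : set R) by exact: itv_closed.
    rewrite closure_id in cl; rewrite [X in _ `<=` X]cl; apply: closureS => x /=.
    rewrite in_itv/=; apply: contraR; rewrite negb_and -!ltNge => /orP[h|h].
      by rewrite !scaled_step0 ?subrr// ltW// (lt_le_trans h).
    by rewrite !scaled_step1 ?subrr// ltW//; apply: le_lt_trans h; rewrite lerD2r.
Qed.

Lemma ball_of_window p x m d : p <= x -> x <= p + m -> m < d -> ball p d x.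
Proof.
move=> px xp md; rewrite /ball/= distrC ger0_norm ?subr_ge0// ltrBlDl.
by apply: le_lt_trans xp _; rewrite ltrD2l.
Qed.

Lemma weak_derivative_assembly (A1 A2 A3 A4 A5 Fa Fb I c e : R) :
  A3 - c * I = A4 + A5 -> `|A1 - c * Fa| <= e * c -> `|A2 - c * Fb| <= e * c ->
  `|A4| <= c * e -> `|A5| <= c * e -> A1 - A2 = - A3 ->
  `|c * (Fb - Fa - I)| <= c * (e * 4).
Proof.
rewrite !ler_norml => Eg /andP[? ?] /andP[? ?] /andP[? ?] /andP[? ?] EQ.
by apply/andP; split; lra.
Qed.

(** Testing against smoothed indicator functions of [a, b]: their derivative is
    an approximate identity at a minus one at b, so the limit is the increment
    of F on one side and the integral of g on the other. *)
Lemma weak_derivative_primitive F g lo hi : continuous F ->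
  is_weak_derivative F g -> primitive_on lo hi F g.
Proof.
move=> cF [_ Lg W]; have gi x y : integrable_on x y g by exact: locally_integrable_integrable_on.
split => // a b _ + _; rewrite le_eqVlt => /predU1P[->|ab].
  by rewrite subrr integ_pt.
set c := bump_mass; have c0 : 0 < c := bump_mass_gt0.
apply/eqP; rewrite -subr_eq0 -normr_le0.
suff : forall e, 0 < e -> `|F b - F a - integ a b g| <= e * 4 by move=> /le0_eps_mul.
move=> e e0.
have Ga : primitive_on a (b + 1) (fun x => integ a x (fun x => `|g x|)) (fun x => `|g x|).
  split => [|x y ax xy _]; first exact: integrable_on_norm.
  rewrite (@integ_cat _ a x y)//; first by ring.
  exact: integrable_on_norm.
have [|d1 d10 H1] := primitive_onP Ga (lexx a) _ e0; first by lra.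
have [||d2 d20 H2] := primitive_onP Ga (c := b) _ _ e0; [lra|lra|].
have /cvgrPdist_le/(_ _ e0)/nbhs_ballP[d3 /= d30 H3] := cF a.
have /cvgrPdist_le/(_ _ e0)/nbhs_ballP[d4 /= d40 H4] := cF b.
pose M := Num.min (Num.min (Num.min d1 d2) (Num.min d3 d4)) (Num.min (b - a) 1).
have M0 : 0 < M by rewrite !lt_min d10 d20 d30 d40 subr_gt0 ab ltr01.
pose m := M / 2.
have m0 : 0 < m by rewrite divr_gt0.
have mM : m < M by rewrite ltr_pdivrMr// ltr_pMr// ltr1n.
have [m1 [m2 [m3 [m4 [m5 m6]]]]] : m < d1 /\ m < d2 /\ m < d3 /\ m < d4 /\
    m < b - a /\ m < 1.
  by do !split; apply: (lt_le_trans mM); rewrite /M !ge_min lexx ?orbT.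
pose n := m^-1; have n0 : 0 < n by rewrite invr_gt0.
have nV : n^-1 = m by rewrite invrK.
pose phi x := step (n * (x - a)) - step (n * (x - b)).
pose dphi x := n * bump (n * (x - a)) - n * bump (n * (x - b)).
have D x : is_derive x (1 : R) phi (dphi x).
  by apply: is_deriveB; exact: is_derive_scaled_step.
have := W phi (test_function_step_diff n0 (ltW ab)).
rewrite (is_derive_derive1 D).
have ab' := ltW ab.
have amb : a + m <= b by rewrite -lerBrDl ltW.
have b1 : b + m <= b + 1 by rewrite lerD2l ltW.
have phi0 x : x <= a -> phi x = 0.
  by move=> xa; rewrite /phi !scaled_step0 ?subrr//; exact: le_trans xa _.
have phi1 x : b + m <= x -> phi x = 0.
  by move=> xb; rewrite /phi !scaled_step1 ?subrr ?nV//; apply: le_trans xb; rewrite lerD2r.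
have phic x : a + m <= x -> x <= b -> phi x = c.
  by move=> xa xb; rewrite /phi scaled_step1 ?nV// scaled_step0// subr0.
have phib x : 0 <= phi x /\ phi x <= c.
  have [xb|xb] := leP x b.
    by rewrite /phi (scaled_step0 n0 xb) subr0; exact: step_bounds.
  rewrite /phi (@scaled_step1 n a)// ?nV; last exact: (le_trans amb (ltW xb)).
  by have [s0 s1] := step_bounds (n * (x - b)); rewrite subr_ge0 gerBl.
rewrite (@Rintegral_supp a (b + 1)); last first.
  move=> x; rewrite negb_and -!ltNge => /orP[h|h].
    by rewrite /dphi !scaled_bump_out ?mulr0 ?subr0 ?mulr0//; left; rewrite ltW// (lt_trans h).
  have bx : b + m <= x := le_trans b1 (ltW h).
  rewrite /dphi !scaled_bump_out ?mulr0 ?subr0 ?mulr0//; right; rewrite nV//.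
  by apply: le_trans bx; rewrite lerD2r.
rewrite (@Rintegral_supp a (b + 1)); last first.
  move=> x; rewrite negb_and -!ltNge => /orP[h|h].
    by rewrite phi0 ?mulr0//; exact: ltW.
  by rewrite phi1 ?mulr0// (le_trans b1)// ltW.
have iFw p : integrable_on a (b + 1) (fun x => F x * (n * bump (n * (x - p)))).
  apply: continuous_integrable_on => x; apply: cvgM; first exact: cF.
  exact: scaled_bump_continuous.
rewrite (_ : (fun x => F x * dphi x) = fun x => F x * (n * bump (n * (x - a))) -
   F x * (n * bump (n * (x - b)))); last by apply/funext => x; rewrite /dphi mulrBr.
rewrite integB//.
have Ea : `|integ a (b + 1) (fun x => F x * (n * bump (n * (x - a)))) - c * F a| <= e * c.
  apply: integ_scaled_bump; rewrite ?nV//; first exact: ltW.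
    by rewrite (le_trans amb)// lerDl.
  by move=> x ax xa; rewrite distrC; apply: H3; exact: ball_of_window m3.
have Eb : `|integ a (b + 1) (fun x => F x * (n * bump (n * (x - b)))) - c * F b| <= e * c.
  apply: integ_scaled_bump; rewrite ?nV//; first exact: ltW.
  by move=> x ax xa; rewrite distrC; apply: H4; exact: ball_of_window m4.
have phic' : continuous phi.
  by move=> x; apply/differentiable_continuous/derivable1_diffP; case: (D x).
have igp x y : integrable_on x y (fun x => g x * phi x).
  apply: (eq_integrable_on (f := fun x => phi x * g x)); first by move=> *; rewrite mulrC.
  by apply: integrable_onM => //; exact: continuous_subspaceT.
have igpc x y : integrable_on x y (fun x => g x * phi x - c * g x).
  by apply: integrable_onB => //; exact: integrable_onZ.
have [L1 [L2 [L3 [L4 [L5 L6]]]]] : a <= a + m /\ a + m <= b /\ a + m <= b + 1 /\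
    b <= b + m /\ b + m <= b + 1 /\ b <= b + 1.
  by clear -m0 m5 m6 ab; do !split; lra.
have Eg : integ a (b + 1) (fun x => g x * phi x) - c * integ a b g =
    integ a (a + m) (fun x => g x * phi x - c * g x) + integ b (b + m) (fun x => g x * phi x).
  rewrite (@integ_cat _ a (a + m) (b + 1))//.
  rewrite (@integ_cat _ (a + m) b (b + 1))//.
  rewrite (@integ_cat _ b (b + m) (b + 1))//.
  rewrite (@integ_cat _ a (a + m) b)//.
  rewrite integB//; last exact: integrable_onZ.
  rewrite integZ//.
  rewrite [integ (b + m) _ _](@eq_integ _ _ _ _ (fun=> 0)); last first.
    by move=> x xb _; rewrite phi1 ?mulr0.
  rewrite integ_cst ?mul0r ?addr0//.
  rewrite [integ (a + m) b (fun x => g x * phi x)](@eq_integ _ _ _ _ (fun x => c * g x)); last first.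
    by move=> x xa xb; rewrite phic// mulrC.
  rewrite integZ//; ring.
have B1 : `|integ a (a + m) (fun x => g x * phi x - c * g x)| <= c * e.
  apply: (le_trans (le_norm_integ _)) => //.
  apply: (@le_trans _ _ (integ a (a + m) (fun x => c * `|g x|))).
    apply: le_integ; first exact: integrable_on_norm.
      by apply: integrable_onZ; exact: integrable_on_norm.
    move=> x xa xm; rewrite (_ : g x * phi x - c * g x = (phi x - c) * g x); last by ring.
    rewrite normrM ler_wpM2r//; have [p0 p1] := phib x.
    by rewrite distrC ger0_norm ?subr_ge0// gerBl.
  rewrite integZ; last exact: integrable_on_norm.
  rewrite ler_pM2l//; have h : `|a + m - a| < d1 by rewrite addrAC subrr add0r gtr0_norm.
  have := H1 (a + m) L1 L3 h; rewrite integ_pt subr0.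
  by move=> /ltW; apply: le_trans; exact: ler_norm.
have B2 : `|integ b (b + m) (fun x => g x * phi x)| <= c * e.
  apply: (le_trans (le_norm_integ _)) => //.
  apply: (@le_trans _ _ (integ b (b + m) (fun x => c * `|g x|))).
    apply: le_integ; first exact: integrable_on_norm.
      by apply: integrable_onZ; exact: integrable_on_norm.
    by move=> x xa xm; rewrite mulrC normrM ler_wpM2r//; have [p0 p1] := phib x; rewrite ger0_norm.
  rewrite integZ; last exact: integrable_on_norm.
  rewrite ler_pM2l//; have h : `|b + m - b| < d2 by rewrite addrAC subrr add0r gtr0_norm.
  have := H2 (b + m) (le_trans (ltW ab) L4) L5 h.
  rewrite (@integ_cat _ a b (b + m))//; last exact: integrable_on_norm.
  rewrite addrAC subrr add0r.
  by move=> /ltW; apply: le_trans; exact: ler_norm.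
move=> EQ.
have : `|c * (F b - F a - integ a b g)| <= c * (e * 4).
  move: Eg Ea Eb B1 B2 EQ.
  set A1 := integ _ _ (fun x => F x * (n * bump (n * (x - a)))).
  set A2 := integ _ _ (fun x => F x * (n * bump (n * (x - b)))).
  set A3 := integ a (b + 1) _; set A4 := integ a (a + m) _; set A5 := integ b _ _.
  exact: weak_derivative_assembly.
by rewrite normrM (gtr0_norm c0) ler_pM2l.
Qed.

Lemma primitive_weak_derivative F f : continuous F -> measurable_fun setT f ->
  (forall lo hi, primitive_on lo hi F f) -> is_weak_derivative F f.
Proof.
move=> cF mf Ff; split.
- apply: integrable_on_locally_integrable => [|a b]; last exact: continuous_integrable_on.
  exact: continuous_measurable_fun.
- apply: integrable_on_locally_integrable => // a b; by have [] := Ff a b.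
move=> phi [sm /compact_bounded[M [Mr HM]]].
have dphi x : is_derive x (1 : R) phi (phi^`()%classic x).
  by split; [have := sm 0%N x; rewrite derive1n0|rewrite derive1E].
have cphi : continuous (phi^`()%classic).
  move=> x; apply/differentiable_continuous/derivable1_diffP.
  by have := sm 1%N x; rewrite derive1n1.
have phi0 x : M + 1 < `|x| -> phi x = 0.
  move=> xM; apply/eqP; apply: contraTT xM => px; rewrite -leNgt.
  have := HM (M + 1); rewrite ltrDl => /(_ ltr01 x); apply; exact: subset_closure.
pose N := `|M| + 2.
have N0 : M + 1 < N by rewrite /N; have := ler_norm M; lra.
have N00 : 0 < N by rewrite /N ltr_wpDl.
have dphi0 x : N < `|x| -> phi^`()%classic x = 0.
  move=> xN; rewrite derive1E.
  have H : is_derive x (1 : R) phi 0.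
    apply: (@near_eq_is_derive _ _ _ (cst 0)).
    near=> y; rewrite phi0//; apply: (lt_trans N0); near: y.
    apply: (cvgr_gt `|x|) => //.
    exact: norm_continuous.
  by have [_ h] := H; exact: h.
have out x : ~~ (- (N + 1) <= x <= N + 1) -> N < `|x|.
  by rewrite -ler_norml -ltNge; apply: lt_trans; rewrite ltrDl.
rewrite (@Rintegral_supp (- (N + 1)) (N + 1)); last first.
  by move=> x /out/dphi0 ->; rewrite mulr0.
rewrite (@Rintegral_supp (- (N + 1)) (N + 1)); last first.
  by move=> x /out xN; rewrite phi0 ?mulr0// (lt_trans N0).
have [_ /(_ (- (N + 1)) (N + 1))] := primitive_onM (Ff (- (N + 1)) (N + 1))
  (C1_primitive_on (- (N + 1)) (N + 1) dphi cphi).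
have NN : N < N + 1 by rewrite ltrDl.
rewrite !phi0 ?normrN ?ger0_norm ?addr_ge0 ?(ltW N00)//; try exact: lt_trans NN.
rewrite !mulr0 subrr lexx => /(_ isT); rewrite lexx => H.
have {H} := H _ isT; rewrite integD.
- move=> E; apply/eqP; rewrite -addr_eq0 addrC; apply/eqP; rewrite -E//; lra.
- apply: (eq_integrable_on (f := fun x => phi x * f x)); first by move=> *; rewrite mulrC.
  apply: integrable_onM; last by have [] := Ff (- (N + 1)) (N + 1).
  apply: continuous_subspaceT => x.
  by apply/differentiable_continuous/derivable1_diffP; case: (dphi x).
- apply: continuous_integrable_on => x; apply: cvgM; [exact: cF|exact: cphi].
Unshelve. all: by end_near. Qed.

End WeakDerivative.

(** * Derivatives almost everywhere *)

Section RealFunctions.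
Context {R : realType}.
Local Notation mu := (@lebesgue_measure R).
Implicit Types (a b c d e k lo hi r s t x y z : R) (f g F G : R -> R).

Lemma is_derive_epsP f c d : is_derive c (1 : R) f d <->
  (forall e, 0 < e -> exists2 r, 0 < r &
     forall y, `|y - c| < r -> `|f y - f c - d * (y - c)| <= e * `|y - c|).
Proof.
split.
- move=> [/cvg_ex[l H] D] e e0.
  have ld : l = d by rewrite -D; apply/esym; exact: cvg_lim H.
  move: H; rewrite ld => /cvgrPdist_le/(_ _ e0); rewrite near_withinE.
  move=> /nbhs_ballP[r /= r0 Hr]; exists r => // y yc.
  have [->|yne] := eqVneq y c; first by rewrite !subrr mulr0 subrr normr0 mulr0.
  have h0 : y - c != 0 by rewrite subr_eq0.
  have := Hr (y - c); rewrite /ball/= sub0r normrN => /(_ yc h0).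
  rewrite /= [_ *: 1]mulr1 subrK /GRing.scale/= => h.
  have -> : f y - f c - d * (y - c) = - ((d - (y - c)^-1 * (f y - f c)) * (y - c)).
    by field.
  by rewrite normrN normrM ler_wpM2r.
- move=> H.
  have K : h^-1 *: ((f \o shift c) (h *: (1 : R)) - f c) @[h --> 0^'] --> d.
    apply/cvgrPdist_le => e e0; have [r r0 Hr] := H e e0.
    rewrite near_withinE; apply/nbhs_ballP; exists r => // h.
    rewrite /ball/= sub0r normrN => hr h0.
    rewrite [_ *: 1]mulr1 /GRing.scale/=.
    have := Hr (h + c); rewrite addrK => /(_ hr) Q.
    have -> : d - h^-1 * (f (h + c) - f c) = - ((f (h + c) - f c - d * h) / h) by field.
    by rewrite normrN normrM normfV ler_pdivrMr ?normr_gt0.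
  by split; [apply/cvg_ex; exists d|exact: cvg_lim K].
Qed.

Lemma primitive_on_ae_derive lo hi F f : primitive_on lo hi F f ->
  {ae mu, forall x, lo < x -> x < hi -> is_derive x (1 : R) F (f x)}.
Proof.
move=> [fi FE].
pose g := f \_ `[lo, hi].
have gi : mu.-integrable setT (EFin \o g).
  have := proj1 (@integrable_mkcond _ _ _ mu _ (EFin \o f) (measurable_itv `[lo, hi])) fi.
  by rewrite restrict_EFin.
have /lebesgue_differentiation := open_integrable_locally openT gi.
apply: filterS; first exact: (ae_filter_ringOfSetsType mu).
move=> x gx lx xh.
have gi' : mu.-integrable `[lo, hi] (EFin \o g) by apply: integrableS gi.
have [//|] := @FTC1_lebesgue_pt _ g (BLeft lo) x hi xh gi' _ gx.
rewrite derive1E => D1 D2.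
have gxE : g x = f x by rewrite /g patchE ifT// inE/= in_itv/= !ltW.
have : is_derive x (1 : R) (fun y => \int[mu]_(t in `[lo, y]) g t) (f x) by split; rewrite // D2.
move=> /(is_deriveD (is_derive_cst (F lo) x (1 : R))); rewrite add0r.
apply: near_eq_is_derive; near=> y.
have yh : y < hi by near: y; exact: lt_nbhsl.
have ly : lo < y by near: y; exact: lt_nbhsr.
rewrite /= -[LHS]/(F lo + integ lo y g).
rewrite -[RHS](subrK (F lo)) FE//; [|exact: ltW|exact: ltW].
rewrite [RHS]addrC; congr (_ + _).
apply: eq_integ => z lz zy; rewrite /g patchE ifT// inE/= in_itv/= lz/=.
by apply: le_trans zy _; exact: ltW.
Unshelve. all: by end_near. Qed.

(** Outside the exceptional null set the increments are controlled by the
    derivative; on an open neighbourhood of small measure of that null set,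
    the Lipschitz bound costs little. *)
Lemma lipschitz_ae_nonincreasing (phi : R -> R) a b k : a <= b ->
  (forall x y, a <= x -> x <= y -> y <= b -> `|phi y - phi x| <= k * (y - x)) ->
  {ae mu, forall t : R, a < t -> t < b -> exists2 d : R, is_derive t (1 : R) phi d & d <= 0} ->
  phi b <= phi a.
Proof.
move=> ab Lip ae.
suff main : forall N : set R, measurable N -> lebesgue_measure N = 0%E ->
    (forall t, a <= t -> t <= b -> ~ N t -> exists2 d : R, is_derive t (1 : R) phi d & d <= 0) ->
    phi b <= phi a.
  have [N [mN N0 HN]] : mu.-negligible
      (~` [set t | a < t -> t < b -> exists2 d : R, is_derive t (1 : R) phi d & d <= 0] `|`
       ([set a] `|` [set b])).
    apply: negligibleU; first exact: ae.
    by apply: negligibleU; [exists [set a]|exists [set b]]; split => //;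
      exact: lebesgue_measure_set1.
  apply: (main N) => // t at_ tb Nt.
  have H : a < t -> t < b -> exists2 d : R, is_derive t (1 : R) phi d & d <= 0.
    by apply: contrapT => h; apply: Nt; apply: HN; left.
  apply: H; rewrite lt_neqAle ?at_ ?tb ?andbT; apply/eqP => h; apply: Nt; apply: HN; right.
    by left.
  by right.
move=> N mN N0 H.
pose K := `|k|.
have Lip' x y : a <= x -> x <= y -> y <= b -> `|phi y - phi x| <= K * (y - x).
  move=> ax xy yb; apply: (le_trans (Lip _ _ ax xy yb)).
  by rewrite ler_wpM2r ?subr_ge0// ler_norm.
rewrite -subr_le0.
suff : forall e, 0 < e -> phi b - phi a <= e * ((b - a) + K) by move=> /le0_eps_mul.
move=> e e0.
have [|U [oU NU muU]] := lebesgue_regularity_outer mN _ e0.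
  by apply: (@le_lt_trans _ _ 0%E) => //; rewrite le_eqVlt; apply/orP; left; apply/eqP; exact: N0.
have mU : measurable U by exact: open_measurable.
have muUe : (mu U <= e%:E)%E.
  have EU : mu U = (mu N + mu (U `\` N))%E.
    rewrite -measureU ?setDUK//; first exact: measurableD.
    by apply/seteqP; split => // w [Nw [_ /(_ Nw)]].
  by rewrite EU N0 add0e ltW.
have fU x y : mu (U `&` `]x, y]) \is a fin_num.
  rewrite ge0_fin_numE//; apply: le_lt_trans (ltry e); apply: le_trans muUe.
  by apply: le_measure; rewrite ?inE//; exact: measurableI.
pose P x y : Prop := phi y - phi x <= e * (y - x) + K * fine (mu (U `&` `]x, y])).
have : P a b.
  apply: (@interval_induction _ P) => // [x y z ax xy yz zb|c ac cb]; rewrite /P.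
    move=> h1 h2; have -> : U `&` `]x, z] = (U `&` `]x, y]) `|` (U `&` `]y, z]).
      rewrite -setIUr; congr (_ `&` _).
      by rewrite -itv_bndbnd_setU// bnd_simp.
    have -> : mu ((U `&` `]x, y]) `|` (U `&` `]y, z])) =
        (mu (U `&` `]x, y]) + mu (U `&` `]y, z]))%E; last by rewrite fineD//; lra.
      rewrite measureU; [by []|exact: measurableI|exact: measurableI|].
      rewrite setIACA setIid; apply/seteqP; split => // w [_ [/=]].
      by rewrite !in_itv/= => /andP[_ wy] /andP[yw _]; move: (lt_le_trans yw wy); rewrite ltxx.
  have K0 : 0 <= K by exact: normr_ge0.
  have [cU|cU] := pselect (U c).
    have /nbhs_ballP[d /= d0 Hd] : nbhs c U by apply: open_nbhs_nbhs.
    exists d => // x y ax cx xc cy yc yb.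
    have xy := le_trans xc cy.
    have -> : U `&` `]x, y] = `]x, y]%classic.
      apply/seteqP; split => [w []//|w] /=; rewrite in_itv/= => /andP[xw wy]; split.
        by apply: Hd; rewrite /ball/= ltr_norml; apply/andP; split; lra.
      by rewrite xw.
    have -> : fine (mu `]x, y]) = y - x.
      have := lebesgue_measure_itv `]x, y]; rewrite /= => ->; rewrite lte_fin.
      by move: xy; rewrite le_eqVlt => /predU1P[->|->//]; rewrite ltxx subrr.
    have := Lip' _ _ ax xy yb; rewrite ler_norml => /andP[_].
    have : 0 <= e * (y - x) by rewrite mulr_ge0 ?subr_ge0// ltW.
    lra.
  have [d /is_derive_epsP/(_ _ e0)[r r0 Hr] d0] := H c ac cb (fun h => cU (NU _ h)).
  exists r => // x y ax cx xc cy yc yb.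
  have h1 := Hr x; have h2 := Hr y.
  have {}h1 : `|phi x - phi c - d * (x - c)| <= e * (c - x).
    by rewrite -[c - x]opprB -(ler0_norm (x := x - c)) ?h1 ?subr_le0// ltr_norml; apply/andP; split; lra.
  have {}h2 : `|phi y - phi c - d * (y - c)| <= e * (y - c).
    by rewrite -{2}(ger0_norm (x := y - c)) ?h2 ?subr_ge0// ltr_norml; apply/andP; split; lra.
  have q1 : d * (y - c) <= 0 by rewrite mulr_le0_ge0// subr_ge0.
  have q2 : 0 <= d * (x - c) by rewrite mulr_le0// subr_le0.
  have q3 : 0 <= K * fine (mu (U `&` `]x, y])) by rewrite mulr_ge0// fine_ge0.
  move: h1 h2; rewrite !ler_norml => /andP[h1' _] /andP[_ h2''].
  move: h1' h2''; clear -q1 q2 q3 e0; move: (K * _) (d * (y - c)) (d * (x - c)) q1 q2 q3.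
  by move=> ? ? ? *; lra.
rewrite /P => /le_trans; apply; rewrite [e * (_ + K)]mulrDr lerD2l [e * K]mulrC ler_wpM2l ?normr_ge0//.
rewrite -lee_fin fineK//; apply: le_trans muUe.
by apply: le_measure; rewrite ?inE//; exact: measurableI.
Qed.

(** * Existence for ordinary differential equations with continuous velocity *)

Lemma ultra_bounded_cvg (F : set_system nat) (z : nat -> R) k :
  UltraFilter F -> (forall n, `|z n| <= k) ->
  exists l : R, z n @[n --> F] --> l.
Proof.
move=> FU zk; have FP : ProperFilter F  by exact: (@ultra_proper _ _ FU).
have := @segment_compact R (- k) k.
move=> /(_ (z @ F)) H; have HI : (z @ F) `[- k, k]%classic.
  have : F (z @^-1` `[- k, k]%classic).
    by apply: filterE => n; rewrite /= in_itv/= -ler_norml; exact: zk.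
  exact.
have [l [_ cl]] := H _ HI; exists l => U Ul.
have [//|nU] := in_ultra_setVsetC (z @^-1` U) FU.
by have [w [] ] := cl (~` U) U nU Ul.
Qed.

(** Peano's theorem. The Euler polygons of step 1/(n+1) converge along an
    ultrafilter, simultaneously at all times, which spares the extraction of a
    subsequence. The modulus of continuity w turns the Euler scheme into the
    estimate that passes to the limit. *)
Lemma characteristic_exists (v : R -> R -> R) (w : R -> R) k x0 :
  (forall t x, `|v t x| <= k) ->
  (forall r t s x y, `|t - s| <= r -> `|x - y| <= r -> `|v t x - v s y| <= w r) ->
  (forall e, 0 < e -> exists2 d, 0 < d & forall r, 0 < r -> r < d -> w r < e) ->
  exists X : R -> R, [/\ X 0 = x0,
    (forall t s, 0 <= t -> 0 <= s -> `|X s - X t| <= k * `|s - t|) &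
    forall t, 0 <= t -> forall e, 0 < e -> exists2 d, 0 < d &
      forall s, 0 <= s -> `|s - t| < d ->
        `|X s - X t - v t (X t) * (s - t)| <= e * `|s - t|].
Proof.
move=> vk vw w0.
have k0 : 0 <= k by apply: le_trans (normr_ge0 _) (vk 0 0).
pose h n : R := n.+1%:R^-1.
have h0 n : 0 < h n by rewrite invr_gt0 ltr0n.
pose E n := fix E (i : nat) : R :=
  if i is j.+1 then E j + h n * v (j%:R * h n) (E j) else x0.
have ES n i : E n i.+1 = E n i + h n * v (i%:R * h n) (E n i) by [].
have Elip n i m : `|E n (i + m)%N - E n i| <= k * (h n * m%:R).
  elim: m => [|m IH]; first by rewrite addn0 subrr normr0 !mulr0.
  rewrite addnS ES addrAC; apply: (le_trans (ler_normD _ _)).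
  rewrite -natr1 !mulrDr mulr1 lerD// normrM (gtr0_norm (h0 n)) mulrC ler_wpM2r//.
  exact: ltW.
have Ediff n i m u W : (forall j, (j < m)%N -> `|v ((i + j)%:R * h n) (E n (i + j)%N) - u| <= W) ->
    `|E n (i + m)%N - E n i - u * (h n * m%:R)| <= W * (h n * m%:R).
  elim: m => [|m IH] Hm; first by rewrite addn0 subrr !mulr0 subrr normr0.
  rewrite addnS ES -natr1.
  have -> : E n (i + m)%N + h n * v ((i + m)%:R * h n) (E n (i + m)%N) - E n i - u * (h n * (m%:R + 1)) =
    (E n (i + m)%N - E n i - u * (h n * m%:R)) + h n * (v ((i + m)%:R * h n) (E n (i + m)%N) - u) by ring.
  apply: (le_trans (ler_normD _ _)); rewrite [h n * (m%:R + 1)]mulrDr mulr1 [W * _]mulrDr lerD//.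
    by apply: IH => j jm; apply: Hm; exact: ltnW.
  rewrite normrM (gtr0_norm (h0 n)) mulrC ler_wpM2r//; first exact: ltW.
  exact: Hm.
pose I n t := Num.truncn (t * n.+1%:R).
have Iitv n t : 0 <= t -> (I n t)%:R * h n <= t /\ t < (I n t)%:R * h n + h n.
  move=> t0; have /andP[h1 h2] : (I n t)%:R <= t * n.+1%:R < (I n t).+1%:R.
    by apply: truncn_itv; rewrite mulr_ge0.
  split; first by rewrite ler_pdivrMr// ltr0n.
  by rewrite -[X in _ + X]mul1r -mulrDl natr1 ltr_pdivlMr// ltr0n.
pose Y n t := E n (I n t).
have Ile n s t : s <= t -> (I n s <= I n t)%N.
  by move=> st; apply: le_truncn; rewrite ler_wpM2r.
have Ywin n s t : 0 <= s -> s <= t -> exists2 m : R,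
    `|m - (t - s)| <= h n & 0 <= m /\ `|Y n t - Y n s| <= k * m.
  move=> s0 st; exists (h n * (I n t - I n s)%:R).
    have [] := Iitv n s s0; have [] := Iitv n t (le_trans s0 st).
    rewrite natrB ?Ile// mulrBr ler_norml ![h n * _]mulrC => *; apply/andP; split; lra.
  split; first by rewrite mulr_ge0// ltW.
  by rewrite /Y -{1}(subnKC (Ile n s t st)); exact: Elip.
have Ylip n s t : 0 <= s -> s <= t -> `|Y n t - Y n s| <= k * (t - s) + k * h n.
  move=> s0 st; have [m mh [m0 /le_trans]] := Ywin n s t s0 st; apply.
  rewrite -mulrDr ler_wpM2l//; move: mh; rewrite ler_norml => /andP[]; lra.
have Ydiff n s t q : 0 <= s -> s <= t -> h n <= t - s -> (q = s \/ q = t) ->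
    `|Y n t - Y n s - v q (Y n q) * (t - s)| <=
    w ((k + 1) * (2 * (t - s))) * (t - s + h n) + k * h n.
  move=> s0 st hts qst.
  have t0 := le_trans s0 st.
  pose m := (I n t - I n s)%N.
  have mI : (I n s + m)%N = I n t by rewrite subnKC// Ile.
  have [s1 s2] := Iitv n s s0; have [t1 t2] := Iitv n t t0.
  have hm : h n * m%:R = (I n t)%:R * h n - (I n s)%:R * h n.
    by rewrite /m natrB ?Ile//; ring.
  have : `|Y n t - Y n s - v q (Y n q) * (h n * m%:R)| <=
      w ((k + 1) * (2 * (t - s))) * (h n * m%:R).
    rewrite /Y -mI; apply: Ediff => j jm.
    have hn0 := h0 n.
    have j0 : 0 <= j%:R * h n by rewrite mulr_ge0// ltW.
    have jmh : j%:R * h n + h n <= m%:R * h n.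
      by rewrite -[X in _ + X]mul1r -mulrDl natr1 ler_wpM2r ?ler_nat//; exact: ltW.
    have ijE : (I n s + j)%:R * h n = (I n s)%:R * h n + j%:R * h n by rewrite natrD mulrDl.
    rewrite [m%:R * h n]mulrC hm in jmh.
    have tq : `|(I n s + j)%:R * h n - q| <= 2 * (t - s).
      by rewrite ijE ler_norml; case: qst => ->; apply/andP; split; lra.
    have r1 : 2 * (t - s) <= (k + 1) * (2 * (t - s)).
      by rewrite ler_peMl; lra.
    apply: vw; first exact: le_trans r1.
    have r2 : k * (2 * (t - s)) <= (k + 1) * (2 * (t - s)) by rewrite ler_wpM2r; lra.
    apply: le_trans r2.
    have jI : (I n s + j <= I n t)%N by rewrite -mI leq_add2l ltnW.
    case: qst => ->.
      apply: (le_trans (Elip n _ _)); rewrite ler_wpM2l// mulrC; lra.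
    rewrite distrC -{1}(subnKC jI); apply: (le_trans (Elip n _ _)); rewrite ler_wpM2l//.
    rewrite natrB// natrD mulrC !mulrDl mulNr mulrDl; lra.
  have W0 : 0 <= w ((k + 1) * (2 * (t - s))).
    have r0 : 0 <= (k + 1) * (2 * (t - s)).
      by rewrite mulr_ge0 ?addr_ge0// mulr_ge0// subr_ge0.
    by apply: le_trans (normr_ge0 _) (vw _ 0 0 0 0 _ _); rewrite subrr normr0.
  have mts : `|h n * m%:R - (t - s)| <= h n.
    by rewrite hm ler_norml; apply/andP; split; lra.
  move=> H.
  have -> : Y n t - Y n s - v q (Y n q) * (t - s) =
     (Y n t - Y n s - v q (Y n q) * (h n * m%:R)) + v q (Y n q) * (h n * m%:R - (t - s)) by ring.
  apply: (le_trans (ler_normD _ _)); apply: lerD.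
    apply: (le_trans H); rewrite ler_wpM2l//; move: mts; rewrite ler_norml => /andP[]; lra.
  by rewrite normrM ler_pM.
have [F [FU Foo]] := ultraFilterLemma (eventually_filter : ProperFilter \oo).
have FP : ProperFilter F  by exact: (@ultra_proper _ _ FU).
have hF : h n @[n --> F] --> (0 : R).
  by apply: (cvg_trans _ (@cvg_harmonic R)) => U HU; apply: Foo; exact: HU.
have Ybd t : 0 <= t -> exists l : R, Y n t @[n --> F] --> l.
  move=> t0; apply: (@ultra_bounded_cvg _ _ (`|x0| + (k * t + k))) => // n.
  have := Ylip n 0 t (lexx 0) t0; rewrite {2}/Y /I mul0r truncn0 /= subr0 => H.
  rewrite -(subrK x0 (Y n t)) addrC; apply: (le_trans (ler_normD _ _)); rewrite lerD2l.
  apply: (le_trans H); rewrite lerD2l -[leRHS]mulr1 ler_wpM2l//.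
  by rewrite invf_le1 ?ltr0n// ler1n.
have /choice[X HX] : forall t, exists l : R, 0 <= t -> Y n t @[n --> F] --> l.
  by move=> t; have [/Ybd[l]|] := leP 0 t; [exists l|exists 0].
have X0 : X 0 = x0.
  apply: (cvg_unique _ (HX 0 (lexx 0))); first exact: Rhausdorff.
  have -> : Y^~ 0 = (fun=> x0); last exact: cvg_cst.
  by apply/funext => n; rewrite /Y /I mul0r truncn0.
have Xlip s t : 0 <= s -> s <= t -> `|X t - X s| <= k * (t - s).
  move=> s0 st; have t0 := le_trans s0 st.
  have c1 : `|Y n t - Y n s| @[n --> F] --> `|X t - X s|.
    by apply: cvg_norm; apply: cvgB; exact: HX.
  have c2 : k * (t - s) + k * h n @[n --> F] --> k * (t - s) + k * 0.
    by apply: cvgD; [exact: cvg_cst|apply: cvgM => //; exact: cvg_cst].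
  rewrite mulr0 addr0 in c2; apply: (ler_cvg_to c1 c2).
  by apply: filterE => n; exact: Ylip.
have Xdiff s t q : 0 <= s -> s < t -> (q = s \/ q = t) ->
    `|X t - X s - v q (X q) * (t - s)| <= w ((k + 1) * (2 * (t - s))) * (t - s).
  move=> s0 st qst; have t0 := le_trans s0 (ltW st).
  have q0 : 0 <= q by case: qst => ->.
  have cv : v q (Y n q) @[n --> F] --> v q (X q).
    apply/cvgrPdist_lt => e e0; have [d d0 wd] := w0 e e0.
    have d20 : 0 < d / 2 by rewrite divr_gt0.
    have /cvgrPdist_lt/(_ _ d20) := HX q q0.
    apply: filterS => n /ltW hn; apply: le_lt_trans (wd (d / 2) _ _) => //.
      by apply: vw => //; rewrite subrr normr0 ltW.
    by rewrite ltr_pdivrMr// ltr_pMr// ltr1n.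
  have c1 : `|Y n t - Y n s - v q (Y n q) * (t - s)| @[n --> F] -->
       `|X t - X s - v q (X q) * (t - s)|.
    apply: cvg_norm; apply: cvgB; first by apply: cvgB; exact: HX.
    by apply: cvgM => //; exact: cvg_cst.
  have c2 : w ((k + 1) * (2 * (t - s))) * (t - s + h n) + k * h n @[n --> F] -->
      w ((k + 1) * (2 * (t - s))) * (t - s + 0) + k * 0.
    apply: cvgD; apply: cvgM => //; try exact: cvg_cst.
    by apply: cvgD => //; exact: cvg_cst.
  rewrite mulr0 !addr0 in c2; apply: (ler_cvg_to c1 c2).
  have ts0 : 0 < t - s by rewrite subr_gt0.
  have /cvgrPdist_lt/(_ _ ts0) := hF.
  apply: filterS => n; rewrite sub0r normrN (gtr0_norm (h0 n)) => /ltW hn.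
  by apply: Ydiff => //; exact: ltW.
exists X; split => //.
  move=> t s t0 s0; have [ts|st] := leP t s; first by rewrite [`|s - t|]ger0_norm ?subr_ge0// Xlip.
  have ts0 : 0 <= t - s by rewrite subr_ge0 ltW.
  by rewrite (distrC (X s)) (distrC s) (ger0_norm ts0); exact: Xlip (ltW st).
move=> t t0 e e0; have [d d0 wd] := w0 e e0.
have k10 : 0 < (k + 1) * 2 by rewrite mulr_gt0// ltr_wpDl.
exists (d / ((k + 1) * 2)); first by rewrite divr_gt0.
have small r : 0 < r -> r < d / ((k + 1) * 2) -> w ((k + 1) * (2 * r)) < e.
  move=> r0; rewrite ltr_pdivlMr// => rd; apply: wd; first by rewrite mulrA mulr_gt0.
  by rewrite mulrA mulrC.
move=> s s0; have [ts|st|->] := ltgtP t s.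
- have ts0 : 0 < s - t by rewrite subr_gt0.
  rewrite (gtr0_norm ts0) => /(small _ ts0)/ltW we.
  apply: (le_trans (Xdiff t s t t0 ts _)); first by left.
  by rewrite ler_wpM2r// ltW.
- have ts0 : 0 < t - s by rewrite subr_gt0.
  rewrite distrC (gtr0_norm ts0) => /(small _ ts0)/ltW we.
  have -> : X s - X t - v t (X t) * (s - t) = - (X t - X s - v t (X t) * (t - s)) by ring.
  rewrite normrN; apply: (le_trans (Xdiff s t t s0 st _)); first by right.
  by rewrite ler_wpM2r// ltW.
- by move=> _; rewrite !subrr mulr0 subrr normr0 mulr0.
Qed.

End RealFunctions.

(** * Square-integrable functions and derivatives on the line *)

Section Sobolev.
Context {R : realType}.
Local Notation mu := (@lebesgue_measure R).
Implicit Types (a b c d e k lo hi r s t x y z : R) (f g F G : R -> R).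

Lemma ae_impl (P Q : R -> Prop) : (forall x, P x -> Q x) ->
  {ae mu, forall x, P x} -> {ae mu, forall x, Q x}.
Proof. by move=> PQ; apply: negligibleS => x /= nQ /PQ. Qed.

Lemma ae_impl2 (P Q S : R -> Prop) : (forall x, P x -> Q x -> S x) ->
  {ae mu, forall x, P x} -> {ae mu, forall x, Q x} -> {ae mu, forall x, S x}.
Proof.
move=> PQS HP HQ; apply: (negligibleS _ (negligibleU HP HQ)) => x /= nS.
by have [Px|] := pselect (P x); [right=> Qx; exact: nS (PQS x Px Qx)|left].
Qed.

Lemma L2_measurable f : L2 f -> measurable_fun setT f.
Proof. by rewrite /L2 inE => /andP[]; rewrite inE. Qed.

Lemma L2_sqr_integrable f : L2 f ->
  mu.-integrable setT (EFin \o (fun x => f x ^+ 2)).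
Proof. exact: Lfun2_integrable_sqr. Qed.

Lemma is_derive_unique_val f x d d' : is_derive x (1 : R) f d ->
  is_derive x (1 : R) f d' -> d = d'.
Proof. by move=> [_ <-] [_ <-]. Qed.

Lemma primitive_ae_derive F f : (forall lo hi, primitive_on lo hi F f) ->
  {ae mu, forall x, is_derive x (1 : R) F (f x)}.
Proof.
move=> H.
have : forall n : nat, {ae mu, forall x : R, - n%:R < x -> x < n%:R -> is_derive x (1 : R) F (f x)}.
  by move=> n; apply: primitive_on_ae_derive.
move=> /ae_foralln; apply: ae_impl => x Hx; pose n := (Num.truncn `|x|).+1.
have : `|x| < n%:R by have /andP[] := truncn_itv (normr_ge0 x).
by rewrite ltr_norml => /andP[h1 h2]; exact: (Hx n).
Qed.

Lemma primitive_ae_unique F f g : (forall lo hi, primitive_on lo hi F f) ->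
  (forall lo hi, primitive_on lo hi F g) -> {ae mu, forall x, f x = g x}.
Proof.
move=> /primitive_ae_derive fF /primitive_ae_derive gF.
by apply: (ae_impl2 _ fF gF) => x h1 h2; exact: is_derive_unique_val h1 h2.
Qed.

Lemma weak_derivative_Dx f g : is_weak_derivative f g -> is_weak_derivative f (Dx f).
Proof. by move=> fg; exact: (xgetPex (fun=> 0) (ex_intro _ g fg)). Qed.

Lemma sqr_integrable_ae f g : measurable_fun setT f -> {ae mu, forall x, f x = g x} ->
  measurable_fun setT g ->
  mu.-integrable setT (EFin \o (fun x => g x ^+ 2)) ->
  mu.-integrable setT (EFin \o (fun x => f x ^+ 2)).
Proof.
move=> mf fg mg /integrableP[_ gi]; apply/integrableP; split.
  by apply/measurable_EFinP; exact: measurable_funX.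
rewrite (@ae_eq_integral _ _ _ mu setT (fun x => `|(g x ^+ 2)%:E|%E))//.
- by apply: measurableT_comp => //; apply/measurable_EFinP; exact: measurable_funX.
- by apply: measurableT_comp => //; apply/measurable_EFinP; exact: measurable_funX.
- by apply: (ae_impl _ fg) => x /= -> _.
Qed.

(** For a continuous function the chosen weak derivative is a derivative in the
    sense of primitives, hence almost everywhere unique, so that it inherits the
    square-integrability that is assumed of some weak derivative. *)
Lemma H1_Dx f : continuous f -> H1 f ->
  [/\ forall lo hi, primitive_on lo hi f (Dx f), measurable_fun setT (Dx f),
      mu.-integrable setT (EFin \o (fun x => f x ^+ 2)) &
      mu.-integrable setT (EFin \o (fun x => Dx f x ^+ 2))].
Proof.
move=> cf [f2 [g fg g2]].
have fD := weak_derivative_Dx fg.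
have mD : measurable_fun setT (Dx f) by case: fD => _ [].
have pD lo hi : primitive_on lo hi f (Dx f) by exact: weak_derivative_primitive.
split => //; first exact: L2_sqr_integrable.
apply: (sqr_integrable_ae mD _ (L2_measurable g2) (L2_sqr_integrable g2)).
apply: (primitive_ae_unique (F := f)) => // lo hi; exact: weak_derivative_primitive.
Qed.

Lemma integrable_integrable_on f a b : mu.-integrable setT (EFin \o f) ->
  integrable_on a b f.
Proof. by apply: integrableS. Qed.

(** Cauchy-Schwarz, as the nonnegativity of the variance of f over [a, b]. *)
Lemma sqr_integ_le f a b : a <= b -> integrable_on a b f ->
  integrable_on a b (fun x => f x ^+ 2) ->
  integ a b f ^+ 2 <= (b - a) * integ a b (fun x => f x ^+ 2).
Proof.
rewrite le_eqVlt => /predU1P[->|ab] fi f2i; first by rewrite !integ_pt subrr mul0r expr0n.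
have ba : 0 < b - a by rewrite subr_gt0.
pose m := integ a b f / (b - a).
have I1 : integrable_on a b (fun x => (2 * m) * f x) by exact: integrable_onZ.
have I2 : integrable_on a b (fun=> m ^+ 2) by exact: integrable_on_cst.
have : 0 <= integ a b (fun x => f x ^+ 2 - (2 * m) * f x + m ^+ 2).
  apply: integ_ge0 => x _ _.
  have -> : f x ^+ 2 - 2 * m * f x + m ^+ 2 = (f x - m) ^+ 2 by ring.
  exact: sqr_ge0.
rewrite integD//; last exact: integrable_onB.
rewrite integB// integZ// (integ_cst _ (ltW ab)).
have mE : integ a b f = m * (b - a) by rewrite /m divfK// lt0r_neq0.
rewrite mE => H; have -> : (m * (b - a)) ^+ 2 = (b - a) * (m ^+ 2 * (b - a)) by ring.
rewrite ler_pM2l//; apply: le_trans (_ : 2 * m * (m * (b - a)) - m ^+ 2 * (b - a) <= _).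
  by rewrite le_eqVlt; apply/orP; left; apply/eqP; ring.
lra.
Qed.

Lemma sqr_integrable_integrable_on f a b : measurable_fun setT f ->
  mu.-integrable setT (EFin \o (fun x => f x ^+ 2)) -> integrable_on a b f.
Proof.
move=> mf f2.
have I : integrable_on a b (fun x => 1 + f x ^+ 2).
  by apply: integrable_onD; [exact: integrable_on_cst|exact: integrable_integrable_on].
apply: le_integrable I => //.
- by apply/measurable_EFinP; exact: measurable_funS mf.
- move=> x _ /=; rewrite lee_fin [leRHS]ger0_norm ?addr_ge0 ?sqr_ge0//.
  rewrite -(real_normK (num_real (f x))); have := sqr_ge0 (`|f x| - 1); nra.
Qed.

Lemma L2norm_sqr f c : measurable_fun setT f -> 0 <= c -> (L2norm f <= c%:E)%E ->
  mu.-integrable setT (EFin \o (fun x => f x ^+ 2)) /\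
  forall a b, integ a b (fun x => f x ^+ 2) <= c ^+ 2.
Proof.
move=> mf c0 fc.
have m2 : measurable_fun setT (EFin \o (fun x => f x ^+ 2)).
  by apply/measurable_EFinP; exact: measurable_funX.
have E : (\int[mu]_x (f x ^+ 2)%:E <= (c ^+ 2)%:E)%E.
  have : ('N[mu]_2%:E[EFin \o f] `^ 2 <= c%:E `^ 2)%E.
    by apply: gt0_ler_poweR => //; rewrite in_itv/= leey andbT// ?Lnorm_ge0 ?lee_fin.
  rewrite poweR_Lnorm// poweR_EFin powR_mulrn//; apply: le_trans.
  apply: ge0_le_integral => //.
  - by move=> x _; rewrite lee_fin sqr_ge0.
  - apply: (measurableT_comp (measurable_poweR _)).
    by apply: measurableT_comp => //; exact/measurable_EFinP.
  - by move=> x _ /=; rewrite lee_fin powR_mulrn// real_normK// num_real.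
have I : mu.-integrable setT (EFin \o (fun x => f x ^+ 2)).
  apply/integrableP; split => //; apply: le_lt_trans (ltry (c ^+ 2)).
  apply: le_trans E; rewrite le_eqVlt; apply/orP; left; apply/eqP.
  by apply: eq_integral => x _ /=; rewrite ger0_norm ?sqr_ge0.
split=> // a b; rewrite -lee_fin; apply: le_trans E.
rewrite /integ /Rintegral fineK; last first.
  by apply: integrable_fin_num => //; apply: integrableS I.
apply: ge0_subset_integral => //.
by move=> x _; rewrite lee_fin sqr_ge0.
Qed.

(** Cauchy-Schwarz, with b - a + 1 in place of the square root of b - a. *)
Lemma L2norm_integ f c a b : measurable_fun setT f -> 0 <= c -> a <= b ->
  (L2norm f <= c%:E)%E -> integrable_on a b f /\ `|integ a b f| <= (b - a + 1) * c.
Proof.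
move=> mf c0 ab fc; have [I H] := L2norm_sqr mf c0 fc.
have fi : integrable_on a b f by exact: sqr_integrable_integrable_on.
split => //; have ba : 0 <= b - a by rewrite subr_ge0.
have ba1 : 0 <= b - a + 1 by exact: addr_ge0.
rewrite -(@ler_pXn2r _ 2) ?nnegrE ?mulr_ge0//.
rewrite real_normK ?num_real//; apply: (le_trans (sqr_integ_le ab fi _)).
  exact: integrable_integrable_on.
apply: (@le_trans _ _ ((b - a) * c ^+ 2)); first by rewrite ler_wpM2l.
rewrite exprMn ler_wpM2r ?sqr_ge0//; nra.
Qed.

Lemma ae_le_integ f g a b : integrable_on a b f -> integrable_on a b g ->
  {ae mu, forall x, f x <= g x} -> integ a b f <= integ a b g.
Proof.
move=> fi gi fg; rewrite -subr_ge0 -integB//.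
have di : integrable_on a b (fun x => g x - f x) by exact: integrable_onB.
rewrite (_ : integ a b _ = integ a b (fun x => `|g x - f x|)).
  by apply: integ_ge0.
congr fine; apply: ae_eq_integral => //.
- exact: measurable_int di.
- exact: measurable_int (integrable_on_norm di).
- by apply: (ae_impl _ fg) => x xfg _; rewrite ger0_norm// subr_ge0.
Qed.

End Sobolev.

(** * The kernel exp(-|x|)/2, the fundamental solution of 1 - d^2/dx^2 *)

Section Kernel.
Context {R : realType}.
Local Notation mu := (@lebesgue_measure R).
Implicit Types (a b c d e k lo hi r s t x y z : R) (f g F G : R -> R).

Definition left_exp f x : R := \int[mu]_(y in `]-oo, x]) (expR y * f y).
Definition right_exp f x : R := \int[mu]_(y in `[x, +oo[) (expR (- y) * f y).
(** Convolution with exp(-|x|)/2 and its derivative, written with the one-sided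
    exponential moments of f. For an integrable f these are absolutely continuous,
    and so are the convolution and its derivative. *)
Definition kernel_conv f x : R :=
  2^-1 * (expR (- x) * left_exp f x + expR x * right_exp f x).
Definition kernel_conv' f x : R :=
  2^-1 * (expR x * right_exp f x - expR (- x) * left_exp f x).

Lemma is_derive_expRN x : is_derive x (1 : R) (fun y : R => expR (- y)) (- expR (- x)).
Proof.
have H : is_derive x (1 : R) (fun y : R => expR (- y)) (expR (- x) * -1).
  apply: (@is_derive1_comp _ expR (fun y : R => - y)).
by apply: (is_derive_eq H); rewrite mulrN1.
Qed.

Lemma expR_primitive lo hi : primitive_on lo hi expR expR.
Proof. by apply: C1_primitive_on; exact: continuous_expR. Qed.

Lemma expRN_primitive lo hi :
  primitive_on lo hi (fun y => expR (- y)) (fun y => - expR (- y)).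
Proof.
apply: C1_primitive_on; first exact: is_derive_expRN.
move=> y; apply: cvgN; apply: continuous_comp; [exact: continuousN|exact: continuous_expR].
Qed.

Section fixed.
Variables (f : R -> R).
Hypothesis (f0 : forall x, 0 <= f x) (fi : mu.-integrable setT (EFin \o f)).

Let mass := \int[mu]_x f x.

Let mf : measurable_fun setT f.
Proof. by have /integrableP[/measurable_EFinP] := fi. Qed.

Let mexp g : continuous g -> measurable_fun setT (fun y => g y * f y).
Proof. by move=> cg; apply: measurable_funM => //; exact: continuous_measurable_fun. Qed.

Lemma weighted_integrable g (A : set R) k : measurable A -> continuous g ->
  (forall y, A y -> `|g y| <= k) -> mu.-integrable A (EFin \o (fun y => g y * f y)).
Proof.
move=> mA cg gk.
have I : mu.-integrable A (fun y => k%:E * (f y)%:E)%E.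
  by apply: integrableZl => //; apply: integrableS fi.
apply: le_integrable I => //.
  by apply/measurable_EFinP; apply: measurable_funS (mexp cg).
move=> y Ay /=; rewrite lee_fin !normrM ler_wpM2r//.
by apply: (le_trans (gk y Ay)); exact: ler_norm.
Qed.

Lemma weighted_Rintegral_le g (A : set R) k : measurable A -> continuous g -> 0 <= k ->
  (forall y, A y -> 0 <= g y /\ g y <= k) ->
  \int[mu]_(y in A) (g y * f y) <= k * mass.
Proof.
move=> mA cg k0 gk.
have I : mu.-integrable A (EFin \o (fun y => k * f y)).
  by apply: (@weighted_integrable _ _ `|k|) => // y; exact: cvg_cst.
apply: (@le_trans _ _ (\int[mu]_(y in A) (k * f y))).
  apply: le_Rintegral => //.
    apply: (@weighted_integrable _ _ (k)) => // y /gk[g0 gk']; by rewrite ger0_norm.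
  by move=> y /gk[_ ?]; rewrite ler_wpM2r.
rewrite RintegralZl//; last by apply: integrableS fi.
rewrite ler_wpM2l// /mass /Rintegral fine_le//.
- by apply: integrable_fin_num => //; apply: integrableS fi.
- exact: integrable_fin_num.
- apply: ge0_subset_integral => //; first exact/measurable_EFinP.
  by move=> y _; rewrite lee_fin.
Qed.

Let cexp : continuous (@expR R). Proof. exact: continuous_expR. Qed.
Let cexpN : continuous (fun y : R => expR (- y)).
Proof. move=> y; apply: continuous_comp; [exact: continuousN|exact: continuous_expR]. Qed.

Lemma left_exp_primitive lo hi : primitive_on lo hi (left_exp f) (fun y => expR y * f y).
Proof.
split.
  by apply: integrable_onM; [exact: continuous_subspaceT|exact: integrable_integrable_on].
move=> a b _ ab _; rewrite /left_exp (@Rintegral_itvB _ _ _ (BRight b) a) ?bnd_simp//.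
  rewrite Rintegral_itv_obnd_cbnd//.
  apply: (@weighted_integrable _ _ (expR b)) => // y /=; rewrite in_itv/= => /andP[_ yb].
  by rewrite ger0_norm ?expR_ge0// ler_expR.
apply: (@weighted_integrable _ _ (expR b)) => // y /=; rewrite in_itv/= => yb.
by rewrite ger0_norm ?expR_ge0// ler_expR.
Qed.

Lemma right_exp_primitive lo hi :
  primitive_on lo hi (right_exp f) (fun y => - (expR (- y) * f y)).
Proof.
have I a b : integrable_on a b (fun y => expR (- y) * f y).
  by apply: integrable_onM; [exact: continuous_subspaceT|exact: integrable_integrable_on].
split; first exact: integrable_onN.
move=> a b _ ab _; rewrite integN//; apply/eqP; rewrite -opprB eqr_opp; apply/eqP.
have Ia x : mu.-integrable `[x, +oo[ (EFin \o (fun y => expR (- y) * f y)).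
  apply: (@weighted_integrable _ _ (expR (- x))) => // y /=; rewrite in_itv/= andbT => xy.
  by rewrite ger0_norm ?expR_ge0// ler_expR lerN2.
have := @Rintegral_itvB _ (fun y => expR (- y) * f y) (BLeft a) +oo%O b (Ia a).
rewrite !bnd_simp => /(_ ab isT).
rewrite Rintegral_itv_obnd_cbnd; last first.
  by apply: integrableS (Ia b) => //; apply: subset_itvr; rewrite bnd_simp.
rewrite -/(right_exp f a) -/(right_exp f b) -/(integ _ _ _) => <-; ring.
Qed.

Lemma kernel_convE x :
  2^-1 * \int[mu]_y (expR (- `|x - y|) * f y) = kernel_conv f x.
Proof.
have cg : continuous (fun y => expR (- `|x - y|)).
  move=> y; apply: (@continuous_comp _ _ _ (fun y => - `|x - y|) expR); last exact: continuous_expR.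
  apply: continuousN; apply: (@continuous_comp _ _ _ (fun y => x - y) Num.norm); last exact: norm_continuous.
  by apply: continuousB; [exact: cvg_cst|exact: cvg_id].
rewrite /kernel_conv; congr (_ * _).
have -> : [set: R] = `]-oo, x] `|` `]x, +oo[ by rewrite -set_itvNyy -itv_bndbnd_setU.
have I : mu.-integrable setT (EFin \o (fun y => expR (- `|x - y|) * f y)).
  apply: (@weighted_integrable _ _ (1)) => // y _.
  by rewrite ger0_norm ?expR_ge0// -expR0 ler_expR oppr_le0.
rewrite Rintegral_setU//; last 2 first.
  by apply: integrableS I => //; exact: measurableU.
  by rewrite disj_set2E; apply/eqP/seteqP; split => // y []/=; rewrite !in_itv/= andbT leNgt => /negP.
congr (_ + _).
- rewrite /left_exp -RintegralZl//; last first.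
    apply: (@weighted_integrable _ _ (expR x)) => // y /=; rewrite in_itv/= => yx.
    by rewrite ger0_norm ?expR_ge0// ler_expR.
  apply: eq_Rintegral => y; rewrite inE/= in_itv/= => yx.
  by rewrite mulrA -expRD ger0_norm ?subr_ge0// opprB addrC.
- have Ir : mu.-integrable `[x, +oo[ (EFin \o (fun y => expR (- y) * f y)).
    apply: (@weighted_integrable _ _ (expR (- x))) => // y /=; rewrite in_itv/= andbT => xy.
    by rewrite ger0_norm ?expR_ge0// ler_expR lerN2.
  rewrite /right_exp -RintegralZl// Rintegral_itv_obnd_cbnd; last first.
    by apply: integrableS I.
  apply: eq_Rintegral => y; rewrite inE/= in_itv/= andbT => xy.
  by rewrite mulrA -expRD ler0_norm ?subr_le0// opprK.
Qed.

Lemma kernel_conv_primitive lo hi :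
  primitive_on lo hi (kernel_conv f) (kernel_conv' f).
Proof.
have h1 := primitive_onM (expRN_primitive lo hi) (left_exp_primitive lo hi).
have h2 := primitive_onM (expR_primitive lo hi) (right_exp_primitive lo hi).
apply: eq_primitive_on (primitive_onZ 2^-1 (primitive_onD h1 h2)) => x _ _ //.
have EE : expR x * expR (- x) = 1 by rewrite -expRD subrr expR0.
rewrite /kernel_conv'; ring.
Qed.

Lemma kernel_conv'_primitive lo hi :
  primitive_on lo hi (kernel_conv' f) (fun x => kernel_conv f x - f x).
Proof.
have h1 := primitive_onM (expRN_primitive lo hi) (left_exp_primitive lo hi).
have h2 := primitive_onM (expR_primitive lo hi) (right_exp_primitive lo hi).
apply: eq_primitive_on (primitive_onZ 2^-1 (primitive_onB h2 h1)) => x _ _ //.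
have EE : expR x * expR (- x) = 1 by rewrite -expRD subrr expR0.
transitivity (kernel_conv f x - expR x * expR (- x) * f x); last by rewrite EE mul1r.
by rewrite /kernel_conv; field.
Qed.

Lemma left_exp_ge0 x : 0 <= left_exp f x.
Proof. by apply: Rintegral_ge0 => y _; rewrite mulr_ge0 ?expR_ge0. Qed.

Lemma right_exp_ge0 x : 0 <= right_exp f x.
Proof. by apply: Rintegral_ge0 => y _; rewrite mulr_ge0 ?expR_ge0. Qed.

Lemma left_exp_le x : left_exp f x <= expR x * mass.
Proof.
apply: weighted_Rintegral_le; [exact: measurable_itv|exact: cexp|exact: expR_ge0|].
by move=> y /=; rewrite in_itv/= => yx; rewrite expR_ge0 ler_expR.
Qed.

Lemma right_exp_le x : right_exp f x <= expR (- x) * mass.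
Proof.
apply: weighted_Rintegral_le; [exact: measurable_itv|exact: cexpN|exact: expR_ge0|].
by move=> y /=; rewrite in_itv/= andbT => xy; rewrite expR_ge0 ler_expR lerN2.
Qed.

Lemma kernel_conv_ge0 x : 0 <= kernel_conv f x.
Proof.
apply: mulr_ge0; first by rewrite invr_ge0.
by apply: addr_ge0; apply: mulr_ge0;
  [exact: expR_ge0|exact: left_exp_ge0|exact: expR_ge0|exact: right_exp_ge0].
Qed.

Lemma kernel_conv'_le x : `|kernel_conv' f x| <= kernel_conv f x.
Proof.
have h1 : 0 <= expR (- x) * left_exp f x by rewrite mulr_ge0 ?expR_ge0 ?left_exp_ge0.
have h2 : 0 <= expR x * right_exp f x by rewrite mulr_ge0 ?expR_ge0 ?right_exp_ge0.
by rewrite /kernel_conv' /kernel_conv ler_norml; apply/andP; split; lra.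
Qed.

Lemma kernel_conv_le_weights c x : left_exp f x <= expR x * c ->
  right_exp f x <= expR (- x) * c -> kernel_conv f x <= c.
Proof.
move=> h1 h2; have e0 : 0 <= expR x by exact: expR_ge0.
have e1 : 0 <= expR (- x) by exact: expR_ge0.
have := ler_wpM2l e1 h1; have := ler_wpM2l e0 h2.
rewrite !mulrA -!expRD subrr addNr expR0 mul1r /kernel_conv; lra.
Qed.

Lemma kernel_conv_le x : kernel_conv f x <= mass.
Proof. by apply: kernel_conv_le_weights; [exact: left_exp_le|exact: right_exp_le]. Qed.

Lemma expR_small_le0 x z k : (forall y, y <= x -> z <= expR y * k) -> z <= 0.
Proof.
move=> H; rewrite leNgt; apply/negP => z0.
have k1 : 0 < `|k| + 1 by rewrite ltr_pwDr.
pose y := Num.min x (ln (z / (`|k| + 1))).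
have := H y; rewrite ge_min lexx => /(_ isT).
apply/negP; rewrite -ltNge.
have yl : expR y <= z / (`|k| + 1).
  rewrite -[leRHS]lnK ?posrE ?divr_gt0// ler_expR ge_min lexx orbT//.
apply: (@le_lt_trans _ _ (expR y * `|k|)).
  by rewrite ler_wpM2l ?expR_ge0 ?ler_norm.
apply: (@lt_le_trans _ _ (expR y * (`|k| + 1))); first by rewrite ltr_pM2l ?expR_gt0 ?ltrDl.
by rewrite -ler_pdivlMr.
Qed.

(** The kernel has mass 1. The bound on f is only required almost everywhere,
    because f will involve the square of a weak derivative; it is therefore
    integrated over bounded intervals, and the tails vanish. *)
Lemma kernel_conv_le_ae c x : 0 <= c -> {ae mu, forall y, f y <= c} ->
  kernel_conv f x <= c.
Proof.
move=> c0 fc; apply: kernel_conv_le_weights.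
- rewrite -subr_le0; apply: (@expR_small_le0 x _ mass) => a ax.
  have [I /(_ a x (lexx a) ax (lexx x)) H] := left_exp_primitive a x.
  rewrite -(subrK (left_exp f a) (left_exp f x)) H.
  have : integ a x (fun y => expR y * f y) <= integ a x (fun y => expR y * c).
    apply: ae_le_integ => //.
      by apply: integrable_onM; [exact: continuous_subspaceT|exact: integrable_on_cst].
    by apply: (ae_impl _ fc) => y yc; rewrite ler_wpM2l ?expR_ge0.
  have -> : integ a x (fun y => expR y * c) = integ a x (fun y => c * expR y).
    by apply: eq_integ => y _ _; rewrite mulrC.
  have [J /(_ a x (lexx a) ax (lexx x)) E] := expR_primitive a x.
  rewrite integZ// -E => h1; have h2 := left_exp_le a.
  have h3 : 0 <= c * expR a by rewrite mulr_ge0 ?expR_ge0.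
  lra.
- rewrite -subr_le0; apply: (@expR_small_le0 (- x) _ mass) => a' ax'.
  pose a := - a'; have -> : a' = - a by rewrite opprK.
  have ax : x <= a by rewrite lerNr.
  have [I /(_ x a (lexx x) ax (lexx a)) H] := right_exp_primitive x a.
  have I' : integrable_on x a (fun y => expR (- y) * f y).
    by apply: integrable_onM; [exact: continuous_subspaceT|exact: integrable_integrable_on].
  rewrite integN// in H.
  have {H} H : right_exp f x = right_exp f a + integ x a (fun y => expR (- y) * f y).
    by rewrite -[integ _ _ _]opprK -H; ring.
  rewrite H.
  have : integ x a (fun y => expR (- y) * f y) <= integ x a (fun y => expR (- y) * c).
    apply: ae_le_integ => //.
      by apply: integrable_onM; [exact: continuous_subspaceT|exact: integrable_on_cst].
    by apply: (ae_impl _ fc) => y yc; rewrite ler_wpM2l ?expR_ge0.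
  have -> : integ x a (fun y => expR (- y) * c) = integ x a (fun y => - c * - expR (- y)).
    by apply: eq_integ => y _ _; ring.
  have [J /(_ x a (lexx x) ax (lexx a)) E] := expRN_primitive x a.
  rewrite integZ// -E => h1; have h2 := right_exp_le a.
  have h3 : 0 <= c * expR (- a) by rewrite mulr_ge0 ?expR_ge0.
  lra.
Qed.

Lemma kernel_conv_continuous : continuous (kernel_conv f).
Proof. exact: primitive_continuous kernel_conv_primitive. Qed.

Lemma kernel_conv'_continuous : continuous (kernel_conv' f).
Proof. exact: primitive_continuous kernel_conv'_primitive. Qed.

Lemma kernel_conv_weak_derivative : is_weak_derivative (kernel_conv f) (kernel_conv' f).
Proof.
apply: primitive_weak_derivative; last exact: kernel_conv_primitive.
  exact: kernel_conv_continuous.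
by apply: continuous_measurable_fun; exact: kernel_conv'_continuous.
Qed.

End fixed.
End Kernel.

(** * Bounds and regularity of a solution *)

Section Solution.
Context {R : realType}.
Local Notation mu := (@lebesgue_measure R).
Implicit Types (a b c d e k lo hi r s t x y z : R) (f g F G : R -> R).

Lemma dist_lt_ge s t x : `|s - t| < t - x -> x <= s.
Proof. by rewrite ltr_norml => /andP[]; lra. Qed.

Definition source (u : R -> R -> R) t y : R := u t y ^+ 2 + 2^-1 * Dx (u t) y ^+ 2.
Definition pressure u t : R -> R := kernel_conv (source u t).
Definition pressure' u t : R -> R := kernel_conv' (source u t).
Definition energy (u : R -> R -> R) : R := fine (CH_energy u 0).

Section fixed.
Variables (u0 : R -> R) (u : R -> R -> R).
Hypothesis hsol : CH_solution u0 u.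
Hypothesis hE : forall t, 0 <= t -> (CH_energy u t <= CH_energy u 0)%E.

(** Hölder continuity in the form of a modulus of continuity, as Peano's theorem
    wants it. *)
Lemma hoelder_modulus : exists w : R -> R,
  (forall r t s x y, 0 <= t -> 0 <= s -> `|t - s| <= r -> `|x - y| <= r ->
     `|u t x - u s y| <= w r) /\
  (forall e, 0 < e -> exists2 d, 0 < d & forall r, 0 < r -> r < d -> w r < e).
Proof.
have [[a [C [a0 _ H]]] _ _ _ _] := hsol.
pose c := `|C| + 1; have c0 : 0 < c by rewrite ltr_pwDr.
exists (fun r => c * r `^ a); split.
- move=> r t s x y t0 s0 ts xy; apply: (le_trans (H t s x y t0 s0)).
  apply: (@le_trans _ _ (c * Num.max `|t - s| `|x - y| `^ a)).
    by rewrite ler_wpM2r ?powR_ge0// /c (le_trans (ler_norm _))// lerDl.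
  rewrite ler_wpM2l//; first exact: ltW.
  apply: ge0_ler_powR.
  + exact: ltW.
  + by rewrite nnegrE le_max normr_ge0.
  + by rewrite nnegrE; exact: le_trans ts.
  + by rewrite ge_max ts.
- move=> e e0; have ec : 0 < e / c by rewrite divr_gt0.
  exists ((e / c) `^ a^-1); first by rewrite powR_gt0.
  move=> r r0 rd; rewrite mulrC -ltr_pdivlMr//.
  have -> : e / c = ((e / c) `^ a^-1) `^ a.
    by rewrite -powRrM mulVf ?gt_eqF// powRr1// ltW.
  by apply: gt0_ltr_powR => //; rewrite nnegrE ?powR_ge0// ltW.
Qed.

Lemma sol_continuous2 e : 0 < e -> exists2 d, 0 < d & forall t s x y,
  0 <= t -> 0 <= s -> `|t - s| <= d -> `|x - y| <= d -> `|u t x - u s y| < e.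
Proof.
move=> e0; have [w [Hw w0]] := hoelder_modulus; have [d d0 Hd] := w0 e e0.
have d20 : 0 < d / 2 by rewrite divr_gt0.
exists (d / 2) => // t s x y t0 s0 ts xy; apply: (le_lt_trans (Hw _ _ _ _ _ t0 s0 ts xy)).
by apply: Hd => //; rewrite ltr_pdivrMr// ltr_pMr// ltr1n.
Qed.

Lemma sol_continuous t : 0 <= t -> continuous (u t).
Proof.
move=> t0 x; apply/cvgrPdist_lt => e e0; have [d d0 H] := sol_continuous2 e0.
apply/nbhs_ballP; exists d => // y; rewrite /ball/= => /ltW xy.
by apply: H => //; rewrite subrr normr0 ltW.
Qed.

Lemma sol_H1 t : 0 <= t ->
  [/\ forall lo hi, primitive_on lo hi (u t) (Dx (u t)), measurable_fun setT (Dx (u t)),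
      mu.-integrable setT (EFin \o (fun x => u t x ^+ 2)) &
      mu.-integrable setT (EFin \o (fun x => Dx (u t) x ^+ 2))].
Proof.
move=> t0; apply: H1_Dx; first exact: sol_continuous.
by have [_ H _ _ _] := hsol; exact: H.
Qed.

Lemma source_ge0 t y : 0 <= source u t y.
Proof. apply: addr_ge0; first exact: sqr_ge0.
by apply: mulr_ge0; [rewrite invr_ge0|exact: sqr_ge0]. Qed.

Lemma source_integrable t : 0 <= t -> mu.-integrable setT (EFin \o source u t).
Proof.
move=> /sol_H1[_ _ I1 I2].
have := integrableD measurableT I1 (integrableZl measurableT 2^-1 I2).
by apply: eq_integrable.
Qed.

Lemma energy_density_integrable t : 0 <= t ->
  mu.-integrable setT (EFin \o (fun x => u t x ^+ 2 + Dx (u t) x ^+ 2)).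
Proof. by move=> /sol_H1[_ _ I1 I2]; have := integrableD measurableT I1 I2. Qed.

Lemma energy_Rintegral_le t : 0 <= t ->
  \int[mu]_x (u t x ^+ 2 + Dx (u t) x ^+ 2) <= energy u.
Proof.
move=> t0; apply: fine_le; last exact: hE.
- by apply: (integrable_fin_num _ (energy_density_integrable t0)).
- by apply: (integrable_fin_num _ (energy_density_integrable (lexx 0))).
Qed.

Lemma integ_le_Rintegral f a b : (forall x, 0 <= f x) ->
  mu.-integrable setT (EFin \o f) -> integ a b f <= \int[mu]_x f x.
Proof.
move=> f0 fi; apply: fine_le.
- by apply: integrable_fin_num => //; apply: integrableS fi.
- exact: integrable_fin_num.
- apply: ge0_subset_integral => //.
    by have /integrableP[] := fi.
  by move=> x _; rewrite lee_fin.
Qed.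

Lemma energy_integ_le t a b : 0 <= t ->
  integ a b (fun x => u t x ^+ 2 + Dx (u t) x ^+ 2) <= energy u.
Proof.
move=> t0; apply: le_trans (energy_Rintegral_le t0); apply: integ_le_Rintegral.
  by move=> x; rewrite addr_ge0 ?sqr_ge0.
exact: energy_density_integrable.
Qed.

Lemma energy_ge0 : 0 <= energy u.
Proof.
apply: fine_ge0; apply: integral_ge0 => x _.
by rewrite lee_fin addr_ge0 ?sqr_ge0.
Qed.

Lemma source_mass_le t : 0 <= t -> \int[mu]_x source u t x <= energy u.
Proof.
move=> t0; apply: le_trans (energy_Rintegral_le t0); apply: le_Rintegral => //.
- exact: source_integrable.
- exact: energy_density_integrable.
- by move=> x _; rewrite lerD2l ler_piMl ?sqr_ge0// invf_le1// ler1n.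
Qed.

Lemma pressure_bounds t x : 0 <= t -> 0 <= pressure u t x /\ pressure u t x <= energy u.
Proof.
move=> t0; split; first by apply: kernel_conv_ge0 => y; exact: source_ge0.
apply: le_trans (source_mass_le t0); apply: kernel_conv_le; last exact: source_integrable.
by move=> y; exact: source_ge0.
Qed.

Lemma pressure'_bound t x : 0 <= t -> `|pressure' u t x| <= energy u.
Proof.
move=> t0; have [_ H] := pressure_bounds x t0; apply: le_trans H.
by apply: kernel_conv'_le => y; exact: source_ge0.
Qed.

Lemma CH_PE t : 0 <= t -> CH_P u t = pressure u t.
Proof.
move=> t0; apply/funext => x; rewrite /CH_P /pressure -kernel_convE//.
exact: source_integrable.
Qed.

Lemma pressure_primitive t lo hi : 0 <= t ->
  primitive_on lo hi (pressure u t) (pressure' u t).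
Proof.
by move=> t0; apply: kernel_conv_primitive; exact: source_integrable.
Qed.

Lemma pressure'_primitive t lo hi : 0 <= t ->
  primitive_on lo hi (pressure' u t) (fun x => pressure u t x - source u t x).
Proof.
by move=> t0; apply: kernel_conv'_primitive; exact: source_integrable.
Qed.

Lemma pressure'_continuous t : 0 <= t -> continuous (pressure' u t).
Proof.
by move=> t0; apply: kernel_conv'_continuous; exact: source_integrable.
Qed.

Lemma pressure_continuous t : 0 <= t -> continuous (pressure u t).
Proof.
by move=> t0; apply: kernel_conv_continuous; exact: source_integrable.
Qed.

Lemma Dx_pressure t : 0 <= t -> measurable_fun setT (Dx (CH_P u t)) /\
  forall lo hi, primitive_on lo hi (pressure u t) (Dx (CH_P u t)).
Proof.
move=> t0; rewrite (CH_PE t0).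
have W := weak_derivative_Dx (kernel_conv_weak_derivative (source_integrable t0)).
split; first by case: W => _ [].
by move=> lo hi; apply: weak_derivative_primitive W; exact: pressure_continuous.
Qed.

(** Averaging u(x) = u(y) - int_x^y u_x over y in [x, x + 1]. *)
Lemma sol_sqr_le t x : 0 <= t -> u t x ^+ 2 <= 2 * energy u.
Proof.
move=> t0; have [pu mw I1 I2] := sol_H1 t0.
have x1 : x <= x + 1 by rewrite lerDl.
have i1 : integrable_on x (x + 1) (fun y => u t y ^+ 2) by exact: integrable_integrable_on.
have i2 a b : integrable_on a b (fun y => Dx (u t) y ^+ 2) by exact: integrable_integrable_on.
set W := integ x (x + 1) (fun y => Dx (u t) y ^+ 2).
have H : integ x (x + 1) (fun=> u t x ^+ 2) <=
    integ x (x + 1) (fun y => 2 * u t y ^+ 2 + 2 * W).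
  apply: le_integ; first exact: integrable_on_cst.
    by apply: integrable_onD; [exact: integrable_onZ|exact: integrable_on_cst].
  move=> y xy yx.
  have [wi /(_ x y (lexx x) xy yx) E] := pu x (x + 1).
  have CS : integ x y (Dx (u t)) ^+ 2 <= W.
    apply: (le_trans (sqr_integ_le xy _ (i2 x y))); first exact: integrable_onS wi.
    rewrite /W (@integ_cat _ x y (x + 1))//.
    have n1 : 0 <= integ x y (fun y => Dx (u t) y ^+ 2) by apply: integ_ge0 => *; exact: sqr_ge0.
    have n2 : 0 <= integ y (x + 1) (fun y => Dx (u t) y ^+ 2) by apply: integ_ge0 => *; exact: sqr_ge0.
    apply: (@le_trans _ _ (integ x y (fun y => Dx (u t) y ^+ 2))); last by rewrite lerDl.
    by rewrite ler_piMl//; lra.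
  have -> : u t x = u t y - integ x y (Dx (u t)) by rewrite -E; ring.
  have := sqr_ge0 (u t y + integ x y (Dx (u t))); nra.
rewrite integ_cst// addrAC subrr add0r mulr1 in H; apply: (le_trans H).
rewrite integD; [|exact: integrable_onZ|exact: integrable_on_cst].
rewrite integ_cst// addrAC subrr add0r mulr1 integZ// -mulrDr ler_wpM2l//.
have := energy_integ_le x (x + 1) t0; rewrite integD//.
Qed.

(** Any bound for |u| would do as a speed limit for the characteristics. *)
Definition speed := 2 * energy u + 1.

Lemma sol_bound t x : 0 <= t -> `|u t x| <= speed.
Proof.
move=> t0; have h := sol_sqr_le x t0; have E0 := energy_ge0.
have s1 : 1 <= speed by rewrite /speed; lra.
rewrite -(@ler_pXn2r _ 2) ?nnegrE//; last by lra.
rewrite real_normK ?num_real//; apply: (le_trans h).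
by rewrite /speed; nra.
Qed.

Lemma space_integral_lipschitz : exists2 C, 0 <= C & forall t s a b,
  0 <= t -> 0 <= s -> a <= b ->
  `|integ a b (u t) - integ a b (u s)| <= (b - a + 1) * (C * `|t - s|).
Proof.
have [_ _ [C HC] _ _] := hsol.
exists `|C| => // t s a b t0 s0 ab.
have mu_ r : 0 <= r -> measurable_fun setT (u r).
  by move=> r0; apply: continuous_measurable_fun; exact: sol_continuous.
rewrite -integB; try by apply: continuous_integrable_on; exact: sol_continuous.
have [||| _ //] := @L2norm_integ _ (fun x => u t x - u s x) (`|C| * `|t - s|) a b _ _ ab.
- by apply: measurable_funB; exact: mu_.
- by rewrite mulr_ge0.
- apply: (le_trans (HC t s t0 s0)); rewrite lee_fin ler_wpM2r//; exact: ler_norm.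
Qed.

(** The conservation law, integrated over a fixed interval of space. *)
Definition space_derivative t := forall a b, a <= b ->
  is_derive t (1 : R) (fun s => integ a b (u s))
    (- ((u t b ^+ 2 - u t a ^+ 2) / 2 + (pressure u t b - pressure u t a))).

Lemma ae_space_derivative : {ae mu, forall t, 0 < t -> space_derivative t}.
Proof.
have [_ _ _ _] := hsol; apply: ae_impl => t H t0 a b ab.
have {}H := H t0; have t0' := ltW t0.
set v := (fun x => - (u t x * Dx (u t) x) - Dx (CH_P u t) x) in H.
have [pu mw I1 I2] := sol_H1 t0'.
have [mP pP] := Dx_pressure t0'.
have mu_ r : 0 <= r -> measurable_fun setT (u r).
  by move=> r0; apply: continuous_measurable_fun; exact: sol_continuous.
have iu r : 0 <= r -> integrable_on a b (u r).
  by move=> r0; apply: continuous_integrable_on; exact: sol_continuous.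
have mv : measurable_fun setT v.
  apply: measurable_funB => //; apply: measurableT_comp => //.
  by apply: measurable_funM => //; exact: mu_.
have [i1 E1] := primitive_on_sqr (pu a b).
have [i2 E2] := pP a b.
have i3 : integrable_on a b (fun x => u t x * Dx (u t) x).
  apply: (@eq_integrable_on _ _ _ (fun x => 2^-1 * (2 * u t x * Dx (u t) x))).
    by move=> x _ _; field.
  exact: integrable_onZ.
have iv : integrable_on a b v.
  exact: integrable_onB (integrable_onN i3) i2.
have Ev : integ a b v = - ((u t b ^+ 2 - u t a ^+ 2) / 2 + (pressure u t b - pressure u t a)).
  rewrite integB//; last exact: integrable_onN.
  rewrite integN// -E2// E1//.
  have -> : integ a b (fun x => u t x * Dx (u t) x) = 2^-1 * integ a b (fun x => 2 * u t x * Dx (u t) x).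
    by rewrite -integZ//; apply: eq_integ => x _ _; field.
  by field.
apply/is_derive_epsP => e e0; rewrite -Ev.
have ba : 0 < b - a + 1 by rewrite ltr_wpDl// subr_ge0.
have e1 : 0 < e / (b - a + 1) by rewrite divr_gt0.
have : \forall h \near 0^', (L2norm (fun x => (u (t + h) x - u t x) / h - v x)%R < (e / (b - a + 1))%:E)%E.
  move: H; rewrite /has_L2_derivative => /(_ [set z | (z < (e / (b - a + 1))%:E)%E]); apply.
  by apply: open_nbhs_nbhs; split; [exact: open_ereal_lt_ereal|rewrite /= lte_fin].
rewrite near_withinE => /nbhs_ballP[r /= r0 Hr].
exists (Num.min r t) => [|s]; first by rewrite lt_min r0.
rewrite lt_min => /andP[sr st].
have [->|st0] := eqVneq s t; first by rewrite !subrr mulr0 subrr normr0 mulr0.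
have h0 : s - t != 0 by rewrite subr_eq0.
have s0 : 0 <= s by move: st; rewrite ltr_norml => /andP[]; lra.
have := Hr (s - t); rewrite /ball/= sub0r normrN => /(_ sr h0).
rewrite addrC subrK => /ltW HL.
have [||_] := @L2norm_integ _ (fun x => (u s x - u t x) / (s - t) - v x) (e / (b - a + 1)) a b _ _ ab HL.
- apply: measurable_funB => //; apply: measurable_funM => //.
  by apply: measurable_funB; exact: mu_.
- exact: ltW.
rewrite mulrCA divff ?gt_eqF// mulr1 => K.
have iq : integrable_on a b (fun x => (s - t)^-1 * (u s x - u t x)).
  by apply: integrable_onZ; apply: integrable_onB; exact: iu.
have E : integ a b (fun x => (u s x - u t x) / (s - t) - v x) =
    (s - t)^-1 * (integ a b (u s) - integ a b (u t)) - integ a b v.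
  rewrite -integB ?iu// -integZ; last by apply: integrable_onB; exact: iu.
  by rewrite -integB//; apply: eq_integ => x _ _; rewrite mulrC.
rewrite E in K.
have -> : integ a b (u s) - integ a b (u t) - integ a b v * (s - t) =
   ((s - t)^-1 * (integ a b (u s) - integ a b (u t)) - integ a b v) * (s - t) by field.
by rewrite normrM ler_wpM2r.
Qed.

Lemma integ_increment_le g b0 p q c e : continuous g -> b0 <= p -> b0 <= q ->
  (forall z, `|z - p| <= `|q - p| -> `|g z - c| <= e) ->
  `|integ b0 q g - integ b0 p g - c * (q - p)| <= e * `|q - p|.
Proof.
move=> cg bp bq H.
have gi a b : integrable_on a b g by exact: continuous_integrable_on.
have ci a b : integrable_on a b (fun=> c) by exact: integrable_on_cst.
have [pq|qp] := leP p q.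
- rewrite (@integ_cat _ b0 p q)//.
  have -> : integ b0 p g + integ p q g - integ b0 p g = integ p q g by ring.
  rewrite -integ_cst// -integB//.
  rewrite [`|q - p|]ger0_norm ?subr_ge0//; apply: le_norm_integ_cst => //.
    exact: integrable_onB.
  move=> z pz zq; apply: H; rewrite !ger0_norm ?subr_ge0//; lra.
- have qp' := ltW qp.
  rewrite (@integ_cat _ b0 q p)//.
  have -> : integ b0 q g - (integ b0 q g + integ q p g) - c * (q - p) =
    - (integ q p g - c * (p - q)) by ring.
  rewrite normrN -integ_cst// -integB// [`|q - p|]distrC [`|p - q|]ger0_norm ?subr_ge0//.
  apply: le_norm_integ_cst => //; first exact: integrable_onB.
  move=> z qz zp; apply: H.
  by rewrite (distrC z) (distrC q) !ger0_norm ?subr_ge0//; lra.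
Qed.

(** Leibniz' rule: the moving endpoint adds the flux u * Y'. *)
Lemma curve_derivative t b0 Y y' : 0 < t -> space_derivative t ->
  is_derive t (1 : R) Y y' -> b0 < Y t ->
  is_derive t (1 : R) (fun s => integ b0 (Y s) (u s))
   (u t (Y t) * y' - ((u t (Y t) ^+ 2 - u t b0 ^+ 2) / 2 + (pressure u t (Y t) - pressure u t b0))).
Proof.
move=> t0 St /is_derive_epsP HY bY; apply/is_derive_epsP => e e0.
have t0' := ltW t0.
have /is_derive_epsP HS := St b0 (Y t) (ltW bY).
pose d := - ((u t (Y t) ^+ 2 - u t b0 ^+ 2) / 2 + (pressure u t (Y t) - pressure u t b0)).
rewrite -/d in HS.
have y10 : 0 < `|y'| + 1 by rewrite ltr_wpDl.
have K0 : 0 < `|u t (Y t)| + 1 by rewrite ltr_wpDl.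
pose e1 := Num.min 1 (e / 3 / (`|u t (Y t)| + 1)).
have e10 : 0 < e1 by rewrite lt_min ltr01/= !divr_gt0.
pose e2 := e / 3 / (`|y'| + 1).
have e20 : 0 < e2 by rewrite !divr_gt0.
have e30 : 0 < e / 3 by rewrite divr_gt0.
have [r1 r10 H1] := HY e1 e10.
have [r2 r20 H2] := HS (e / 3) e30.
have [r3 r30 H3] := sol_continuous2 e20.
pose q := (Y t - b0) / (`|y'| + 1).
have q0 : 0 < q by rewrite divr_gt0// subr_gt0.
pose r4 := r3 / (`|y'| + 1); have r40 : 0 < r4 by rewrite divr_gt0.
exists (Num.min (Num.min (Num.min r1 r2) (Num.min r3 r4)) (Num.min q t)).
  by rewrite !lt_min r10 r20 r30 r40 q0 t0.
move=> s; rewrite !lt_min => /andP[/andP[/andP[s1 s2] /andP[s3 s4]] /andP[sq st]].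
have s0 : 0 <= s by apply: (@dist_lt_ge s t); rewrite subr0.
have {}H1 := H1 s s1; have {}H2 := H2 s s2.
have e11 : e1 <= 1 by rewrite ge_min lexx.
have e12 : e1 * (`|u t (Y t)| + 1) <= e / 3 by rewrite -ler_pdivlMr// ge_min lexx orbT.
have YL : `|Y s - Y t| <= (`|y'| + 1) * `|s - t|.
  rewrite -(subrK (y' * (s - t)) (Y s - Y t)); apply: (le_trans (ler_normD _ _)).
  rewrite mulrDl addrC normrM lerD2l mul1r; apply: (le_trans H1).
  by rewrite ler_piMl.
have bYs : b0 <= Y s.
  have : `|Y s - Y t| < Y t - b0.
    by apply: (le_lt_trans YL); rewrite mulrC -ltr_pdivlMr.
  exact: dist_lt_ge.
have YL3 : `|Y s - Y t| <= r3.
  by apply: (le_trans YL); rewrite mulrC -ler_pdivlMr// ltW.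
have Q := @integ_increment_le (u s) b0 (Y t) (Y s) (u t (Y t)) e2 (sol_continuous s0)
  (ltW bY) bYs.
have {}Q : `|integ b0 (Y s) (u s) - integ b0 (Y t) (u s) - u t (Y t) * (Y s - Y t)| <= e2 * `|Y s - Y t|.
  apply: Q => z zY; apply: ltW; apply: H3 => //; first exact: ltW.
  exact: le_trans YL3.
have Q' : e2 * `|Y s - Y t| <= e / 3 * `|s - t|.
  apply: (@le_trans _ _ (e2 * ((`|y'| + 1) * `|s - t|))); first by rewrite ler_wpM2l// ltW.
  by rewrite mulrA /e2 divfK// gt_eqF.
have Q2 : `|u t (Y t) * (Y s - Y t - y' * (s - t))| <= e / 3 * `|s - t|.
  rewrite normrM; apply: (@le_trans _ _ ((`|u t (Y t)| + 1) * (e1 * `|s - t|))).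
    by apply: ler_pM => //; rewrite lerDl.
  by rewrite mulrA ler_wpM2r// mulrC.
have -> : integ b0 (Y s) (u s) - integ b0 (Y t) (u t) -
   (u t (Y t) * y' - ((u t (Y t) ^+ 2 - u t b0 ^+ 2) / 2 + (pressure u t (Y t) - pressure u t b0))) * (s - t)
  = (integ b0 (Y s) (u s) - integ b0 (Y t) (u s) - u t (Y t) * (Y s - Y t)) +
    u t (Y t) * (Y s - Y t - y' * (s - t)) +
    (integ b0 (Y t) (u s) - integ b0 (Y t) (u t) - d * (s - t)) by rewrite /d; ring.
apply: (le_trans (ler_normD _ _)).
have -> : e * `|s - t| = (e / 3 * `|s - t| + e / 3 * `|s - t|) + e / 3 * `|s - t| by field.
apply: lerD => //; apply: (le_trans (ler_normD _ _)); apply: lerD => //.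
exact: le_trans Q'.
Qed.

End fixed.
End Solution.

(** * Characteristics *)

Section MoreCalculus.
Context {R : realType}.
Local Notation mu := (@lebesgue_measure R).
Implicit Types (a b c d e k lo hi r s t x y z : R) (f g F G : R -> R).

Lemma primitive_continuous_derive F f x : continuous f ->
  (forall lo hi, primitive_on lo hi F f) -> is_derive x (1 : R) F (f x).
Proof.
move=> cf Ff; apply/is_derive_epsP => e e0.
have /cvgrPdist_le/(_ _ e0)/nbhs_ballP[d /= d0 H] := cf x.
exists d => // y xy.
pose b0 := x - d.
have yb : b0 <= y by move: xy; rewrite ltr_norml /b0 => /andP[]; lra.
have bx : b0 <= x by rewrite /b0; lra.
have E z : b0 <= z -> F z = F b0 + integ b0 z f.
  by move=> bz; have [_ <-//] := Ff b0 z; ring.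
rewrite E// (E x)//.
have -> : F b0 + integ b0 y f - (F b0 + integ b0 x f) = integ b0 y f - integ b0 x f by ring.
apply: integ_increment_le => // z zx; rewrite distrC; apply: H.
by rewrite /ball/= distrC; apply: le_lt_trans zx xy.
Qed.

Lemma within_derive_primitive lo hi F f : {within `[lo, hi], continuous f} ->
  {within `[lo, hi], continuous F} ->
  (forall x, lo < x -> x < hi -> is_derive x (1 : R) F (f x)) ->
  primitive_on lo hi F f.
Proof.
move=> cf cF dF; split; first exact: within_continuous_integrable_on.
move=> a b la; rewrite le_eqVlt => /predU1P[->|ab] bh.
  by rewrite subrr integ_pt.
have sub : `[a, b] `<=` `[lo, hi] by apply: subset_itv; rewrite bnd_simp.
have cfa := continuous_subspaceW sub cf.
have cFa := continuous_subspaceW sub cF.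
have dab x : x \in `]a, b[ -> is_derive x (1 : R) F (f x).
  rewrite in_itv/= => /andP[ax xb]; apply: dF; first exact: le_lt_trans ax.
  exact: lt_le_trans bh.
have [c1 c2 c3] := (continuous_within_itvP _ ab).1 cFa.
rewrite /integ /Rintegral (@continuous_FTC2 _ f F)//.
- split => //.
  by move=> x /dab[].
- by move=> x xab; rewrite derive1E; have [_ h] := dab x xab; exact: h.
Qed.

Lemma integ_bounded_cvg (fn : nat -> R -> R) f a b k :
  (forall n, measurable_fun `[a, b] (fn n)) -> measurable_fun `[a, b] f ->
  (forall n x, a <= x -> x <= b -> `|fn n x| <= k) ->
  (forall x, a <= x -> x <= b -> fn n x @[n --> \oo] --> f x) ->
  integ a b (fn n) @[n --> \oo] --> integ a b f.
Proof.
move=> mfn mf fk fcv.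
have gi : mu.-integrable `[a, b] (EFin \o (fun=> k)) by exact: integrable_on_cst.
have [] := @dominated_convergence _ _ _ mu `[a, b]%classic (measurable_itv _)
  (fun n => EFin \o fn n) (EFin \o f) (EFin \o (fun=> k)).
- by move=> n; apply/measurable_EFinP; exact: mfn.
- exact/measurable_EFinP.
- apply: aeW => x /=; rewrite in_itv/= => /andP[ax xb].
  by apply: cvg_EFin; [exact: nearW|exact: fcv].
- exact: gi.
- apply: aeW => x n /=; rewrite in_itv/= => /andP[ax xb].
  by rewrite lee_fin fk.
- move=> fi _ H; apply: fine_cvg; rewrite fineK//.
  exact: integrable_fin_num.
Qed.

Lemma bounded_measurable_integrable_on f a b k : measurable_fun `[a, b] f ->
  (forall x, a <= x -> x <= b -> `|f x| <= k) -> integrable_on a b f.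
Proof.
move=> mf fk; apply: (le_integrable _ _ _ (integrable_on_cst a b k)) => //.
  exact/measurable_EFinP.
move=> x /=; rewrite in_itv/= => /andP[ax xb].
by rewrite lee_fin (le_trans (fk x ax xb))// ler_norm.
Qed.

(** A function that is measurable in one variable and continuous in the other is
    jointly measurable: freezing the continuous variable on a grid exhibits it
    as a limit of countably piecewise measurable functions. *)
Lemma caratheodory_measurable (h : R -> R -> R) :
  (forall t, measurable_fun setT (h t)) -> (forall y, continuous (h^~ y)) ->
  measurable_fun setT (fun z : R * R => h z.1 z.2 : R).
Proof.
move=> mh ch.
pose N (n : nat) : R := n.+1%:R.
have N0 n : 0 < N n by rewrite ltr0n.
pose g (n : nat) (t : R) : R := (Num.floor (t * N n))%:~R / N n.
have gE n t : g n t <= t < g n t + (N n)^-1.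
  have /andP[h1 h2] := floor_itv (t * N n).
  rewrite /g ler_pdivrMr// h1/=.
  rewrite -[X in _ + X]mul1r -mulrDl ltr_pdivlMr//.
  by move: h2; rewrite intrD.
suff H : measurable_fun (setT : set (measurableTypeR R * measurableTypeR R))
    (fun z : measurableTypeR R * measurableTypeR R => h z.1 z.2 : R) by exact: H.
apply: (@measurable_fun_cvg _ _ _ _
  (fun n (z : measurableTypeR R * measurableTypeR R) => h (g n z.1) z.2 : R)); last first.
  move=> [t y] _ /=; apply: (@cvg_comp _ _ _ (fun n => g n t) (h^~ y) _ (nbhs t)); last exact: ch.
  apply/cvgrPdist_lt => e e0.
  have /cvgrPdist_lt/(_ _ e0) := @cvg_harmonic R.
  apply: filterS => n; rewrite sub0r normrN gtr0_norm ?invr_gt0 ?ltr0n// => hn.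
  have /andP[g1 g2] := gE n t.
  rewrite ger0_norm ?subr_ge0//; apply: lt_trans hn; rewrite ltrBlDl.
  exact: g2.
move=> n _ B mB; rewrite setTI.
have -> : (fun z : R * R => h (g n z.1) z.2) @^-1` B =
   \bigcup_(i : int) ([set t | Num.floor (t * N n) = i] `*` (h (i%:~R / N n) @^-1` B)).
  apply/seteqP; split => [[t y] /= Bh|[t y] [i _ [/= <-]]//].
  by exists (Num.floor (t * N n)).
apply: countable_bigcupT_measurable => // i; apply: measurableX; last first.
  by have := mh (i%:~R / N n) measurableT B mB; rewrite setTI.
have -> : [set t | Num.floor (t * N n) = i] = `[i%:~R / N n, (i + 1)%:~R / N n[%classic.
  apply/seteqP; split => t /=; rewrite in_itv/=.
    by move=> <-; rewrite ler_pdivrMr// ltr_pdivlMr// floor_itv.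
  rewrite ler_pdivrMr// ltr_pdivlMr// => H.
  exact: floor_def.
exact: measurable_itv.
Qed.

End MoreCalculus.

Section Characteristics.
Context {R : realType}.
Local Notation mu := (@lebesgue_measure R).
Implicit Types (a b c d e k lo hi r s t x y z : R) (f g F G : R -> R).

(** A solution of X' = u(t, X), with a one-sided derivative at the endpoints. The
    Lipschitz condition is what makes the mass of u in a strip that moves along X
    a Lipschitz function of time. *)
Definition characteristic (u : R -> R -> R) lo hi (X : R -> R) : Prop :=
  (exists k, forall s t, lo <= s -> s <= hi -> lo <= t -> t <= hi ->
     `|X s - X t| <= k * `|s - t|) /\
  (forall t, lo <= t -> t <= hi -> forall e, 0 < e -> exists2 d, 0 < d &
     forall s, lo <= s -> s <= hi -> `|s - t| < d ->
       `|X s - X t - u t (X t) * (s - t)| <= e * `|s - t|).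

Lemma characteristicS u lo hi lo' hi' X : lo <= lo' -> hi' <= hi ->
  characteristic u lo hi X -> characteristic u lo' hi' X.
Proof.
move=> l h [[k H1] H2]; split.
  exists k => s t ls sh lt th; apply: H1.
  - exact: le_trans ls.
  - exact: le_trans h.
  - exact: le_trans lt.
  - exact: le_trans h.
move=> t lt th e e0; have [||d d0 H] := H2 t _ _ e e0.
- exact: le_trans lt.
- exact: le_trans h.
exists d => // s ls sh; apply: H; [exact: le_trans ls|exact: le_trans h].
Qed.

Lemma characteristic_derive u lo hi X t : characteristic u lo hi X -> lo < t -> t < hi ->
  is_derive t (1 : R) X (u t (X t)).
Proof.
move=> [_ H] lt th; apply/is_derive_epsP => e e0.
have [d d0 Hd] := H t (ltW lt) (ltW th) e e0.
exists (Num.min d (Num.min (t - lo) (hi - t))).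
  by rewrite !lt_min d0 !subr_gt0 lt th.
move=> s; rewrite !lt_min => /andP[sd /andP[s1 s2]]; apply: Hd => //.
- by move: s1; rewrite ltr_norml => /andP[]; lra.
- by move: s2; rewrite ltr_norml => /andP[]; lra.
Qed.

Lemma lipschitz_within_continuous lo hi (X : R -> R) k :
  (forall s t, lo <= s -> s <= hi -> lo <= t -> t <= hi -> `|X s - X t| <= k * `|s - t|) ->
  {within `[lo, hi], continuous X}.
Proof.
move=> H; apply/within_continuousP => c lc ch e e0.
have k0 : 0 < `|k| + 1 by rewrite ltr_wpDl.
exists (e / (`|k| + 1)); first by rewrite divr_gt0.
move=> x lx xh; rewrite ltr_pdivlMr// => xc.
apply: le_lt_trans (H x c lx xh lc ch) _; apply: le_lt_trans xc.
by rewrite mulrC ler_wpM2l// (le_trans (ler_norm k))// lerDl.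
Qed.

Section fixed.
Variables (u0 : R -> R) (u : R -> R -> R).
Hypothesis hsol : CH_solution u0 u.
Hypothesis hE : forall t, 0 <= t -> (CH_energy u t <= CH_energy u 0)%E.

Lemma characteristic_velocity_continuous lo hi X : 0 <= lo -> characteristic u lo hi X ->
  {within `[lo, hi], continuous (fun t => u t (X t))}.
Proof.
move=> lo0 [[k Hk] _]; have /within_continuousP cX := lipschitz_within_continuous Hk.
apply/within_continuousP => c lc ch e e0.
have [d d0 Hd] := sol_continuous2 hsol e0.
have [d' d'0 Hd'] := cX c lc ch d d0.
exists (Num.min d d'); first by rewrite lt_min d0.
move=> x lx xh; rewrite lt_min => /andP[x1 x2]; apply: Hd.
- exact: le_trans lx.
- exact: le_trans lc.
- exact: ltW.
- by apply: ltW; apply: Hd'.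
Qed.

Lemma characteristic_primitive lo hi X : 0 <= lo -> characteristic u lo hi X ->
  primitive_on lo hi X (fun t => u t (X t)).
Proof.
move=> lo0 hX; have [[k Hk] _] := hX.
apply: within_derive_primitive.
- exact: characteristic_velocity_continuous.
- exact: lipschitz_within_continuous Hk.
- by move=> t lt th; exact: characteristic_derive hX lt th.
Qed.

Lemma dist_max0 t s : `|Num.max t 0 - Num.max s 0| <= `|t - s|.
Proof.
have [t0|t0] := leP t 0; have [s0|s0] := leP s 0.
- by rewrite subrr normr0.
- by rewrite sub0r normrN gtr0_norm// distrC ger0_norm; lra.
- by rewrite subr0 gtr0_norm// ger0_norm; lra.
- by [].
Qed.

Lemma max0_ge0 t : 0 <= Num.max t 0.
Proof. by rewrite le_max lexx orbT. Qed.

Lemma forward_characteristic x0 hi : exists2 X : R -> R, X 0 = x0 & characteristic u 0 hi X.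
Proof.
have [w [Hw w0]] := hoelder_modulus hsol.
have [|||X [X0 XL XD]] := @characteristic_exists _ (fun t x => u (Num.max t 0) x) w (speed u) x0.
- by move=> t x; apply: (sol_bound hsol hE); exact: max0_ge0.
- move=> r t s x y ts xy; apply: Hw => //; try exact: max0_ge0.
  exact: le_trans (dist_max0 t s) ts.
- exact: w0.
exists X => //; split.
  by exists (speed u) => s t s0 _ t0 _; exact: XL.
move=> t t0 _ e e0; have [d d0 H] := XD t t0 e e0.
exists d => // s s0 _ sd; have := H s s0 sd.
by rewrite max_l.
Qed.

Lemma backward_characteristic x0 hi : 0 <= hi ->
  exists2 X : R -> R, X hi = x0 & characteristic u 0 hi X.
Proof.
move=> hi0; have [w [Hw w0]] := hoelder_modulus hsol.
have [|||Y [Y0 YL YD]] := @characteristic_exists _ (fun t x => - u (Num.max (hi - t) 0) x) w (speed u) x0.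
- by move=> t x; rewrite normrN; apply: (sol_bound hsol hE); exact: max0_ge0.
- move=> r t s x y ts xy; rewrite -opprD normrN.
  apply: Hw => //; try exact: max0_ge0.
  apply: le_trans (dist_max0 _ _) _.
  have -> : hi - t - (hi - s) = - (t - s) by ring.
  by rewrite normrN.
- exact: w0.
exists (fun t => Y (hi - t)); first by rewrite subrr.
have dE s t : hi - s - (hi - t) = - (s - t) by ring.
split.
  exists (speed u) => s t s0 sh t0 th.
  by apply: (le_trans (YL _ _ _ _)); rewrite ?subr_ge0// dE normrN.
move=> t t0 th e e0.
have [|d d0 H] := YD (hi - t) _ e e0; first by rewrite subr_ge0.
exists d => // s s0 sh sd.
have := H (hi - s); rewrite subr_ge0 dE normrN => /(_ sh sd).
have -> : hi - (hi - t) = t by ring.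
by rewrite max_l// mulrNN.
Qed.

(** ** Measurability in time of the pressure along a curve *)

(** For each t the function u_x(t, .) is only known almost everywhere, which says
    nothing about its dependence on t. The difference quotients of u are jointly
    measurable, and so is the upper limit of the integrand that they define; for
    each t it agrees almost everywhere with the integrand of the pressure. *)

Section measurability.
Variables (lo hi : R) (X : R -> R).
Hypothesis (lo0 : 0 <= lo) (cX : continuous X).

Let c t := Num.max lo (Num.min t hi).

Let c_ge t : lo <= c t. Proof. by rewrite /c le_max lexx. Qed.
Let c_ge0 t : 0 <= c t. Proof. exact: le_trans (c_ge t). Qed.
Let c_id t : lo <= t -> t <= hi -> c t = t.
Proof. by move=> lt th; rewrite /c min_l// max_r. Qed.

Let c_continuous : continuous c.
Proof.
move=> t; rewrite /c.
apply: (@continuous_comp _ _ _ (fun t => Num.min t hi) (fun z => Num.max lo z)) => /=.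
  by apply: continuous_min; [exact: cvg_id|exact: cvg_cst].
by apply: continuous_max; [exact: cvg_cst|exact: cvg_id].
Qed.

Let u_continuous (Y : R -> R) : continuous Y -> continuous (fun t => u (c t) (Y t)).
Proof.
move=> cY t; apply/cvgrPdist_lt => e e0; have [d d0 H] := sol_continuous2 hsol e0.
have /cvgrPdist_le/(_ _ d0) := @c_continuous t.
have /cvgrPdist_le/(_ _ d0) := cY t.
by apply: filterS2 => s h1 h2; exact: H.
Qed.

Let quot (n : nat) t y := expR (- `|X t - y|) *
  (u (c t) y ^+ 2 + 2^-1 * (n.+1%:R * (u (c t) (y + n.+1%:R^-1) - u (c t) y)) ^+ 2).

Let kernel_continuous (Y Z : R -> R) : continuous Y -> continuous Z ->
  continuous (fun t => expR (- `|Y t - Z t|)).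
Proof.
move=> cY cZ t.
apply: (@continuous_comp _ _ _ (fun t => - `|Y t - Z t|) expR); last exact: continuous_expR.
apply: cvgN; apply: (@continuous_comp _ _ _ (fun t => Y t - Z t) Num.norm); last exact: norm_continuous.
by apply: cvgB; [exact: cY|exact: cZ].
Qed.

Let sqr_continuous (Y : R -> R) : continuous Y -> continuous (fun t => Y t ^+ 2).
Proof.
move=> cY t; rewrite (_ : (fun t => Y t ^+ 2) = fun t => Y t * Y t); first exact: cvgM (cY t) (cY t).
by apply/funext => s; rewrite expr2. Qed.

Let quot_measurable n : measurable_fun setT (fun z : R * R => quot n z.1 z.2 : R).
Proof.
apply: caratheodory_measurable => [t|y].
- apply: continuous_measurable_fun => y; apply: cvgM.
    by apply: kernel_continuous; [move=> z; exact: cvg_cst|move=> z; exact: cvg_id].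
  have cu : continuous (u (c t)) by exact: (sol_continuous hsol).
  apply: cvgD; first exact: sqr_continuous.
  apply: cvgM; first exact: cvg_cst.
  apply: (@sqr_continuous (fun y => n.+1%:R * (u (c t) (y + n.+1%:R^-1) - u (c t) y))) => z.
  apply: cvgM; first exact: cvg_cst.
  apply: cvgB; last exact: cu.
  apply: (@continuous_comp _ _ _ (fun z => z + n.+1%:R^-1) (u (c t))); last exact: cu.
  by apply: cvgD; [exact: cvg_id|exact: cvg_cst].
- have cc z : continuous (cst z : R -> R) by exact: cst_continuous.
  move=> t; apply: cvgM; first exact: (@kernel_continuous X (cst y) cX (cc y) t).
  have cu z : continuous (fun t => u (c t) z) := u_continuous (cc z).
  apply: cvgD; first exact: (@sqr_continuous (fun t => u (c t) y) (cu y) t).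
  apply: cvgM; first exact: cvg_cst.
  apply: (@sqr_continuous (fun t => n.+1%:R * (u (c t) (y + n.+1%:R^-1) - u (c t) y))) => z.
  by apply: cvgM; [exact: cvg_cst|apply: cvgB; exact: cu].
Qed.

Let integrand (z : R * R) : \bar R :=
  maxe 0%E (limn_esup (fun n => (quot n z.1 z.2)%:E)).

Let integrandE t : {ae mu, forall y,
  integrand (t, y) = (expR (- `|X t - y|) * source u (c t) y)%:E}.
Proof.
have [pu _ _ _] := sol_H1 hsol (c_ge0 t).
apply: ae_impl (primitive_ae_derive pu) => y /is_derive_epsP H.
rewrite /integrand/=.
suff : (quot n t y)%:E @[n --> \oo] --> (expR (- `|X t - y|) * source u (c t) y)%:E.
  move=> /cvg_limn_einf_sup[_ ->]; rewrite max_r// lee_fin mulr_ge0 ?expR_ge0//.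
  exact: source_ge0.
apply: cvg_EFin; first exact: nearW.
apply: cvgM; first exact: cvg_cst.
apply: cvgD; first exact: cvg_cst.
apply: cvgM; first exact: cvg_cst.
rewrite [X in X @ _ --> _](_ : _ = fun n : nat =>
    (n.+1%:R * (u (c t) (y + n.+1%:R^-1) - u (c t) y)) *
    (n.+1%:R * (u (c t) (y + n.+1%:R^-1) - u (c t) y)))//.
suff C : n.+1%:R * (u (c t) (y + n.+1%:R^-1) - u (c t) y) @[n --> \oo] --> Dx (u (c t)) y.
  by rewrite expr2; apply: cvgM.
apply/cvgrPdist_le => e e0; have [r r0 Hr] := H e e0.
have /cvgrPdist_lt/(_ _ r0) := @cvg_harmonic R.
apply: filterS => n; rewrite sub0r normrN => hn.
have n0 : 0 < n.+1%:R :> R by rewrite ltr0n.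
have := Hr (y + n.+1%:R^-1); rewrite addrAC subrr add0r => /(_ hn) K.
rewrite distrC.
have -> : n.+1%:R * (u (c t) (y + n.+1%:R^-1) - u (c t) y) - Dx (u (c t)) y =
   n.+1%:R * (u (c t) (y + n.+1%:R^-1) - u (c t) y - Dx (u (c t)) y * n.+1%:R^-1).
  by rewrite [RHS]mulrBr; congr (_ - _); rewrite mulrC divfK// gt_eqF.
rewrite normrM gtr0_norm// mulrC -ler_pdivlMr//.
by move: K; rewrite [`|_^-1|]gtr0_norm ?invr_gt0.
Qed.

Lemma measurable_pressure_curve :
  measurable_fun `[lo, hi] (fun t => pressure u t (X t)).
Proof.
have mI : measurable_fun setT integrand.
  apply: measurable_maxe => //; apply: measurable_fun_limn_esup => n.
  by apply/measurable_EFinP; exact: quot_measurable.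
have mF : measurable_fun setT (fubini_F mu integrand).
  by apply: measurable_fun_fubini_tonelli_F => // z; rewrite /integrand le_max lexx.
have FE t : fubini_F mu integrand t = (\int[mu]_y (expR (- `|X t - y|) * source u (c t) y)%:E)%E.
  apply: ae_eq_integral => //.
  - exact: measurableT_comp mI (measurable_pair1 _).
  - apply/measurable_EFinP; apply: measurable_funM.
      apply: continuous_measurable_fun.
      by apply: kernel_continuous; [move=> z; exact: cvg_cst|move=> z; exact: cvg_id].
    by have /integrableP[/measurable_EFinP] := source_integrable hsol (c_ge0 t).
  - by apply: ae_impl (integrandE t) => y ->.
have : measurable_fun `[lo, hi] (fun t => 2^-1 * fine (fubini_F mu integrand t)).
  apply: measurable_funM => //; apply: measurable_funS (_ : measurable_fun setT _) => //.
  exact: measurableT_comp mF.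
apply: eq_measurable_fun => t; rewrite inE/= in_itv/= => /andP[lt th].
rewrite FE c_id// /pressure -kernel_convE//.
by apply: (source_integrable hsol); exact: le_trans lt.
Qed.

End measurability.

Lemma pressure_derive t x : 0 <= t -> is_derive x (1 : R) (pressure u t) (pressure' u t x).
Proof.
move=> t0; apply: primitive_continuous_derive.
  exact: (pressure'_continuous hsol).
by move=> lo hi; exact: (pressure_primitive hsol).
Qed.

Lemma pressure_increment t x h : 0 <= t ->
  `|pressure u t (x + h) - pressure u t x| <= energy u * `|h|.
Proof.
move=> t0; pose b0 := Num.min x (x + h).
have b1 : b0 <= x by rewrite ge_min lexx.
have b2 : b0 <= x + h by rewrite ge_min lexx orbT.
have E z : b0 <= z -> pressure u t z = pressure u t b0 + integ b0 z (pressure' u t).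
  by move=> bz; have [_ <-//] := pressure_primitive hsol b0 z t0; ring.
have := @integ_increment_le _ (pressure' u t) b0 x (x + h) 0 (energy u)
  (pressure'_continuous hsol t0) b1 b2.
rewrite mul0r subr0 addrAC subrr add0r E// (E x)// => H.
have -> : pressure u t b0 + integ b0 (x + h) (pressure' u t) -
  (pressure u t b0 + integ b0 x (pressure' u t)) =
  integ b0 (x + h) (pressure' u t) - integ b0 x (pressure' u t) by ring.
by apply: H => z _; rewrite subr0; exact: (pressure'_bound hsol hE).
Qed.

Lemma pressure_quotient_cvg t x (h : nat -> R) : 0 <= t -> h n @[n --> \oo] --> (0 : R) ->
  (forall n, h n != 0) ->
  (h n)^-1 * (pressure u t (x + h n) - pressure u t x) @[n --> \oo] --> pressure' u t x.
Proof.
move=> t0 h0 hn0; apply/cvgrPdist_le => e e0.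
have /is_derive_epsP/(_ _ e0)[r r0 Hr] := pressure_derive x t0.
have /cvgrPdist_lt/(_ _ r0) := h0.
apply: filterS => n; rewrite sub0r normrN => hr.
have := Hr (x + h n); rewrite addrAC subrr add0r => /(_ hr) K.
rewrite distrC.
have -> : (h n)^-1 * (pressure u t (x + h n) - pressure u t x) - pressure' u t x =
  (h n)^-1 * (pressure u t (x + h n) - pressure u t x - pressure' u t x * h n).
  by rewrite [RHS]mulrBr; congr (_ - _); rewrite mulrC mulfK.
by rewrite normrM normfV mulrC ler_pdivrMr// normr_gt0.
Qed.

Section along.
Variables (lo hi : R) (X : R -> R).
Hypothesis (lo0 : 0 <= lo) (lh : lo <= hi) (hX : characteristic u lo hi X).

(** ** The acceleration along a characteristic *)

(* The curve is frozen outside [lo, hi], so as to be defined and continuous at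
   all times. *)
Let c t := Num.max lo (Num.min t hi).

Let extended_continuous : continuous (X \o c).
Proof.
have lc t : lo <= c t by rewrite /c le_max lexx.
have ch t : c t <= hi by rewrite /c ge_max lh/= ge_min lexx orbT.
have [[k Hk] _] := hX.
have /within_continuousP cX := lipschitz_within_continuous Hk.
move=> t; apply/cvgrPdist_lt => e e0.
have [d d0 Hd] := cX (c t) (lc t) (ch t) e e0.
have cc : {for t, continuous c}.
  apply: (@continuous_comp _ _ _ (fun t => Num.min t hi) (fun z => Num.max lo z)) => /=.
    by apply: continuous_min; [exact: cvg_id|exact: cvg_cst].
  by apply: continuous_max; [exact: cvg_cst|exact: cvg_id].
have /cvgrPdist_lt/(_ _ d0) := cc.
by apply: filterS => s h; rewrite distrC; apply: Hd => //; rewrite distrC.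
Qed.

Lemma measurable_pressure_characteristic h :
  measurable_fun `[lo, hi] (fun t => pressure u t (X t + h)).
Proof.
have cXh : continuous (fun t => (X \o c) t + h).
  by move=> t; apply: cvgD; [exact: extended_continuous|exact: cvg_cst].
have := @measurable_pressure_curve lo hi _ lo0 cXh.
apply: eq_measurable_fun => t; rewrite inE/= in_itv/= => /andP[lt th].
by rewrite /c min_l// max_r.
Qed.

Let hs (n : nat) : R := n.+1%:R^-1.
Let hs0 : hs n @[n --> \oo] --> (0 : R). Proof. exact: cvg_harmonic. Qed.
Let hs_neq0 n : hs n != 0. Proof. by rewrite invr_neq0// pnatr_eq0. Qed.

Lemma measurable_pressure'_characteristic :
  measurable_fun `[lo, hi] (fun t => pressure' u t (X t)).
Proof.
apply: (@measurable_fun_cvg _ _ _ _ (fun n t =>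
  (hs n)^-1 * (pressure u t (X t + hs n) - pressure u t (X t)))).
  move=> n; apply: measurable_funM => //; apply: measurable_funB.
    exact: measurable_pressure_characteristic.
  have := measurable_pressure_characteristic 0.
  by apply: eq_measurable_fun => t _; rewrite addr0.
move=> t /=; rewrite in_itv/= => /andP[lt th].
by apply: pressure_quotient_cvg => //; exact: le_trans lt.
Qed.

Lemma pressure'_characteristic_integrable :
  integrable_on lo hi (fun t => pressure' u t (X t)).
Proof.
apply: (bounded_measurable_integrable_on (k := energy u)).
  exact: measurable_pressure'_characteristic.
by move=> t lt th; apply: (pressure'_bound hsol hE); exact: le_trans lt.
Qed.

(* A Lipschitz constant of X, then a base point b0 to the left of the curve. *)
Let B := `|X lo| + `|xget 0 [set k | forall s t, lo <= s -> s <= hi -> lo <= t -> t <= hi ->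
     `|X s - X t| <= k * `|s - t|]| * (hi - lo).
Let b0 := - B - 2.

Let k := `|xget 0 [set k | forall s t, lo <= s -> s <= hi -> lo <= t -> t <= hi ->
     `|X s - X t| <= k * `|s - t|]|.

Let Xlip s t : lo <= s -> s <= hi -> lo <= t -> t <= hi -> `|X s - X t| <= k * `|s - t|.
Proof.
move=> ls sh lt th; have [[k' Hk'] _] := hX.
have /(_ s t ls sh lt th) := xgetPex 0 (ex_intro (fun k => forall s t, lo <= s -> s <= hi -> lo <= t -> t <= hi ->
     `|X s - X t| <= k * `|s - t|) k' Hk').
by move=> /le_trans; apply; rewrite ler_wpM2r// ler_norm.
Qed.

Let Xb t h : lo <= t -> t <= hi -> `|h| <= 1 -> b0 < X t + h /\ X t + h - b0 + 1 <= B + B + 4.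
Proof.
move=> lt th h1.
have XB : `|X t| <= B.
  rewrite -(subrK (X lo) (X t)) addrC; apply: (le_trans (ler_normD _ _)).
  rewrite lerD2l; apply: (le_trans (Xlip lt th (lexx lo) lh)).
  by rewrite ler_wpM2l ?normr_ge0// ger0_norm ?subr_ge0//; lra.
by move: XB h1; rewrite !ler_norml /b0 => /andP[? ?] /andP[? ?]; split; lra.
Qed.

Let strip h t := integ b0 (X t + h) (u t) - integ b0 (X t) (u t).

Let strip_lipschitz h : `|h| <= 1 -> exists K, forall s t, lo <= s -> s <= hi ->
  lo <= t -> t <= hi -> `|strip h t - strip h s| <= K * `|t - s|.
Proof.
move=> h1; have [C C0 HC] := space_integral_lipschitz hsol.
suff H (g : R) : `|g| <= 1 -> forall s t, lo <= s -> s <= hi -> lo <= t -> t <= hi ->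
   `|integ b0 (X t + g) (u t) - integ b0 (X s + g) (u s)| <=
    ((B + B + 4) * C + speed u * k) * `|t - s|.
  exists (((B + B + 4) * C + speed u * k) * 2) => s t ls sh lt th.
  have H1 := H h h1 s t ls sh lt th.
  have := H 0 _ s t ls sh lt th; rewrite normr0 ler01 !addr0 => /(_ isT) H2.
  have -> : strip h t - strip h s =
     (integ b0 (X t + h) (u t) - integ b0 (X s + h) (u s)) -
     (integ b0 (X t) (u t) - integ b0 (X s) (u s)) by rewrite /strip; ring.
  apply: (le_trans (ler_normB _ _)); rewrite mulrAC mulr_natr mulr2n.
  exact: lerD.
move=> g1 s t ls sh lt th.
have t0 := le_trans lo0 lt; have s0 := le_trans lo0 ls.
have [bt Bt] := Xb lt th g1; have [bs _] := Xb ls sh g1.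
rewrite -(subrK (integ b0 (X t + g) (u s)) (integ b0 (X t + g) (u t))) -addrA.
apply: (le_trans (ler_normD _ _)); rewrite mulrDl; apply: lerD.
  apply: (le_trans (HC t s b0 (X t + g) t0 s0 (ltW bt))).
  by rewrite -mulrA ler_wpM2r// mulr_ge0.
have := @integ_increment_le _ (u s) b0 (X s + g) (X t + g) 0 (speed u)
  (sol_continuous hsol s0) (ltW bs) (ltW bt).
rewrite mul0r subr0 => /(_ _)/le_trans; apply.
  by move=> z _; rewrite subr0; exact: (sol_bound hsol hE).
have -> : X t + g - (X s + g) = X t - X s by ring.
rewrite -mulrA ler_wpM2l//; last exact: Xlip.
by apply: le_trans (normr_ge0 _) (sol_bound hsol hE 0 s0).
Qed.

(** The mass of u between X and X + h decreases at least as fast as the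
    pressure pushes it out: the transport terms leave a negative square. *)
Let strip_le h t1 t2 : `|h| <= 1 -> lo <= t1 -> t1 <= t2 -> t2 <= hi ->
  strip h t2 - strip h t1 <=
  - integ t1 t2 (fun t => pressure u t (X t + h) - pressure u t (X t)).
Proof.
move=> h1 lt1 t12 t2h.
pose g t := pressure u t (X t + h) - pressure u t (X t).
have gk t : lo <= t -> t <= hi -> `|g t| <= energy u * `|h|.
  by move=> lt th; apply: pressure_increment; exact: le_trans lt.
have gi : integrable_on lo hi g.
  apply: (bounded_measurable_integrable_on (k := energy u * `|h|)) => //.
  apply: measurable_funB; first exact: measurable_pressure_characteristic.
  have := measurable_pressure_characteristic 0.
  by apply: eq_measurable_fun => t _; rewrite addr0.
have gp : primitive_on t1 t2 (fun t => integ t1 t g) g.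
  split=> [|a b ta ab bt]; first exact: integrable_onS gi.
  rewrite (@integ_cat _ t1 a b)//; first by ring.
  by apply: integrable_onS gi => //; exact: le_trans t2h.
have [K HK] := strip_lipschitz h1.
have := @lipschitz_ae_nonincreasing _ (fun t => strip h t + integ t1 t g) t1 t2
  (K + energy u * `|h|) t12.
rewrite integ_pt addr0 => H.
suff : strip h t2 + integ t1 t2 g <= strip h t1 by rewrite -/g; lra.
apply: H.
- move=> x y tx xy yt.
  have lx := le_trans lt1 tx; have yh := le_trans yt t2h.
  have ly := le_trans lx xy; have xh := le_trans xy yh.
  rewrite opprD addrACA; apply: (le_trans (ler_normD _ _)); rewrite mulrDl; apply: lerD.
    by rewrite -[y - x]ger0_norm ?subr_ge0//; exact: HK.
  have [_ ->//] := gp; apply: le_norm_integ_cst => //.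
    exact: integrable_onS gi.
  by move=> z xz zy; apply: gk; [exact: le_trans xz|exact: le_trans yh].
- apply: (ae_impl2 _ (ae_space_derivative hsol) (primitive_on_ae_derive gp)) => t St Gt tt1 tt2.
  have lt := le_lt_trans lt1 tt1; have th := lt_le_trans tt2 t2h.
  have t0 : 0 < t by exact: le_lt_trans lt.
  have dX := characteristic_derive hX lt th.
  have dXh : is_derive t (1 : R) (fun s => X s + h) (u t (X t)).
    by have := is_deriveD dX (is_derive_cst h t (1 : R)); rewrite addr0.
  have [bh _] := Xb (ltW lt) (ltW th) h1.
  have [] := @Xb t 0 (ltW lt) (ltW th); rewrite ?normr0// addr0 => b00 _.
  have D1 := curve_derivative hsol t0 (St t0) dXh bh.
  have D2 := curve_derivative hsol t0 (St t0) dX b00.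
  have D := is_deriveD (is_deriveB D1 D2) (Gt tt1 tt2).
  eexists; first exact: D.
  rewrite /g; have := sqr_ge0 (u t (X t + h) - u t (X t)).
  set U1 := u t (X t + h); set U2 := u t (X t); set U3 := u t b0.
  set P1 := pressure u t (X t + h); set P2 := pressure u t (X t); set P3 := pressure u t b0.
  move=> sq.
  have -> : U1 * U2 - ((U1 ^+ 2 - U3 ^+ 2) / 2 + (P1 - P3)) -
     (U2 * U2 - ((U2 ^+ 2 - U3 ^+ 2) / 2 + (P2 - P3))) + (P1 - P2) =
     - (2^-1 * (U1 - U2) ^+ 2) by field.
  by rewrite oppr_le0 mulr_ge0// invr_ge0.
Qed.

Let strip_cvg (h : nat -> R) t : lo <= t -> t <= hi -> (forall n, `|h n| <= 1) ->
  (forall n, h n != 0) -> h n @[n --> \oo] --> (0 : R) ->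
  (h n)^-1 * strip (h n) t @[n --> \oo] --> u t (X t).
Proof.
move=> lt th h1 hn0 h0; have t0 := le_trans lo0 lt.
apply/cvgrPdist_le => e e0.
have cu : continuous (u t) := sol_continuous hsol t0.
have /cvgrPdist_le/(_ _ e0)/nbhs_ballP[r /= r0 Hr] := cu (X t).
have /cvgrPdist_lt/(_ _ r0) := h0.
apply: filterS => n; rewrite sub0r normrN => hr.
have [bh _] := Xb lt th (h1 n).
have [] := @Xb t 0 lt th; rewrite ?normr0// addr0 => b00 _.
have := @integ_increment_le _ (u t) b0 (X t) (X t + h n) (u t (X t)) e
  (sol_continuous hsol t0) (ltW b00) (ltW bh).
rewrite [X t + h n - X t]addrAC subrr add0r => K.
have {}K : `|strip (h n) t - u t (X t) * h n| <= e * `|h n|.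
  apply: K => z zX; rewrite distrC; apply: Hr; rewrite /ball/= distrC.
  exact: le_lt_trans zX hr.
rewrite distrC.
have -> : (h n)^-1 * strip (h n) t - u t (X t) = (h n)^-1 * (strip (h n) t - u t (X t) * h n).
  by rewrite [RHS]mulrBr; congr (_ - _); rewrite mulrC mulfK.
by rewrite normrM normfV mulrC ler_pdivrMr// normr_gt0.
Qed.

Let quotient_integ_cvg (h : nat -> R) t1 t2 : lo <= t1 -> t1 <= t2 -> t2 <= hi ->
  (forall n, h n != 0) -> h n @[n --> \oo] --> (0 : R) ->
  (h n)^-1 * integ t1 t2 (fun t => pressure u t (X t + h n) - pressure u t (X t))
  @[n --> \oo] --> integ t1 t2 (fun t => pressure' u t (X t)).
Proof.
move=> lt1 t12 t2h hn0 h0.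
have sub : `[t1, t2] `<=` `[lo, hi] by apply: subset_itv; rewrite bnd_simp.
have mg n : measurable_fun `[lo, hi] (fun t => pressure u t (X t + h n) - pressure u t (X t)).
  apply: measurable_funB; first exact: measurable_pressure_characteristic.
  have := measurable_pressure_characteristic 0.
  by apply: eq_measurable_fun => t _; rewrite addr0.
rewrite [X in X @ _ --> _](_ : _ = fun n => integ t1 t2 (fun t =>
   (h n)^-1 * (pressure u t (X t + h n) - pressure u t (X t)))); last first.
  apply/funext => n; rewrite integZ//.
  apply: (bounded_measurable_integrable_on (k := energy u * `|h n|)).
    exact: measurable_funS (mg n).
  move=> t tt1 tt2; apply: pressure_increment.
  by apply: (le_trans lo0); exact: le_trans tt1.
apply: (integ_bounded_cvg (k := energy u)).
- by move=> n; apply: measurable_funM => //; exact: measurable_funS (mg n).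
- exact: measurable_funS measurable_pressure'_characteristic.
- move=> n t tt1 tt2; rewrite normrM normfV mulrC ler_pdivrMr ?normr_gt0//.
  by apply: pressure_increment; apply: (le_trans lo0); exact: le_trans tt1.
- move=> t tt1 tt2; apply: pressure_quotient_cvg => //.
  by apply: (le_trans lo0); exact: le_trans tt1.
Qed.

(** Along characteristics the quasilinear equation becomes an integral equation:
    strips to the right and to the left of X give the two inequalities. *)
Lemma characteristic_acceleration :
  primitive_on lo hi (fun t => u t (X t)) (fun t => - pressure' u t (X t)).
Proof.
split; first by apply: integrable_onN; exact: pressure'_characteristic_integrable.
move=> t1 t2 lt1 t12 t2h.
have lt2 := le_trans lt1 t12; have t1h := le_trans t12 t2h.
have ip : integrable_on t1 t2 (fun t => pressure' u t (X t)).
  by apply: integrable_onS pressure'_characteristic_integrable.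
rewrite integN//.
have hs1 n : `|hs n| <= 1.
  by rewrite /hs gtr0_norm ?invr_gt0 ?ltr0n// invf_le1 ?ltr0n// ler1n.
have nhs1 n : `|- hs n| <= 1 by rewrite normrN.
have nhs_neq0 n : - hs n != 0 by rewrite oppr_eq0.
have nhs0 : - hs n @[n --> \oo] --> (0 : R) by rewrite -[X in _ --> X]oppr0; exact: cvgN.
apply/eqP; rewrite eq_le; apply/andP; split.
- apply: (ler_cvg_to (a := \oo) (f := fun n => (hs n)^-1 * strip (hs n) t2 - (hs n)^-1 * strip (hs n) t1)
    (g := fun n => - ((hs n)^-1 * integ t1 t2 (fun t => pressure u t (X t + hs n) - pressure u t (X t))))).
  + by apply: cvgB; exact: strip_cvg.
  + by apply: cvgN; exact: quotient_integ_cvg.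
  + apply: nearW => n; rewrite -mulrBr -mulrN ler_pM2l; first exact: strip_le.
    by rewrite invr_gt0 /hs invr_gt0 ltr0n.
- apply: (ler_cvg_to (a := \oo) (g := fun n => (- hs n)^-1 * strip (- hs n) t2 - (- hs n)^-1 * strip (- hs n) t1)
    (f := fun n => - ((- hs n)^-1 * integ t1 t2 (fun t => pressure u t (X t + - hs n) - pressure u t (X t))))).
  + by apply: cvgN; exact: (quotient_integ_cvg (h := fun n => - hs n)).
  + by apply: cvgB; exact: (strip_cvg (h := fun n => - hs n)).
  + apply: nearW => n; rewrite -mulrBr -mulrN ler_nM2l; first exact: strip_le.
    by rewrite invr_lt0 oppr_lt0 /hs invr_gt0 ltr0n.
Qed.

End along.
End fixed.
End Characteristics.

(** * The energy gap of a profile above the antisymmetric peakon *)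

Section Gap.
Context {R : realType}.
Local Notation mu := (@lebesgue_measure R).

Definition odd_peakon (beta a b y : R) :=
  beta * (expR (- `|y - b|) - expR (- `|y - a|)).

(** On a piece where m'' = m and m'^2 = m^2 - k, the cubic density
    2 m' f + 2 M (w^2 + w'^2), with f = w^2 + w'^2 / 2, differs from an exact
    derivative by a quadratic form in w - m and w' - m' that is nonnegative
    when M >= |m'|. The exact derivative is that of [gap_flux] below. *)
Lemma gap_identity (m m' w g k M : R) : m' ^+ 2 = m ^+ 2 - k ->
  2 * m' * (w ^+ 2 + 2^-1 * g ^+ 2) + 2 * M * (w ^+ 2 + g ^+ 2) -
   (m' * m ^+ 2 + m * (2 * m * m') - k * m' +
    2 * (2 * m' * m * (w - m) + m' ^+ 2 * (g - m')) +
    2 * M * (2 * (g * m' + w * m) - (m' * m' + m * m))) =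
  2 * (m' + M) * (w - m) ^+ 2 + (m' + 2 * M) * (g - m') ^+ 2.
Proof.
move=> E; have : m' * (m' ^+ 2 - (m ^+ 2 - k)) = 0 by rewrite E subrr mulr0.
move=> H; apply/eqP; rewrite -subr_eq0 -[X in _ == X]H; by apply/eqP; field.
Qed.

Lemma gap_pointwise (m m' w g k M M0 : R) : M0 <= M -> `|m'| <= M0 ->
  m' ^+ 2 = m ^+ 2 - k ->
  2 * (M - M0) * (w - m) ^+ 2 - 2 * M * (w ^+ 2 + g ^+ 2) <=
  2 * m' * (w ^+ 2 + 2^-1 * g ^+ 2) -
   (m' * m ^+ 2 + m * (2 * m * m') - k * m' +
    2 * (2 * m' * m * (w - m) + m' ^+ 2 * (g - m')) +
    2 * M * (2 * (g * m' + w * m) - (m' * m' + m * m))).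
Proof.
move=> hM; rewrite ler_norml => /andP[h1 h2] K.
rewrite lerBlDr addrAC (gap_identity _ _ _ K).
apply: (@le_trans _ _ (2 * (m' + M) * (w - m) ^+ 2)).
  by rewrite ler_wpM2r ?sqr_ge0// ler_wpM2l//; lra.
by rewrite lerDl mulr_ge0 ?sqr_ge0//; lra.
Qed.

Section piece.
Variables (w g : R -> R) (A B M M0 lo hi : R).
Let f y := w y ^+ 2 + 2^-1 * g y ^+ 2.
Hypothesis (hw : primitive_on lo hi w g) (fi : mu.-integrable setT (EFin \o f)).
Hypothesis (ei : integrable_on lo hi (fun y => w y ^+ 2 + g y ^+ 2)).
Let m y := A * expR y + B * expR (- y).
Let m' y := A * expR y + B * - expR (- y).
Hypothesis (hM : M0 <= M).
Hypothesis (hM0 : forall y, lo <= y -> y <= hi -> `|m' y| <= M0).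

Definition gap_flux y := m y * m y ^+ 2 - 4 * A * B * m y +
  2 * (m' y ^+ 2 * (w y - m y)) + 2 * M * (2 * (w y * m' y) - m y * m' y).

(** The right-hand side is the integral of 2 m' f + 2 M (w^2 + w'^2), since m' is a
    combination of two exponentials. *)
Lemma gap_piece : lo <= hi ->
  gap_flux hi - gap_flux lo +
    2 * (M - M0) * integ lo hi (fun y => (w y - m y) ^+ 2) <=
  2 * A * (left_exp f hi - left_exp f lo) + 2 * B * (right_exp f hi - right_exp f lo) +
  2 * M * integ lo hi (fun y => w y ^+ 2 + g y ^+ 2).
Proof.
move=> lh.
have hm : primitive_on lo hi m m'.
  exact: primitive_onD (primitive_onZ A (expR_primitive lo hi))
    (primitive_onZ B (expRN_primitive lo hi)).
have hm' : primitive_on lo hi m' m.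
  have := primitive_onD (primitive_onZ A (expR_primitive lo hi))
    (primitive_onZ B (primitive_onN (expRN_primitive lo hi))).
  by apply: eq_primitive_on => // y _ _; rewrite /m opprK.
have hG : primitive_on lo hi gap_flux (fun y =>
  (m' y * m y ^+ 2 + m y * (2 * m y * m' y) - 4 * A * B * m' y +
    2 * (2 * m' y * m y * (w y - m y) + m' y ^+ 2 * (g y - m' y)) +
    2 * M * (2 * (g y * m' y + w y * m y) - (m' y * m' y + m y * m y)))).
  apply: primitive_onD; first apply: primitive_onD.
  - apply: primitive_onB; first exact: primitive_onM (primitive_on_sqr hm).
    exact: primitive_onZ.
  - apply: primitive_onZ; apply: primitive_onM; first exact: primitive_on_sqr.
    exact: primitive_onB.
  - apply: primitive_onZ; apply: primitive_onB; last exact: primitive_onM.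
    by apply: primitive_onZ; exact: primitive_onM.
have hF := primitive_onB (primitive_onD (primitive_onZ (2 * A) (left_exp_primitive fi lo hi))
  (primitive_onZ (2 * B) (right_exp_primitive fi lo hi))) hG.
have [Ii /(_ lo hi (lexx _) lh (lexx _)) E] := hF.
have zi : integrable_on lo hi (fun y => (w y - m y) ^+ 2).
  apply: within_continuous_integrable_on.
  have := primitive_onB hw hm => /primitive_on_sqr; exact: primitive_on_continuous.
have : integ lo hi (fun y => 2 * (M - M0) * (w y - m y) ^+ 2 - 2 * M * (w y ^+ 2 + g y ^+ 2)) <=
   integ lo hi (fun y => 2 * A * (expR y * f y) + 2 * B * - (expR (- y) * f y) -
   (m' y * m y ^+ 2 + m y * (2 * m y * m' y) - 4 * A * B * m' y +
    2 * (2 * m' y * m y * (w y - m y) + m' y ^+ 2 * (g y - m' y)) +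
    2 * M * (2 * (g y * m' y + w y * m y) - (m' y * m' y + m y * m y)))).
  apply: le_integ => [||y y1 y2].
  - by apply: integrable_onB; exact: integrable_onZ.
  - exact: Ii.
  - have K : m' y ^+ 2 = m y ^+ 2 - 4 * A * B.
      have EE : expR y * expR (- y) = 1 by rewrite -expRD subrr expR0.
      have -> : m y ^+ 2 - 4 * A * B = m y ^+ 2 - 4 * A * B * (expR y * expR (- y)).
        by rewrite EE mulr1.
      by rewrite /m /m'; ring.
    have -> : 2 * A * (expR y * f y) + 2 * B * - (expR (- y) * f y) =
      2 * m' y * (w y ^+ 2 + 2^-1 * g y ^+ 2) by rewrite /m' /f; ring.
    exact: gap_pointwise hM (hM0 y1 y2) K.
rewrite integB//; [|exact: integrable_onZ|exact: integrable_onZ].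
rewrite !integZ// -E => H; lra.
Qed.

End piece.

Lemma gap_fluxE w A B M y (x x' k : R) : A * expR y + B * expR (- y) = x ->
  A * expR y + B * - expR (- y) = x' -> 4 * A * B = k ->
  gap_flux w A B M y = x * x ^+ 2 - k * x + 2 * (x' ^+ 2 * (w y - x)) +
    2 * M * (2 * (w y * x') - x * x').
Proof. by rewrite /gap_flux => -> -> ->. Qed.

(** The flux at the far end of the left piece, where m' = m; on the right piece
    m' = - m, and a change of sign of w leads back to the same expression. *)
Lemma flux_small (x c W M w eps : R) : 0 <= M -> 0 <= eps -> eps <= 1 -> 0 <= c ->
  `|x| <= c * eps -> `|w| <= W ->
  `|x * x ^+ 2 + 2 * (x ^+ 2 * (w - x)) + 2 * M * (2 * (w * x) - x * x)| <=
    eps * (c * (c ^+ 2 + 2 * (c * (W + c)) + 2 * M * (2 * W + c))).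
Proof.
move=> M0 e0 e1 c0 hx hw.
have -> : x * x ^+ 2 + 2 * (x ^+ 2 * (w - x)) + 2 * M * (2 * (w * x) - x * x) =
  x * (x ^+ 2 + 2 * (x * (w - x)) + 2 * M * (2 * w - x)) by ring.
rewrite normrM; set K := (X in c * X); have -> : eps * (c * K) = c * eps * K by ring.
rewrite /K; apply: ler_pM => //.
have xc : `|x| <= c by apply: (le_trans hx); rewrite ler_piMr.
apply: (le_trans (ler_normD _ _)); apply: lerD; last first.
  rewrite normrM (ger0_norm (_ : 0 <= 2 * M)) ?mulr_ge0// ler_wpM2l ?mulr_ge0//.
  apply: (le_trans (ler_normB _ _)); apply: lerD => //.
  by rewrite normrM normr_nat ler_wpM2l.
apply: (le_trans (ler_normD _ _)); apply: lerD.
  by rewrite normrX lerXn2r// nnegrE.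
rewrite normrM normr_nat ler_wpM2l// normrM; apply: ler_pM => //.
by apply: (le_trans (ler_normB _ _)); apply: lerD.
Qed.

Lemma odd_peakon_continuous beta a b : continuous (odd_peakon beta a b).
Proof.
have H c : continuous (fun y : R => expR (- `|y - c|)).
  move=> y; apply: (@continuous_comp _ _ _ (fun y => - `|y - c|) expR); last exact: continuous_expR.
  apply: cvgN; apply: (@continuous_comp _ _ _ (fun y => y - c) Num.norm); last exact: norm_continuous.
  by apply: cvgB; [exact: cvg_id|exact: cvg_cst].
by move=> y; apply: cvgM; [exact: cvg_cst|apply: cvgB; exact: H].
Qed.

Lemma gap_assembly (r1 r2 r3 r4 r5 r6 l1 l2 l3 s1 s2 v1 v2 v3 x1 x2 x3 c1 c2 e y1 y2 y3 : R) :
  - c1 <= s1 -> s2 <= c1 -> r5 <= c2 -> - c2 <= r6 ->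
  r1 - r2 + r3 - r4 = v2 + v3 -> l1 + l2 + l3 = v1 - 2 * s1 + 2 * s2 ->
  y1 + (y2 + y3) <= e ->
  r1 - r5 + x1 <= l1 + y1 -> r3 - r2 + x2 <= l2 + y2 -> r6 - r4 + x3 <= l3 + y3 ->
  x1 + x2 + x3 <= v1 - v2 + (e - v3) + (4 * c1 + 2 * c2).
Proof. lra. Qed.

Lemma integ_subset (p q p' q' : R) (h : R -> R) : (forall y, 0 <= h y) ->
  (forall lo hi, integrable_on lo hi h) -> p' <= p -> q <= q' ->
  integ p q h <= integ p' q' h.
Proof.
move=> h0 hi pp qq; case: (leP p q) => pq; last by rewrite integ_lt//; exact: integ_ge0.
rewrite (@integ_cat _ p' p q')//; last exact: le_trans qq.
rewrite (@integ_cat _ p q q')//.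
by rewrite addrCA lerDl addr_ge0//; exact: integ_ge0.
Qed.

Lemma continuous_integ_eq0 (h : R -> R) : continuous h -> (forall y, 0 <= h y) ->
  (forall p q, integ p q h <= 0) -> forall y, h y = 0.
Proof.
move=> ch h0 H y; apply/eqP; rewrite eq_le h0 andbT leNgt; apply/negP => hy.
have hy2 : 0 < h y / 2 by rewrite divr_gt0.
have /cvgrPdist_lt/(_ _ hy2)/nbhs_ballP[d /= d0 Hd] := ch y.
have := H (y - d / 2) (y + d / 2); apply/negP; rewrite -ltNge.
have lh : y - d / 2 <= y + d / 2 by have := d0; lra.
apply: (@lt_le_trans _ _ (integ (y - d / 2) (y + d / 2) (fun=> h y / 2))).
  by rewrite integ_cst// mulr_gt0//; have := d0; lra.
apply: le_integ; [exact: integrable_on_cst|exact: continuous_integrable_on|].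
move=> x x1 x2; have xd : `|y - x| < d by rewrite ltr_norml; apply/andP; split; have := d0; lra.
have := Hd x xd; rewrite ltr_norml => /andP[_]; lra.
Qed.

Lemma ae_neq (c : R) : {ae mu, forall x, x != c}.
Proof.
exists [set c]; split => //; first exact: lebesgue_measure_set1.
by move=> x /= /negP; rewrite negbK => /eqP.
Qed.

Lemma ae_eq_integ (f g : R -> R) p q : integrable_on p q f -> integrable_on p q g ->
  {ae mu, forall x, p < x -> x < q -> f x = g x} -> integ p q f = integ p q g.
Proof.
move=> fi gi H; congr fine; apply: ae_eq_integral => //.
- by have /integrableP[] := fi.
- by have /integrableP[] := gi.
apply: (ae_impl2 _ H (ae_impl2 (fun x => @conj _ _) (ae_neq p) (ae_neq q))).
move=> x {}H [xp xq] /=.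
rewrite in_itv/= => /andP[px qx].
by rewrite H// lt_neqAle ?px ?qx ?andbT// eq_sym.
Qed.

(** On an interval where the function is a combination of two exponentials,
    its energy density is an exact derivative. *)
Lemma exponential_energy (w g : R -> R) A B p q :
  {ae mu, forall x, is_derive x (1 : R) w (g x)} ->
  integrable_on p q (fun y => w y ^+ 2 + g y ^+ 2) -> p <= q ->
  (forall y, p <= y -> y <= q -> w y = A * expR y + B * expR (- y)) ->
  integ p q (fun y => w y ^+ 2 + g y ^+ 2) =
   (A * expR q + B * expR (- q)) * (A * expR q + B * - expR (- q)) -
   (A * expR p + B * expR (- p)) * (A * expR p + B * - expR (- p)).
Proof.
move=> dw ei pq wE.
pose m y := A * expR y + B * expR (- y).
pose m' y := A * expR y + B * - expR (- y).
have hm : primitive_on p q m m'.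
  exact: primitive_onD (primitive_onZ A (expR_primitive p q))
    (primitive_onZ B (expRN_primitive p q)).
have hm' : primitive_on p q m' m.
  have := primitive_onD (primitive_onZ A (expR_primitive p q))
    (primitive_onZ B (primitive_onN (expRN_primitive p q))).
  by apply: eq_primitive_on => // y _ _; rewrite /m opprK.
have [Ii /(_ p q (lexx _) pq (lexx _)) E] := primitive_onM hm hm'.
rewrite -/(m q) -/(m' q) -/(m p) -/(m' p) E.
apply: ae_eq_integ => //; apply: (ae_impl _ dw) => x dx px xq.
have -> : w x = m x by apply: wE; exact: ltW.
have dm : is_derive x (1 : R) m (m' x).
  have h1 := is_derive_expRN x.
  have h2 : is_derive x (1 : R) expR (expR x) by exact: is_derive_expR.
  have H := is_deriveD (is_deriveZ A h2) (is_deriveZ B h1).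
  exact: H.
have -> : g x = m' x.
  apply: is_derive_unique_val dx _.
  have E' : \forall z \near x, m z = w z.
    near=> z; apply/esym/wE; apply: ltW; near: z.
      exact: lt_nbhsr.
    exact: lt_nbhsl.
  exact: near_eq_is_derive E' dm.
by rewrite !expr2 addrC.
Unshelve. all: by end_near.
Qed.

Section odd_gap.
Variables (w g : R -> R) (beta a b E W : R).
Let f y := w y ^+ 2 + 2^-1 * g y ^+ 2.
Hypothesis (hw : forall lo hi, primitive_on lo hi w g).
Hypothesis (f0 : forall y, 0 <= f y) (fi : mu.-integrable setT (EFin \o f)).
Hypothesis (ei : forall lo hi, integrable_on lo hi (fun y => w y ^+ 2 + g y ^+ 2)).
Hypothesis (eE : forall lo hi, integ lo hi (fun y => w y ^+ 2 + g y ^+ 2) <= E).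
Hypothesis (wW : forall y, `|w y| <= W).
Hypothesis (ab : a < b).
Let e := expR (a - b).
Let d := beta * (1 - e).
Hypothesis (wab : w b - w a = 2 * d).
Let mass := \int[mu]_x f x.

Let eN : expR (a - b) = expR a * expR (- b). Proof. by rewrite expRD. Qed.
Let EE x : expR x * expR (- x) = 1 :> R. Proof. by rewrite -expRD subrr expR0. Qed.
Let e0 : 0 <= e. Proof. exact: expR_ge0. Qed.
Let e1 : e <= 1. Proof. by rewrite -expR0 ler_expR subr_le0; exact: ltW. Qed.

Let A1 := beta * (expR (- b) - expR (- a)).
Let A2 := beta * expR (- b).
Let B2 := - (beta * expR a).
Let B3 := beta * (expR b - expR a).

Let A1a : A1 * expR a = - d.
Proof.
transitivity (beta * (expR a * expR (- b)) - beta * (expR a * expR (- a))).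
  by rewrite /A1; ring.
by rewrite EE /d /e eN; ring.
Qed.

Let mid_a : A2 * expR a + B2 * expR (- a) = - d.
Proof.
transitivity (beta * (expR a * expR (- b)) - beta * (expR a * expR (- a))).
  by rewrite /A2 /B2; ring.
by rewrite EE /d /e eN; ring.
Qed.

Let mid'_a : A2 * expR a + B2 * - expR (- a) = beta * (1 + e).
Proof.
transitivity (beta * (expR a * expR (- b)) + beta * (expR a * expR (- a))).
  by rewrite /A2 /B2; ring.
by rewrite EE /e eN; ring.
Qed.

Let mid_b : A2 * expR b + B2 * expR (- b) = d.
Proof.
transitivity (beta * (expR b * expR (- b)) - beta * (expR a * expR (- b))).
  by rewrite /A2 /B2; ring.
by rewrite EE /d /e eN; ring.
Qed.

Let mid'_b : A2 * expR b + B2 * - expR (- b) = beta * (1 + e).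
Proof.
transitivity (beta * (expR b * expR (- b)) + beta * (expR a * expR (- b))).
  by rewrite /A2 /B2; ring.
by rewrite EE /e eN; ring.
Qed.

Let B3b : B3 * expR (- b) = d.
Proof.
transitivity (beta * (expR b * expR (- b)) - beta * (expR a * expR (- b))).
  by rewrite /B3; ring.
by rewrite EE /d /e eN; ring.
Qed.

Let left_small y : y <= a -> `|A1 * expR y| <= `|beta| * expR (y - a).
Proof.
move=> ya; rewrite /A1 -mulrA normrM ler_wpM2l//.
have -> : (expR (- b) - expR (- a)) * expR y = - (expR (y - a) * (1 - e)).
  rewrite /e eN expRD.
  transitivity (- (expR y * expR (- a) - expR y * (expR a * expR (- a)) * expR (- b))); last ring.
  by rewrite EE; ring.
rewrite normrN normrM ger0_norm ?expR_ge0// ler_piMr ?expR_ge0// ger0_norm ?subr_ge0//.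
by rewrite lerBlDr lerDl.
Qed.

Let right_small y : b <= y -> `|B3 * expR (- y)| <= `|beta| * expR (b - y).
Proof.
move=> ya; rewrite /B3 -mulrA normrM ler_wpM2l//.
have -> : (expR b - expR a) * expR (- y) = expR (b - y) * (1 - e).
  rewrite /e eN expRD.
  transitivity (expR b * expR (- y) - expR (- y) * (expR b * expR (- b)) * expR a); last ring.
  by rewrite EE; ring.
rewrite normrM ger0_norm ?expR_ge0// ler_piMr ?expR_ge0// ger0_norm ?subr_ge0//.
by rewrite lerBlDr lerDl.
Qed.

Let peakon_left y : y <= a -> odd_peakon beta a b y = A1 * expR y + 0 * expR (- y).
Proof.
move=> ya; have yb : y <= b by apply: le_trans ya _; exact: ltW.
rewrite /odd_peakon !ler0_norm ?subr_le0// !opprK !expRD /A1; ring.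
Qed.

Let peakon_mid y : a <= y -> y <= b -> odd_peakon beta a b y = A2 * expR y + B2 * expR (- y).
Proof.
move=> ya yb.
rewrite /odd_peakon ler0_norm ?subr_le0// ger0_norm ?subr_ge0// opprK opprB !expRD /A2 /B2; ring.
Qed.

Let peakon_right y : b <= y -> odd_peakon beta a b y = 0 * expR y + B3 * expR (- y).
Proof.
move=> yb; have ya : a <= y by apply: le_trans yb; exact: ltW.
rewrite /odd_peakon !ger0_norm ?subr_ge0// !opprB !expRD /B3; ring.
Qed.

Let z2 y := (w y - odd_peakon beta a b y) ^+ 2.

Let z2c : continuous z2.
Proof.
move=> y; have cw := primitive_continuous hw (x := y).
have cz : {for y, continuous (fun y => w y - odd_peakon beta a b y)}.
  by apply: cvgB; [exact: cw|exact: odd_peakon_continuous].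
have -> : z2 = fun y => (w y - odd_peakon beta a b y) * (w y - odd_peakon beta a b y).
  by apply/funext => x; rewrite /z2 expr2.
exact: cvgM.
Qed.

Let z2i lo hi : integrable_on lo hi z2.
Proof. exact: continuous_integrable_on z2c. Qed.

(** The three pieces of the peakon m, on a bounded interval. Although w need not
    equal m at the crests, the jumps of the flux involve w only through
    w b - w a: w - m takes the same value at a and at b, and m is odd about
    their midpoint. *)
Lemma odd_gap_truncated p q M eps : 2 * `|beta| <= M -> p <= a -> b <= q ->
  expR (p - a) <= eps -> expR (b - q) <= eps -> eps <= 1 ->
  2 * (M - 2 * `|beta|) * integ p q z2 <=
    - 4 * beta * (kernel_conv' f b - kernel_conv' f a) - 4 * beta ^+ 2 * e * (2 * d) +
    2 * M * (E - 2 * beta * (2 * d)) +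
    eps * (4 * `|beta| * mass +
       2 * (`|beta| * (`|beta| ^+ 2 + 2 * (`|beta| * (W + `|beta|)) + 2 * M * (2 * W + `|beta|)))).
Proof.
move=> hM pa bq pe qe eps1.
have b0 : 0 <= `|beta| by [].
have M0 : 0 <= M by apply: le_trans hM; rewrite mulr_ge0.
have aq : a <= q by apply: le_trans bq; exact: ltW.
have eps0 : 0 <= eps by apply: le_trans pe; exact: expR_ge0.
have h1 := @gap_piece w g A1 0 M (2 * `|beta|) p a (hw p a) fi (ei p a) hM.
have h2 := @gap_piece w g A2 B2 M (2 * `|beta|) a b (hw a b) fi (ei a b) hM.
have h3 := @gap_piece w g 0 B3 M (2 * `|beta|) b q (hw b q) fi (ei b q) hM.
have {}h1 := h1 _ pa; have {}h2 := h2 _ (ltW ab); have {}h3 := h3 _ bq.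
have T1 y : p <= y -> y <= a -> `|A1 * expR y + 0 * - expR (- y)| <= 2 * `|beta|.
  move=> _ ya; rewrite mul0r addr0; apply: (le_trans (left_small ya)).
  have : expR (y - a) <= 1 by rewrite -expR0 ler_expR subr_le0.
  by move=> /(ler_wpM2l b0); lra.
have T3 y : b <= y -> y <= q -> `|0 * expR y + B3 * - expR (- y)| <= 2 * `|beta|.
  move=> ya _; rewrite mul0r add0r mulrN normrN; apply: (le_trans (right_small ya)).
  have : expR (b - y) <= 1 by rewrite -expR0 ler_expR subr_le0.
  by move=> /(ler_wpM2l b0); lra.
have T2 y : a <= y -> y <= b -> `|A2 * expR y + B2 * - expR (- y)| <= 2 * `|beta|.
  move=> ya yb.
  have -> : A2 * expR y + B2 * - expR (- y) = beta * (expR (y - b) + expR (a - y)).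
    by rewrite !expRD /A2 /B2; ring.
  rewrite normrM mulrC ler_wpM2r// ger0_norm ?addr_ge0 ?expR_ge0//.
  have i1 : expR (y - b) <= 1 by rewrite -expR0 ler_expR subr_le0.
  have i2 : expR (a - y) <= 1 by rewrite -expR0 ler_expR subr_le0.
  exact: lerD i1 i2.
have {}h1 := h1 T1; have {}h2 := h2 T2; have {}h3 := h3 T3.
have Z1 : integ p a (fun y => (w y - (A1 * expR y + 0 * expR (- y))) ^+ 2) = integ p a z2.
  by apply: eq_integ => y _ ya; rewrite /z2 peakon_left.
have Z2 : integ a b (fun y => (w y - (A2 * expR y + B2 * expR (- y))) ^+ 2) = integ a b z2.
  by apply: eq_integ => y ya yb; rewrite /z2 peakon_mid.
have Z3 : integ b q (fun y => (w y - (0 * expR y + B3 * expR (- y))) ^+ 2) = integ b q z2.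
  by apply: eq_integ => y ya yb; rewrite /z2 peakon_right.
rewrite Z1 in h1; rewrite Z2 in h2; rewrite Z3 in h3.
have ZZ : integ p q z2 = integ p a z2 + integ a b z2 + integ b q z2.
  by rewrite (@integ_cat _ p a q)// (@integ_cat _ a b q) ?addrA//; exact: ltW.
have := eE p q.
rewrite (@integ_cat _ p a q)// (@integ_cat _ a b q)//; [|exact: ltW].
have G1a : gap_flux w A1 0 M a =
  - d * (- d) ^+ 2 - 0 * (- d) + 2 * ((- d) ^+ 2 * (w a - (- d))) + 2 * M * (2 * (w a * (- d)) - (- d) * (- d)).
  by apply: gap_fluxE; rewrite ?A1a ?mul0r ?mulr0 ?addr0.
have G2a : gap_flux w A2 B2 M a =
  - d * (- d) ^+ 2 - (- 4 * beta ^+ 2 * e) * (- d) + 2 * ((beta * (1 + e)) ^+ 2 * (w a - (- d))) +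
   2 * M * (2 * (w a * (beta * (1 + e))) - (- d) * (beta * (1 + e))).
  by apply: gap_fluxE; [exact: mid_a|exact: mid'_a|rewrite /A2 /B2 /e eN; ring].
have G2b : gap_flux w A2 B2 M b =
  d * d ^+ 2 - (- 4 * beta ^+ 2 * e) * d + 2 * ((beta * (1 + e)) ^+ 2 * (w b - d)) +
   2 * M * (2 * (w b * (beta * (1 + e))) - d * (beta * (1 + e))).
  by apply: gap_fluxE; [exact: mid_b|exact: mid'_b|rewrite /A2 /B2 /e eN; ring].
have G3b : gap_flux w 0 B3 M b =
  d * d ^+ 2 - 0 * d + 2 * ((- d) ^+ 2 * (w b - d)) + 2 * M * (2 * (w b * (- d)) - d * (- d)).
  by apply: gap_fluxE; rewrite ?mulrN ?B3b ?mulr0 ?mul0r ?add0r.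
have A1p : `|A1 * expR p| <= `|beta| * eps.
  by apply: (le_trans (left_small pa)); rewrite ler_wpM2l.
have B3q : `|B3 * expR (- q)| <= `|beta| * eps.
  by apply: (le_trans (right_small bq)); rewrite ler_wpM2l.
have G1p := @flux_small _ _ W M (w p) eps M0 eps0 eps1 b0 A1p (wW p).
have G3q := @flux_small (- (B3 * expR (- q))) _ W M (- w q) eps M0 eps0 eps1 b0.
rewrite !normrN in G3q; have {}G3q := G3q B3q (wW q).
have G1p' : gap_flux w A1 0 M p = A1 * expR p * (A1 * expR p) ^+ 2 +
   2 * ((A1 * expR p) ^+ 2 * (w p - A1 * expR p)) +
   2 * M * (2 * (w p * (A1 * expR p)) - A1 * expR p * (A1 * expR p)).
  by rewrite /gap_flux; ring.
have G3q' : gap_flux w 0 B3 M q = - (- (B3 * expR (- q)) * (- (B3 * expR (- q))) ^+ 2 +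
   2 * ((- (B3 * expR (- q))) ^+ 2 * (- w q - (- (B3 * expR (- q))))) +
   2 * M * (2 * (- w q * (- (B3 * expR (- q)))) - (- (B3 * expR (- q))) * (- (B3 * expR (- q))))).
  rewrite /gap_flux; ring.
have EG : gap_flux w A1 0 M a - gap_flux w A2 B2 M a + gap_flux w A2 B2 M b - gap_flux w 0 B3 M b =
    4 * beta ^+ 2 * e * (2 * d) + 2 * M * (2 * beta * (2 * d)).
  rewrite G1a G2a G2b G3b; have -> : w b = w a + 2 * d by rewrite -wab; ring.
  by rewrite /d; ring.
have EL : 2 * A1 * (left_exp f a - left_exp f p) + 2 * 0 * (right_exp f a - right_exp f p) +
  (2 * A2 * (left_exp f b - left_exp f a) + 2 * B2 * (right_exp f b - right_exp f a)) +
  (2 * 0 * (left_exp f q - left_exp f b) + 2 * B3 * (right_exp f q - right_exp f b)) =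
  - 4 * beta * (kernel_conv' f b - kernel_conv' f a) - 2 * (A1 * left_exp f p) +
   2 * (B3 * right_exp f q).
  by rewrite /kernel_conv' /A1 /A2 /B2 /B3; field.
have tail1 : `|A1 * left_exp f p| <= `|beta| * eps * mass.
  apply: (@le_trans _ _ (`|A1 * expR p| * mass)).
    rewrite (normrM A1 (left_exp f p)) (normrM A1 (expR p)) -[leRHS]mulrA ler_wpM2l//.
    rewrite !ger0_norm ?expR_ge0//; last exact: left_exp_ge0.
    exact: left_exp_le.
  by rewrite ler_wpM2r// /mass; apply: Rintegral_ge0.
have tail2 : `|B3 * right_exp f q| <= `|beta| * eps * mass.
  apply: (@le_trans _ _ (`|B3 * expR (- q)| * mass)).
    rewrite (normrM B3 (right_exp f q)) (normrM B3 (expR (- q))) -[leRHS]mulrA ler_wpM2l//.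
    rewrite !ger0_norm ?expR_ge0//; last exact: right_exp_ge0.
    exact: right_exp_le.
  by rewrite ler_wpM2r// /mass; apply: Rintegral_ge0.
rewrite -G1p' in G1p; rewrite -[X in `|X|]opprK -G3q' normrN in G3q.
rewrite ZZ.
move: tail1 tail2 G1p G3q EG EL h1 h2 h3; rewrite -/f.
rewrite !ler_norml => /andP[t1 _] /andP[_ t2] /andP[_ u1] /andP[u2 _].
set K0 := `|beta| * (_ + _).
have -> : eps * (4 * `|beta| * mass + 2 * K0) = 4 * (`|beta| * eps * mass) + 2 * (eps * K0) by ring.
move: t1 t2 u1 u2; rewrite -/K0.
have -> : 2 * M * (E - 2 * beta * (2 * d)) = 2 * M * E - 2 * M * (2 * beta * (2 * d)) by ring.
move: (gap_flux w A1 0 M a) (gap_flux w A2 B2 M a) (gap_flux w A2 B2 M b) (gap_flux w 0 B3 M b)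
  (gap_flux w A1 0 M p) (gap_flux w 0 B3 M q) => r1 r2 r3 r4 r5 r6.
move: (2 * A1 * _ + 2 * 0 * _) (2 * A2 * _ + 2 * B2 * _) (2 * 0 * _ + 2 * B3 * _) => l1 l2 l3.
move: (A1 * left_exp f p) (B3 * right_exp f q) => s1 s2.
move: (- 4 * beta * _) (4 * beta ^+ 2 * e * _) (2 * M * (2 * beta * _)) => v1 v2 v3.
move: (2 * (M - 2 * `|beta|)) => M2; rewrite !(mulrDr M2).
move: (M2 * integ p a _) (M2 * integ a b _) (M2 * integ b q _) => x1 x2 x3.
move: (integ p a _) (integ a b _) (integ b q _) => y1 y2 y3.
move: (`|beta| * eps * mass) (eps * K0) => c1 c2.
move=> t1 t2 u1 u2 EG EL h1 h2 h3 yE.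
have {}yE : 2 * M * (y1 + (y2 + y3)) <= 2 * M * E by rewrite ler_wpM2l ?mulr_ge0.
move: yE h1 h2 h3; rewrite !mulrDr.
move: (2 * M * E) (2 * M * y1) (2 * M * y2) (2 * M * y3) => e' y1' y2' y3'.
exact: gap_assembly EG EL.
Qed.

(** The peakon has energy 2 beta (w b - w a), and the first two terms on the right
    are the time derivative of that energy along the flow. So the gap between E
    and the energy of the peakon controls how fast the latter can decrease. With
    M large, the same inequality shows that the gap is nonnegative, and that it
    vanishes only if w is the peakon. *)
Lemma odd_gap p q M : 2 * `|beta| <= M ->
  2 * (M - 2 * `|beta|) * integ p q z2 <=
    - 4 * beta * (kernel_conv' f b - kernel_conv' f a) - 4 * beta ^+ 2 * e * (2 * d) +
    2 * M * (E - 2 * beta * (2 * d)).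
Proof.
move=> hM; rewrite -subr_le0.
apply: (@le0_eps_mul _ _ (4 * `|beta| * mass +
       2 * (`|beta| * (`|beta| ^+ 2 + 2 * (`|beta| * (W + `|beta|)) + 2 * M * (2 * W + `|beta|))))) => r r0.
have K0 : 0 <= 4 * `|beta| * mass +
       2 * (`|beta| * (`|beta| ^+ 2 + 2 * (`|beta| * (W + `|beta|)) + 2 * M * (2 * W + `|beta|))).
  have m0 : 0 <= mass by apply: Rintegral_ge0.
  have W0 : 0 <= W by apply: le_trans (wW 0).
  have M0 : 0 <= M by apply: le_trans hM; rewrite mulr_ge0.
  by do !(apply: addr_ge0 || apply: mulr_ge0 || apply: exprn_ge0).
pose eps := Num.min r 1.
have eps0 : 0 < eps by rewrite lt_min r0 ltr01.
pose p' := Num.min (Num.min p a) (a + ln eps).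
pose q' := Num.max (Num.max q b) (b - ln eps).
have pa : p' <= a by rewrite /p' !ge_min lexx orbT.
have bq : b <= q' by rewrite /q' !le_max lexx orbT.
have pe : expR (p' - a) <= eps.
  by rewrite -[leRHS]lnK ?posrE// ler_expR lerBlDl /p' ge_min lexx orbT.
have qe : expR (b - q') <= eps.
  rewrite -[leRHS]lnK ?posrE// ler_expR lerBlDr -lerBlDl /q' le_max; apply/orP; right.
  by rewrite lexx.
have e1' : eps <= 1 by rewrite /eps ge_min lexx orbT.
have H := odd_gap_truncated hM pa bq pe qe e1'.
have S : integ p q z2 <= integ p' q' z2.
  apply: integ_subset => //; first by move=> y; exact: sqr_ge0.
    by rewrite /p' !ge_min lexx.
  by rewrite /q' !le_max lexx.
rewrite lerBlDl; apply: (@le_trans _ _ (2 * (M - 2 * `|beta|) * integ p' q' z2)).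
  by rewrite ler_wpM2l// mulr_ge0// subr_ge0.
apply: (le_trans H); rewrite lerD2l ler_wpM2r//.
by rewrite /eps ge_min lexx.
Qed.

Lemma odd_energy_le : 2 * beta * (2 * d) <= E.
Proof.
rewrite leNgt; apply/negP => EJ.
set J := 2 * beta * (2 * d) in EJ.
pose X := - 4 * beta * (kernel_conv' f b - kernel_conv' f a) - 4 * beta ^+ 2 * e * (2 * d).
pose N := (`|X| + 1) / (J - E).
have JE : 0 < J - E by rewrite subr_gt0.
have N0 : 0 <= N by apply: divr_ge0; [exact: addr_ge0|exact: ltW].
have hM : 2 * `|beta| <= 2 * `|beta| + N by rewrite lerDl.
have := odd_gap 0 0 hM; rewrite integ_pt mulr0 -/J -/X.
have NE : N * (J - E) = `|X| + 1 by rewrite /N divfK// gt_eqF.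
have := ler_norm X; have := mulr_ge0 (normr_ge0 beta) (ltW JE).
have -> : 2 * (2 * `|beta| + N) * (E - J) = - 4 * (`|beta| * (J - E)) - 2 * (N * (J - E)) by ring.
rewrite NE; move: (`|beta| * _) (`|X|) (normr_ge0 X) => u v.
move: (X) => x; lra.
Qed.

Lemma odd_energy_eq y : E <= 2 * beta * (2 * d) -> w y = odd_peakon beta a b y.
Proof.
move=> EJ; have {}EJ : E = 2 * beta * (2 * d) by apply/eqP; rewrite eq_le EJ odd_energy_le.
pose X := - 4 * beta * (kernel_conv' f b - kernel_conv' f a) - 4 * beta ^+ 2 * e * (2 * d).
have H p q : integ p q z2 <= 0.
  rewrite leNgt; apply/negP => I0.
  pose N := (`|X| + 1) / integ p q z2.
  have N0 : 0 <= N by apply: divr_ge0; [exact: addr_ge0|exact: ltW].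
  have hM : 2 * `|beta| <= 2 * `|beta| + N by rewrite lerDl.
  have := odd_gap p q hM; rewrite -/X -EJ subrr mulr0 addr0 (addrC (2 * _)) addrK.
  rewrite -mulrA /N divfK ?gt_eqF//.
  move: (ler_norm X) (normr_ge0 X); move: (X) (`|X|) => x v; lra.
apply/eqP; rewrite -subr_eq0 -sqrf_eq0; apply/eqP; rewrite -/(z2 y).
have cz : continuous z2 by move=> x; exact: z2c.
exact: (@continuous_integ_eq0 z2 cz (fun x => sqr_ge0 _) H y).
Qed.

(** The value that [odd_energy_le] gives as a lower bound is attained. *)
Lemma odd_peakon_energy p q : (forall y, w y = odd_peakon beta a b y) ->
  p <= a -> b <= q ->
  integ p q (fun y => w y ^+ 2 + g y ^+ 2) <= 2 * beta * (2 * d).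
Proof.
move=> wE pa bq.
have aq : a <= q by apply: le_trans bq; exact: ltW.
have dw := primitive_ae_derive hw.
rewrite (@integ_cat _ p a q)// (@integ_cat _ a b q)//; [|exact: ltW].
rewrite (@exponential_energy w g A1 0 p a)//; last first.
  by move=> y _ ya; rewrite wE peakon_left.
rewrite (@exponential_energy w g A2 B2 a b)//; [|exact: ltW|]; last first.
  by move=> y ya yb; rewrite wE peakon_mid.
rewrite (@exponential_energy w g 0 B3 b q)//; last first.
  by move=> y yb _; rewrite wE peakon_right.
rewrite mid_a mid'_a mid_b mid'_b !mul0r !addr0 !add0r A1a !mulrN B3b.
have := sqr_ge0 (A1 * expR p); have := sqr_ge0 (B3 * expR (- q)).
rewrite !expr2; move: (A1 * expR p * _) (B3 * expR (- q) * _) => x y x0 y0.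
rewrite /d; lra.
Qed.

End odd_gap.
End Gap.

(** * Before the collision *)

Section Evolution.
Context {R : realType}.
Local Notation mu := (@lebesgue_measure R).

Lemma ler_of_eq (x y : R) : x = y -> x <= y.
Proof. by move->. Qed.

Lemma neg_sqr_le (p q : R) : p < 0 -> q < 0 -> p ^+ 2 <= q ^+ 2 -> q <= p.
Proof.
move=> p0 q0 pq; rewrite leNgt; apply/negP => lt.
have : 0 < (q - p) * (- (p + q)) by rewrite mulr_gt0; lra.
have -> : (q - p) * (- (p + q)) = p ^+ 2 - q ^+ 2 by ring.
lra.
Qed.

Lemma expR_affine_primitive (lo hi c : R) :
  primitive_on lo hi (fun t => expR (c * t)) (fun t => expR (c * t) * c).
Proof.
have hid : primitive_on lo hi (fun t : R => c * t) (fun=> c).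
  by apply: eq_primitive_on (affine_primitive lo hi c 0) => // x _ _; rewrite subr0.
apply: (primitive_on_comp hid) => z _ _.
  by near=> y; exact: is_derive_expR.
exact: continuous_expR.
Unshelve. all: by end_near.
Qed.

Lemma gronwall (lo hi C : R) (G g : R -> R) : primitive_on lo hi G g ->
  (forall t, lo <= t -> t <= hi -> g t <= C * G t) -> G lo <= 0 ->
  forall t, lo <= t -> t <= hi -> G t <= 0.
Proof.
move=> hG gG G0 t lt th.
have h := primitive_onS (lexx lo) th (primitive_onM hG (expR_affine_primitive lo hi (- C))).
have := primitive_on_le h lt; rewrite /=.
have e0 (s : R) : 0 < expR (- C * s) by exact: expR_gt0.
move=> H; have /H : forall x, lo <= x -> x <= t ->
    g x * expR (- C * x) + G x * (expR (- C * x) * - C) <= 0.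
  move=> x lx xt.
  have -> : g x * expR (- C * x) + G x * (expR (- C * x) * - C) =
    (g x - C * G x) * expR (- C * x) by ring.
  by rewrite mulr_le0_ge0 ?subr_le0 ?gG ?(le_trans xt) ?expR_ge0.
move=> K; rewrite -(pmulr_lle0 _ (e0 t)); apply: (le_trans K).
by rewrite mulr_le0_ge0// ltW.
Qed.

Lemma Rintegral_le_exhaustion (f : R -> R) c : (forall x, 0 <= f x) ->
  mu.-integrable setT (EFin \o f) ->
  (forall n : nat, integ (- n%:R) n%:R f <= c) -> \int[mu]_x f x <= c.
Proof.
move=> f0 fi H.
have mf : measurable_fun setT (EFin \o f) by have /integrableP[] := fi.
pose F (n : nat) : set R := `[- n%:R, n%:R]%classic.
have FT : \bigcup_n F n = setT.
  apply/seteqP; split => // x _.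
  exists (Num.trunc `|x|).+1 => //=; rewrite /F/= in_itv/= -ler_norml.
  by apply: ltW; exact: truncnS_gt.
have := @ge0_nondecreasing_set_cvg_integral _ (measurableTypeR R) R F (EFin \o f) mu.
rewrite FT => /(_ _ _ _ _) cv.
rewrite -lee_fin /Rintegral fineK; last exact: integrable_fin_num.
have {}cv : (\int[mu]_(x in F i) (EFin \o f) x)%E @[i --> \oo] --> (\int[mu]_x (EFin \o f) x)%E.
  apply: cv.
  - apply/nondecreasing_seqP => n; rewrite subsetEset; apply: subset_itv; rewrite bnd_simp.
      by rewrite lerN2 ler_nat.
    by rewrite ler_nat.
  - by move=> n; exact: measurable_itv.
  - by move=> n; apply: measurable_funS mf.
  - by move=> n x _; rewrite lee_fin.
move/cvg_lim : (cv) => /(_ (@ereal_hausdorff _)) <-.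
apply: lime_le; first by apply/cvg_ex; eexists; exact: cv.
apply: nearW => n; have := H n; rewrite /integ /Rintegral -lee_fin fineK//.
by apply: integrable_fin_num => //; exact: integrable_integrable_on.
Qed.

Lemma first_zero (l : R -> R) T s : {within `[0, T], continuous l} -> 0 < l 0 ->
  0 <= s -> s <= T -> l s <= 0 ->
  exists t, [/\ 0 < t, t <= s, l t = 0 & forall r, 0 <= r -> r < t -> 0 < l r].
Proof.
move=> /within_continuousP cl l0 s0 sT ls.
pose Z := [set r | 0 <= r /\ r <= s /\ l r <= 0].
have Zs : Z s by split.
have hZ : has_inf Z by split; [exists s|exists 0 => r []].
pose t := inf Z.
have t0 : 0 <= t by apply: lb_le_inf; [exists s|move=> r []].
have ts : t <= s by apply: ge_inf => //; exists 0 => r [].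
have tT : t <= T := le_trans ts sT.
have pos r : 0 <= r -> r < t -> 0 < l r.
  move=> r0 rt; rewrite ltNge; apply/negP => lr.
  have rs : r <= s := le_trans (ltW rt) ts.
  move: rt; apply/negP; rewrite -leNgt; apply: ge_inf; first by exists 0 => q [].
  by split.
have lt : l t <= 0.
  rewrite leNgt; apply/negP => lt0.
  have [d d0 Hd] := cl t t0 tT _ lt0.
  have [r [r0 [rs lr]]] := inf_adherent d0 hZ.
  rewrite -/t => rt.
  have tr : t <= r by apply: ge_inf; [exists 0 => q []|].
  have := Hd r r0 (le_trans rs sT); rewrite ger0_norm ?subr_ge0//.
  rewrite ltrBlDl => /(_ rt); rewrite ltr_norml => /andP[]; lra.
have tpos : 0 < t by rewrite lt_neqAle t0 andbT; apply: contraTneq lt => <-; rewrite -ltNge.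
exists t; split => //; apply/eqP; rewrite eq_le lt leNgt; apply/negP => lt'.
have lt0 : 0 < - l t by rewrite oppr_gt0.
have [d d0 Hd] := cl t t0 tT _ lt0.
pose r := Num.max 0 (t - d / 2).
have r0 : 0 <= r by rewrite le_max lexx.
have rt : r < t by rewrite gt_max tpos/=; have := d0; lra.
have := Hd r r0 (le_trans (ltW rt) tT); rewrite ltr0_norm ?subr_lt0// opprB.
have : t - d / 2 <= r by rewrite le_max lexx orbT.
move=> h /(_ _); have : t - r < d by have := d0; lra.
move=> h' /(_ h'); rewrite ltr_norml => /andP[_]; have := pos r r0 rt; lra.
Qed.

Lemma odd_peakon_bound (d a b y : R) : a < b ->
  `|odd_peakon (d / (2 * (1 - expR (a - b)))) a b y| <= `|d| / 2.
Proof.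
move=> ab; set e := expR (a - b).
have e1 : 0 < 1 - e by rewrite subr_gt0 -expR0 ltr_expR subr_lt0.
have key s t : s <= t + (b - a) -> 0 <= t -> expR (- t) - expR (- s) <= 1 - e.
  move=> st t0; have : e * expR (- t) <= expR (- s) by rewrite -expRD ler_expR; lra.
  have : expR (- t) <= 1 by rewrite -expR0 ler_expR oppr_le0.
  have := e1; have := expR_gt0 (- t); move: (expR (- t)) (expR (- s)) => p q p0 ee p1 pq.
  have : 0 <= (1 - e) * (1 - p) by apply: mulr_ge0; [exact: ltW|rewrite subr_ge0].
  lra.
have h1 : expR (- `|y - b|) - expR (- `|y - a|) <= 1 - e.
  apply: key => //; have -> : y - a = (y - b) + (b - a) by ring.
  by apply: (le_trans (ler_normD _ _)); rewrite lerD2l gtr0_norm// subr_gt0.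
have h2 : expR (- `|y - a|) - expR (- `|y - b|) <= 1 - e.
  apply: key => //; have -> : y - b = (y - a) - (b - a) by ring.
  by apply: (le_trans (ler_normB _ _)); rewrite lerD2l gtr0_norm// subr_gt0.
rewrite /odd_peakon normrM normrM normfV normrM normr_nat (gtr0_norm e1).
rewrite -mulrA ler_wpM2l// invfM -mulrA ler_piMr// mulrC ler_pdivrMr// mul1r ler_norml.
by apply/andP; split => //; rewrite lerNl opprB.
Qed.

Section before.
Variables (p0 q0 : R) (u : R -> R -> R).
Hypothesis (hp0 : 0 < p0) (hq0 : 0 < q0).
Hypothesis hsol : CH_solution (peakon_antipeakon p0 q0) u.
Hypothesis hE : forall t, 0 <= t -> (CH_energy u t <= CH_energy u 0)%E.

Let e0 := expR (- q0 - q0).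

Lemma initial_peakon y : u 0 y = odd_peakon (- (p0 / 2)) (- q0) q0 y.
Proof.
have [_ _ _ -> _] := hsol; rewrite /peakon_antipeakon /odd_peakon opprK; ring.
Qed.

Lemma e0_lt1 : e0 < 1.
Proof. by rewrite -expR0 ltr_expR; have := hq0; lra. Qed.

Lemma initial_difference : u 0 q0 - u 0 (- q0) = - (p0 * (1 - e0)).
Proof.
rewrite !initial_peakon /odd_peakon !subrr normr0 oppr0 expR0 opprK.
have -> : `|q0 + q0| = q0 + q0 by rewrite ger0_norm// addr_ge0// ltW.
have -> : `|- q0 - q0| = q0 + q0.
  by rewrite -opprD normrN ger0_norm// addr_ge0// ltW.
have -> : - (q0 + q0) = - q0 - q0 by ring.
by rewrite -/e0; field.
Qed.

Lemma initial_energy : energy u <= p0 ^+ 2 * (1 - e0).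
Proof.
have t0 : (0 : R) <= 0 by [].
have ei := energy_density_integrable hsol t0.
rewrite /energy.
apply: (Rintegral_le_exhaustion _ ei) => [x|n]; first by rewrite addr_ge0 ?sqr_ge0.
have [hw _ _ _] := sol_H1 hsol t0.
have q0' : - q0 < q0 by have := hq0; lra.
pose p := Num.min (- n%:R) (- q0); pose q := Num.max n%:R q0.
have e0' x : 0 <= u 0 x ^+ 2 + Dx (u 0) x ^+ 2 by rewrite addr_ge0 ?sqr_ge0.
have ii lo hi : integrable_on lo hi (fun x => u 0 x ^+ 2 + Dx (u 0) x ^+ 2).
  exact: integrable_integrable_on.
apply: (@le_trans _ _ (integ p q (fun x => u 0 x ^+ 2 + Dx (u 0) x ^+ 2))).
  by apply: integ_subset; rewrite // /p /q ?ge_min ?le_max lexx.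
have H := @odd_peakon_energy _ (u 0) (Dx (u 0)) (- (p0 / 2)) (- q0) q0 hw ii q0' p q.
apply: (le_trans (H _ _ _)).
- exact: initial_peakon.
- by rewrite /p ge_min lexx orbT.
- by rewrite /q le_max lexx orbT.
- by rewrite -/e0; apply: ler_of_eq; field.
Qed.


Section run.
Variables (T : R) (X1 X2 : R -> R).
Hypothesis (T0 : 0 <= T).
Hypothesis (hX1 : characteristic u 0 T X1) (hX2 : characteristic u 0 T X2).
Hypothesis (X10 : X1 0 = - q0) (X20 : X2 0 = q0).
Hypothesis (sep : forall t, 0 <= t -> t <= T -> X1 t < X2 t).

Let gapf (z : R) := (1 - expR z)^-1.
Let D t := u t (X2 t) - u t (X1 t).
Let e t := expR (X1 t - X2 t).
Let beta t := D t * gapf (X1 t - X2 t) / 2.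
Let J t := D t ^+ 2 * gapf (X1 t - X2 t).

Let e_lt1 t : 0 <= t -> t <= T -> 0 < 1 - e t.
Proof. by move=> t0 tT; rewrite subr_gt0 -expR0 ltr_expR subr_lt0 sep. Qed.

Let beta_e t : 0 <= t -> t <= T -> 2 * (beta t * (1 - e t)) = D t.
Proof.
move=> t0 tT; have := e_lt1 t0 tT => /lt0r_neq0 h.
by rewrite /beta /gapf -/(e t); field.
Qed.

Let JE t : 0 <= t -> t <= T -> J t = 2 * beta t * (2 * (beta t * (1 - e t))).
Proof. by move=> t0 tT; rewrite beta_e// /J /beta; field. Qed.

Let P1 := characteristic_primitive hsol (lexx 0) hX1.
Let P2 := characteristic_primitive hsol (lexx 0) hX2.

Let D_primitive : primitive_on 0 T D
  (fun t => - pressure' u t (X2 t) - - pressure' u t (X1 t)).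
Proof.
exact: primitive_onB (characteristic_acceleration hsol hE (lexx 0) T0 hX2)
  (characteristic_acceleration hsol hE (lexx 0) T0 hX1).
Qed.

Let gapf_derive (z : R) : z < 0 -> is_derive z (1 : R) gapf (expR z / (1 - expR z) ^+ 2).
Proof.
move=> z0; have h : (cst 1 - expR) z != 0 :> R.
  by rewrite /= gt_eqF// subr_gt0 -expR0 ltr_expR.
have h2 : is_derive z (1 : R) expR (expR z) by exact: is_derive_expR.
have h3 := is_deriveB (is_derive_cst (1 : R) z (1 : R)) h2.
have := is_deriveV h h3 => H; apply: (is_derive_eq H).
by rewrite sub0r /GRing.scale/= mulrNN mulrC.
Qed.

Let gap_primitive : primitive_on 0 T (fun t => gapf (X1 t - X2 t))
  (fun t => e t / (1 - e t) ^+ 2 * (u t (X1 t) - u t (X2 t))).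
Proof.
apply: (@primitive_on_comp _ _ _ _ _ gapf (fun z => expR z / (1 - expR z) ^+ 2) (primitive_onB P1 P2)) => t t0 tT.
  near=> z; apply: gapf_derive; near: z; apply: lt_nbhsl.
  by rewrite subr_lt0 sep.
have h : 1 - expR (X1 t - X2 t) != 0 by rewrite gt_eqF// e_lt1.
apply: cvgM; first exact: continuous_expR.
apply: cvgV; first by rewrite expf_neq0.
have c1 : {for (X1 t - X2 t), continuous (fun z => 1 - expR z)}.
  by apply: cvgB; [exact: cvg_cst|exact: continuous_expR].
rewrite (_ : (fun z => (1 - expR z) ^+ 2) = fun z => (1 - expR z) * (1 - expR z)).
  by rewrite /continuous_at expr2; exact: cvgM.
by apply/funext => z; rewrite expr2.
Unshelve. all: by end_near.
Qed.

Let J_primitive : primitive_on 0 T J (fun t =>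
  - 4 * beta t * (pressure' u t (X2 t) - pressure' u t (X1 t)) -
  4 * beta t ^+ 2 * e t * (2 * (beta t * (1 - e t)))).
Proof.
apply: eq_primitive_on (primitive_onM (primitive_on_sqr D_primitive) gap_primitive) => // t t0 tT.
rewrite beta_e// /beta /gapf -/(e t) /D.
have := e_lt1 t0 tT => /lt0r_neq0 h; field.
exact: h.
Qed.

Let beta_bound : exists B, forall t, 0 <= t -> t <= T -> `|beta t| <= B.
Proof.
have := primitive_onM D_primitive gap_primitive => /primitive_on_continuous.
move=> /within_continuous_bounded[B [_ /(_ (B + 1))]].
rewrite ltrDl ltr01 => /(_ isT) H; exists (B + 1) => t t0 tT.
apply: le_trans (H t _); last by rewrite /= in_itv/= t0 tT.
by rewrite /beta normrM ler_piMr// gtr0_norm ?invr_gt0// invf_le1// ler1n.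
Qed.

Let hw t := fun t0 => let: And4 h _ _ _ := @sol_H1 R _ _ hsol t t0 in h.
Let ei t (t0 : 0 <= t) lo hi : integrable_on lo hi (fun x => u t x ^+ 2 + Dx (u t) x ^+ 2).
Proof. by apply: integrable_integrable_on; exact: (energy_density_integrable hsol). Qed.

Let J_le t : 0 <= t -> t <= T -> J t <= energy u.
Proof.
move=> t0 tT; rewrite JE//.
apply: (@odd_energy_le _ (u t) (Dx (u t)) (beta t) (X1 t) (X2 t) (energy u) (speed u)).
- exact: hw.
- exact: source_ge0.
- exact: (source_integrable hsol).
- exact: ei.
- by move=> lo hi; exact: (energy_integ_le hsol hE).
- by move=> y; exact: (sol_bound hsol hE).
- exact: sep.
- exact/esym/beta_e.
Qed.

(** Gronwall's inequality for energy u - J: the gap is closed at time 0, and by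
    [odd_gap] it opens at most at a rate proportional to itself. *)
Let J_ge t : 0 <= t -> t <= T -> energy u <= J t.
Proof.
have [B hB] := beta_bound.
have hG := primitive_onB (primitive_on_cst 0 T (energy u)) J_primitive.
move=> t0 tT; rewrite -subr_le0.
apply: (gronwall (C := 4 * B) hG) => // [s s0 sT|].
  rewrite sub0r lerNl.
  have := @odd_gap _ (u s) (Dx (u s)) (beta s) (X1 s) (X2 s) (energy u) (speed u)
    (hw s0) (source_ge0 u s) (source_integrable hsol s0) (ei s0)
    (fun lo hi => energy_integ_le hsol hE lo hi s0) (fun y => sol_bound hsol hE y s0)
    (sep s0 sT) (esym (beta_e s0 sT)) 0 0 (2 * B).
  rewrite integ_pt mulr0 ler_wpM2l ?hB// => /(_ isT).
  rewrite -/(source u s) -/(pressure' u s) -/(e s) -JE//.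
  move=> H; rewrite -subr_ge0; apply: (le_trans H).
  by apply: ler_of_eq; ring.
rewrite subr_le0; apply: (le_trans initial_energy).
rewrite /J /D /gapf X10 X20 initial_difference -/e0.
have h : 1 - e0 != 0 by rewrite gt_eqF// subr_gt0 e0_lt1.
by apply: ler_of_eq; field.
Qed.

Lemma difference_sqr t : 0 <= t -> t <= T ->
  D t ^+ 2 = energy u * (1 - expR (X1 t - X2 t)).
Proof.
move=> t0 tT; have -> : energy u = J t by apply/eqP; rewrite eq_le J_ge ?J_le.
by rewrite /J /gapf mulfVK// gt_eqF// e_lt1.
Qed.

Lemma peakon_before t y : 0 <= t -> t <= T ->
  u t y = odd_peakon (D t / (2 * (1 - expR (X1 t - X2 t)))) (X1 t) (X2 t) y.
Proof.
move=> t0 tT; have -> : D t / (2 * (1 - expR (X1 t - X2 t))) = beta t.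
  by rewrite /beta /gapf invfM mulrA mulrAC.
apply: (@odd_energy_eq _ (u t) (Dx (u t)) (beta t) (X1 t) (X2 t) (energy u) (speed u)).
- exact: hw.
- exact: source_ge0.
- exact: (source_integrable hsol).
- exact: ei.
- by move=> lo hi; exact: (energy_integ_le hsol hE).
- by move=> z; exact: (sol_bound hsol hE).
- exact: sep.
- exact/esym/beta_e.
- by rewrite -JE ?J_ge.
Qed.


Lemma initial_energyE : energy u = p0 ^+ 2 * (1 - e0).
Proof.
have := difference_sqr (lexx 0) T0; rewrite /D X10 X20 initial_difference -/e0.
have h : 1 - e0 != 0 by rewrite gt_eqF// subr_gt0 e0_lt1.
by rewrite sqrrN exprMn expr2 (expr2 (1 - _)) mulrA => /(mulIf h) <-.
Qed.

Lemma difference_lt0 t : 0 <= t -> t <= T -> D t < 0.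
Proof.
move=> t0 tT.
have E0 : 0 < energy u by rewrite initial_energyE mulr_gt0 ?exprn_gt0 ?subr_gt0 ?e0_lt1.
have D0 : D 0 < 0.
  by rewrite /D X10 X20 initial_difference oppr_lt0 mulr_gt0 ?subr_gt0 ?e0_lt1.
rewrite ltNge; apply/negP => Dt.
have cD : {within `[0, t], continuous D}.
  by apply: primitive_on_continuous; exact: primitive_onS D_primitive.
have [|c] := IVT t0 cD (v := 0).
  by rewrite ge_min le_max Dt (ltW D0) orbT.
rewrite in_itv/= => /andP[c0 ct] Dc.
have := difference_sqr c0 (le_trans ct tT); rewrite Dc expr0n/= => /eqP.
by rewrite eq_sym gt_eqF// mulr_gt0// (e_lt1 c0)// (le_trans ct).
Qed.

Lemma run_sum t : 0 <= t -> t <= T -> u t (X1 t) + u t (X2 t) = 0.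
Proof.
move=> t0 tT.
suff H : u t (X1 t) = - (D t / 2).
  have -> : u t (X2 t) = D t + u t (X1 t) by rewrite /D; ring.
  by rewrite H; field.
have x12 := sep t0 tT.
have -> : u t (X1 t) = odd_peakon (D t / (2 * (1 - expR (X1 t - X2 t)))) (X1 t) (X2 t) (X1 t).
  exact: peakon_before.
rewrite /odd_peakon subrr normr0 oppr0 expR0 ltr0_norm ?subr_lt0// opprK -/(e t).
have h : 1 - e t != 0 by rewrite gt_eqF// e_lt1.
by field.
Qed.

Lemma run_bound t y : 0 <= t -> t <= T -> `|u t y| <= `|D t| / 2.
Proof.
move=> t0 tT; rewrite peakon_before//.
exact: odd_peakon_bound (sep t0 tT).
Qed.

End run.
End before.

Section two.
Variables (p0 q0 : R).
Hypothesis (hp0 : 0 < p0) (hq0 : 0 < q0).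
Local Notation u0 := (peakon_antipeakon p0 q0).

Record peakon_run (u : R -> R -> R) T X1 X2 : Prop := PeakonRun {
  run_sol : CH_solution u0 u;
  run_energy : forall t, 0 <= t -> (CH_energy u t <= CH_energy u 0)%E;
  run_X1 : characteristic u 0 T X1;
  run_X2 : characteristic u 0 T X2;
  run_X10 : X1 0 = - q0;
  run_X20 : X2 0 = q0;
  run_sep : forall t, 0 <= t -> t <= T -> X1 t < X2 t }.

(** The distance solves an autonomous equation whose right-hand side decreases
    with the distance, so two runs cannot drift apart. *)
Lemma peakon_run_positions u v T X1 X2 Y1 Y2 : 0 <= T ->
  peakon_run u T X1 X2 -> peakon_run v T Y1 Y2 ->
  forall t, 0 <= t -> t <= T -> X1 t = Y1 t /\ X2 t = Y2 t.
Proof.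
move=> T0 [us uE hX1 hX2 X10 X20 sepX] [vs vE hY1 hY2 Y10 Y20 sepY] t t0 tT.
have pX1 := characteristic_primitive us (lexx 0) hX1.
have pX2 := characteristic_primitive us (lexx 0) hX2.
have pY1 := characteristic_primitive vs (lexx 0) hY1.
have pY2 := characteristic_primitive vs (lexx 0) hY2.
have pX s : 0 <= s -> s <= T -> X1 s + X2 s = 0.
  move=> s0 sT; have [_ /(_ 0 s (lexx 0) s0 sT)] := primitive_onD pX1 pX2.
  rewrite X10 X20 addNr subr0 => ->.
  have -> : integ 0 s (fun x => u x (X1 x) + u x (X2 x)) = integ 0 s (fun=> 0).
    apply: eq_integ => r r0 rs.
    exact: (run_sum hq0 us uE T0 hX1 hX2 X10 X20 sepX r0 (le_trans rs sT)).
  by rewrite integ_cst// mul0r.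
have pY s : 0 <= s -> s <= T -> Y1 s + Y2 s = 0.
  move=> s0 sT; have [_ /(_ 0 s (lexx 0) s0 sT)] := primitive_onD pY1 pY2.
  rewrite Y10 Y20 addNr subr0 => ->.
  have -> : integ 0 s (fun x => v x (Y1 x) + v x (Y2 x)) = integ 0 s (fun=> 0).
    apply: eq_integ => r r0 rs.
    exact: (run_sum hq0 vs vE T0 hY1 hY2 Y10 Y20 sepY r0 (le_trans rs sT)).
  by rewrite integ_cst// mul0r.
have h := primitive_on_sqr (primitive_onB (primitive_onB pX2 pX1) (primitive_onB pY2 pY1)).
have : (X2 t - X1 t - (Y2 t - Y1 t)) ^+ 2 <= (X2 0 - X1 0 - (Y2 0 - Y1 0)) ^+ 2.
  apply: (primitive_on_le (primitive_onS (lexx 0) tT h) t0) => s s0 st.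
  have sT := le_trans st tT.
  have uD := difference_sqr hq0 us uE T0 hX1 hX2 X10 X20 sepX s0 sT.
  have vD := difference_sqr hq0 vs vE T0 hY1 hY2 Y10 Y20 sepY s0 sT.
  have uN := difference_lt0 hp0 hq0 us uE T0 hX1 hX2 X10 X20 sepX s0 sT.
  have vN := difference_lt0 hp0 hq0 vs vE T0 hY1 hY2 Y10 Y20 sepY s0 sT.
  have uF := initial_energyE hq0 us uE T0 hX1 hX2 X10 X20 sepX.
  have vF := initial_energyE hq0 vs vE T0 hY1 hY2 Y10 Y20 sepY.
  have E0 : 0 <= energy v by exact: energy_ge0.
  rewrite uF -vF in uD.
  move: uD vD uN vN; set p := u s _ - u s _; set q := v s _ - v s _ => uD vD uN vN.
  have mono (d1 d2 : R) : d1 <= d2 -> energy v * (1 - expR (- d1)) <= energy v * (1 - expR (- d2)).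
    by move=> d12; rewrite ler_wpM2l// lerD2l lerN2 ler_expR lerN2.
  have [lt|lt] := leP (X2 s - X1 s) (Y2 s - Y1 s).
    have pq := mono _ _ lt; rewrite !opprB -uD -vD in pq.
    have {}pq : q <= p by exact: neg_sqr_le.
    by rewrite mulr_le0_ge0 ?subr_ge0// mulr_ge0_le0// subr_le0.
  have pq := mono _ _ (ltW lt); rewrite !opprB -uD -vD in pq.
  have {}pq : p <= q by exact: neg_sqr_le.
  by rewrite mulr_ge0_le0 ?subr_le0// mulr_ge0// subr_ge0 ltW.
rewrite X10 X20 Y10 Y20 subrr expr0n/= => sq.
have : X2 t - X1 t - (Y2 t - Y1 t) = 0.
  by apply/eqP; rewrite -sqrf_eq0 eq_le sq sqr_ge0.
have := pX t t0 tT; have := pY t t0 tT; move=> *; split; lra.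
Qed.

Lemma peakon_run_unique u v T X1 X2 Y1 Y2 : 0 <= T ->
  peakon_run u T X1 X2 -> peakon_run v T Y1 Y2 -> forall y, u T y = v T y.
Proof.
move=> T0 Ru Rv y.
have [X1E X2E] := peakon_run_positions T0 Ru Rv T0 (lexx T).
case: (Ru) => us uE hX1 hX2 X10 X20 sepX; case: (Rv) => vs vE hY1 hY2 Y10 Y20 sepY.
rewrite (peakon_before hq0 us uE T0 hX1 hX2 X10 X20 sepX)//.
rewrite (peakon_before hq0 vs vE T0 hY1 hY2 Y10 Y20 sepY)//.
have uD := difference_sqr hq0 us uE T0 hX1 hX2 X10 X20 sepX T0 (lexx T).
have vD := difference_sqr hq0 vs vE T0 hY1 hY2 Y10 Y20 sepY T0 (lexx T).
have uN := difference_lt0 hp0 hq0 us uE T0 hX1 hX2 X10 X20 sepX T0 (lexx T).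
have vN := difference_lt0 hp0 hq0 vs vE T0 hY1 hY2 Y10 Y20 sepY T0 (lexx T).
have uF := initial_energyE hq0 us uE T0 hX1 hX2 X10 X20 sepX.
have vF := initial_energyE hq0 vs vE T0 hY1 hY2 Y10 Y20 sepY.
suff -> : u T (X2 T) - u T (X1 T) = v T (Y2 T) - v T (Y1 T) by rewrite X1E X2E.
have sq : (u T (X2 T) - u T (X1 T)) ^+ 2 = (v T (Y2 T) - v T (Y1 T)) ^+ 2.
  by rewrite uD vD uF vF X1E X2E.
by apply/eqP; rewrite eq_le; apply/andP; split; apply: neg_sqr_le => //; rewrite sq.
Qed.

(** At the collision the difference of the crest velocities has vanished, and
    it bounds the whole profile. *)
Lemma vanishing_at_collision u tau X1 X2 : 0 < tau ->
  CH_solution u0 u -> (forall t, 0 <= t -> (CH_energy u t <= CH_energy u 0)%E) ->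
  characteristic u 0 tau X1 -> characteristic u 0 tau X2 ->
  X1 0 = - q0 -> X2 0 = q0 -> X1 tau = X2 tau ->
  (forall t, 0 <= t -> t < tau -> X1 t < X2 t) -> forall y, u tau y = 0.
Proof.
move=> tau0 us uE hX1 hX2 X10 X20 Xtau sep y.
apply/eqP; rewrite -normr_le0.
apply: (@le0_eps_mul _ _ 2) => e e0.
have cD := primitive_on_continuous (primitive_onB
  (characteristic_acceleration us uE (lexx 0) (ltW tau0) hX2)
  (characteristic_acceleration us uE (lexx 0) (ltW tau0) hX1)).
have /within_continuousP/(_ tau (ltW tau0) (lexx _) _ e0)[d d0 Hd] := cD.
have [d' d'0 Hd'] := sol_continuous2 us e0.
pose s := Num.max 0 (tau - Num.min d d' / 2).
have dd0 : 0 < Num.min d d' by rewrite lt_min d0.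
have s0 : 0 <= s by rewrite le_max lexx.
have st : s < tau by rewrite gt_max tau0/=; lra.
have ts : `|s - tau| <= Num.min d d' / 2.
  rewrite ltr0_norm ?subr_lt0// opprB lerBlDl -lerBlDr le_max; apply/orP; right.
  exact: lexx.
have tsd : `|s - tau| < d.
  apply: (le_lt_trans ts); apply: (@lt_le_trans _ _ (Num.min d d')); first by lra.
  by rewrite ge_min lexx.
have tsd' : `|tau - s| <= d'.
  rewrite distrC; apply: (le_trans ts); apply: (@le_trans _ _ (Num.min d d')); first by lra.
  by rewrite ge_min lexx orbT.
have B := @run_bound p0 q0 u hq0 us uE s X1 X2 s0 (characteristicS (lexx 0) (ltW st) hX1)
  (characteristicS (lexx 0) (ltW st) hX2) X10 X20.
have {}B := B (fun r r0 rs => sep r r0 (le_lt_trans rs st)) s y s0 (lexx s).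
have := Hd s s0 (ltW st) tsd; rewrite Xtau subrr subr0 => Ds.
have := Hd' tau s y y (ltW tau0) s0 tsd'; rewrite subrr normr0 => /(_ (ltW d'0)) us'.
have -> : u tau y = (u tau y - u s y) + u s y by ring.
apply: (le_trans (ler_normD _ _)); lra.
Qed.

End two.
End Evolution.

(** * After the collision *)

Section After.
Context {R : realType}.
Local Notation mu := (@lebesgue_measure R).

Lemma derive_lipschitz_le (F : R -> R) x d N : is_derive x (1 : R) F d ->
  (forall y, `|F y - F x| <= N * `|y - x|) -> `|d| <= N.
Proof.
move=> /is_derive_epsP H FN; rewrite -subr_le0.
apply: (@le0_eps_mul _ _ 1) => e e0; rewrite mulr1 lerBlDl.
have [r r0 Hr] := H _ e0.
have r2 : 0 < r / 2 by rewrite divr_gt0.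
have := Hr (x + r / 2); have := FN (x + r / 2).
rewrite addrAC subrr add0r (gtr0_norm r2) => h1 h2.
have {}h2 : `|F (x + r / 2) - F x - d * (r / 2)| <= e * (r / 2) by apply: h2; lra.
rewrite -(ler_pM2r r2) mulrDl -[X in _ * X](gtr0_norm r2) -normrM.
have -> : d * (r / 2) = (F (x + r / 2) - F x) - (F (x + r / 2) - F x - d * (r / 2)) by ring.
by apply: (le_trans (ler_normB _ _)); exact: lerD.
Qed.

Lemma riccati_pointwise (g2 f p d l th E : R) : 2^-1 * g2 <= f -> p <= E * l -> 0 < l ->
  d ^+ 2 <= l * g2 -> 0 <= th -> th <= 1 ->
  0 <= - (p - f) + ((E + 1) * l + th * d).
Proof.
move=> hf hp l0 CS a0 a1; rewrite -(pmulr_rge0 _ l0).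
have h1 := ler_wpM2l (ltW l0) hf; have h2 := ler_wpM2l (ltW l0) hp.
have h3 := sqr_ge0 (d + th * l).
have h4 : 0 <= l ^+ 2 * (1 - th ^+ 2) by rewrite mulr_ge0 ?sqr_ge0// subr_ge0 exprn_ile1.
have h5 := sqr_ge0 l.
have e3 : (d + th * l) ^+ 2 = d ^+ 2 + 2 * (th * d * l) + l ^+ 2 * th ^+ 2 by ring.
have e4 : l ^+ 2 * (1 - th ^+ 2) = l ^+ 2 - l ^+ 2 * th ^+ 2 by ring.
have e1 : l * (2^-1 * g2) = 2^-1 * (l * g2) by ring.
have e2 : l * (E * l) = E * l ^+ 2 by ring.
have -> : l * (- (p - f) + ((E + 1) * l + th * d)) =
  l * f - l * p + E * l ^+ 2 + l ^+ 2 + th * d * l by ring.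
rewrite e1 in h1; rewrite e2 in h2; rewrite e3 in h3; rewrite e4 in h4.
move: h1 h2 h3 h4 h5 CS.
move: (l * g2) (l * f) (l * p) (E * l ^+ 2) (l ^+ 2 * th ^+ 2) (l ^+ 2) (th * d * l) (d ^+ 2).
by move=> *; lra.
Qed.

Lemma contraction_pointwise (l th d p N : R) : 0 < l -> 0 <= th -> th <= N / 2 ->
  - (N * l) <= d -> p <= 3 / 2 * N ^+ 2 * l -> 0 < N ->
  p - (2 * N ^+ 2 * l + th * d) <= 0.
Proof.
move=> l0 a0 a1 d1 p1 N0; have h1 := ler_wpM2l a0 d1.
have Nl : 0 <= N * l by rewrite mulr_ge0// ltW.
have h2 := ler_wpM2r Nl a1.
have e1 : N / 2 * (N * l) = 2^-1 * (N ^+ 2 * l) by field.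
have e2 : 3 / 2 * N ^+ 2 * l = 3 / 2 * (N ^+ 2 * l) by field.
have -> : 2 * N ^+ 2 * l = 2 * (N ^+ 2 * l) by ring.
rewrite e1 in h2; rewrite e2 in p1; rewrite mulrN in h1.
move: h1 h2 p1; move: (th * d) (th * (N * l)) (N ^+ 2 * l) => *; lra.
Qed.

Section fixed.
Variables (u0 : R -> R) (u : R -> R -> R).
Hypothesis hsol : CH_solution u0 u.
Hypothesis hE : forall t, 0 <= t -> (CH_energy u t <= CH_energy u 0)%E.
Variables (tau K1 : R).
Hypothesis (tau0 : 0 < tau) (K10 : 0 <= K1).
Hypothesis one_sided : forall t x y, tau <= t -> x <= y -> u t y - u t x <= K1 * (y - x).

Let pos s : tau <= s -> 0 <= s. Proof. by apply: le_trans; exact: ltW. Qed.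

(** The one-sided bound makes characteristics unique backwards in time, so two
    of them never meet before the instant at which they are prescribed. *)
Lemma backward_pair s0 t x1 x2 : tau <= s0 -> s0 <= t -> x1 < x2 ->
  exists X1 X2, [/\ characteristic u 0 t X1, characteristic u 0 t X2,
    X1 t = x1, X2 t = x2 & forall s, s0 <= s -> s <= t -> X1 s < X2 s].
Proof.
move=> ts st x12; have t0 : 0 <= t by exact: le_trans (pos ts) st.
have [X1 X1t hX1] := backward_characteristic hsol hE x1 t0.
have [X2 X2t hX2] := backward_characteristic hsol hE x2 t0.
exists X1, X2; split => //.
have hL := primitive_onB (characteristic_primitive hsol (lexx 0) hX2)
  (characteristic_primitive hsol (lexx 0) hX1).
have nz s : s0 <= s -> s <= t -> X2 s - X1 s != 0.
  move=> s1 s2; apply/eqP => Ls.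
  have s0' : 0 <= s by apply: pos; exact: le_trans s1.
  have H := gronwall (C := 2 * K1) (primitive_onS s0' (lexx t) (primitive_on_sqr hL)).
  have : (X2 t - X1 t) ^+ 2 <= 0.
    apply: H => // [r r1 r2|]; last by rewrite Ls expr0n.
    have tr : tau <= r by apply: (le_trans ts); exact: le_trans r1.
    have -> : 2 * K1 * (X2 r - X1 r) ^+ 2 = 2 * ((X2 r - X1 r) * (K1 * (X2 r - X1 r))) by ring.
    rewrite -mulrA ler_wpM2l//.
    have [le|lt] := leP (X1 r) (X2 r).
      by rewrite ler_wpM2l ?subr_ge0// one_sided.
    apply: ler_wnM2l; first by rewrite subr_le0; exact: ltW.
    by rewrite -lerN2 -mulrN !opprB; apply: one_sided => //; exact: ltW.
  rewrite X1t X2t => h; have : 0 < (x2 - x1) ^+ 2 by rewrite exprn_gt0// subr_gt0.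
  by rewrite ltNge h.
move=> s s1 s2; rewrite -subr_gt0 ltNge; apply/negP => Ls.
have s0' : 0 <= s by apply: pos; exact: le_trans s1.
have cL : {within `[s, t], continuous (fun r => X2 r - X1 r)}.
  by apply: primitive_on_continuous; exact: primitive_onS hL.
have [|c] := IVT s2 cL (v := 0).
  have h : 0 <= X2 t - X1 t by rewrite X1t X2t subr_ge0 ltW.
  by rewrite ge_min le_max Ls h orbT.
rewrite in_itv/= => /andP[c1 c2]; apply/eqP; apply: nz => //.
exact: le_trans c1.
Qed.

Lemma source_le_ae s N : 0 <= s ->
  (forall x y, `|u s x| <= N /\ `|u s x - u s y| <= N * `|x - y|) ->
  {ae mu, forall y, source u s y <= 3 / 2 * N ^+ 2}.
Proof.
move=> s0 bnd; have [hw _ _ _] := sol_H1 hsol s0.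
apply: (ae_impl _ (primitive_ae_derive hw)) => x dx.
have h1 : `|Dx (u s) x| <= N.
  by apply: derive_lipschitz_le dx _ => y; have [_] := bnd y x.
have [h2 _] := bnd x x.
have N0 : 0 <= N by apply: le_trans h2.
have sq y : `|y| <= N -> y ^+ 2 <= N ^+ 2.
  by move=> yN; rewrite -(real_normK (num_real y)) lerXn2r// nnegrE.
rewrite /source; have := sq _ h1; have := sq _ h2; lra.
Qed.

Section pair.
Variables (s0 t : R) (X1 X2 : R -> R).
Hypothesis (ts : tau <= s0) (st : s0 <= t).
Hypothesis (hX1 : characteristic u 0 t X1) (hX2 : characteristic u 0 t X2).
Hypothesis (sep : forall s, s0 <= s -> s <= t -> X1 s < X2 s).
Hypothesis (vanish : forall x, u s0 x = 0).
Let L s := X2 s - X1 s.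
Let D s := u s (X2 s) - u s (X1 s).

Let t0 : 0 <= t. Proof. exact: le_trans (pos ts) st. Qed.

Let L_primitive : primitive_on s0 t L D.
Proof.
apply: primitive_onS (pos ts) (lexx t) _.
exact: primitive_onB (characteristic_primitive hsol (lexx 0) hX2)
  (characteristic_primitive hsol (lexx 0) hX1).
Qed.

Let D_primitive : primitive_on s0 t D (fun s =>
   - integ (X1 s) (X2 s) (fun x => pressure u s x - source u s x)).
Proof.
have := primitive_onS (pos ts) (lexx t)
  (primitive_onB (characteristic_acceleration hsol hE (lexx 0) t0 hX2)
  (characteristic_acceleration hsol hE (lexx 0) t0 hX1)).
apply: eq_primitive_on => // s s1 s2.
have s0' : 0 <= s by apply: pos; exact: le_trans s1.
have [_ <-//] := pressure'_primitive hsol (X1 s) (X2 s) s0'; last exact/ltW/sep.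
ring.
Qed.

Let D0 : D s0 = 0. Proof. by rewrite /D !vanish subrr. Qed.

(** A Riccati argument. By Cauchy-Schwarz the part u_x^2 / 2 of the source adds
    at least D^2 / (2 L) to the derivative of D, while the pressure takes away at
    most K L, where K bounds the energy. With theta = (K + 1) (s - s0) the
    derivative of D + theta L is therefore at least (D + theta L)^2 / (2 L), as
    long as theta <= 1. *)
Lemma slope_lower_bound : t - s0 <= (energy u + 1)^-1 -> - L t <= D t.
Proof.
move=> short.
have E0 := energy_ge0 u.
pose theta s := (energy u + 1) * (s - s0).
have htheta : primitive_on s0 t theta (fun=> energy u + 1) by exact: affine_primitive.
have h := primitive_onN (primitive_onD D_primitive (primitive_onM htheta L_primitive)).
have := primitive_on_le h st; rewrite D0 /theta subrr mulr0 mul0r addr0 oppr0 oppr_le0 => H.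
have {}H := H _.
have theta1 s : s0 <= s -> s <= t -> 0 <= theta s /\ theta s <= 1.
  move=> s1 s2; have E1 : 0 < energy u + 1 by rewrite ltr_wpDl.
  split; first by apply: mulr_ge0; [exact: ltW|rewrite subr_ge0].
  rewrite /theta -[leRHS](mulfV (lt0r_neq0 E1)) ler_pM2l//.
  by apply: le_trans short; rewrite lerD2r.
have Lt : 0 < L t by rewrite subr_gt0 sep.
have [th0 th1] := theta1 t st (lexx t).
suff : 0 <= D t + theta t * L t.
  have : theta t * L t <= L t by rewrite ler_piMl// ltW.
  lra.
apply: H => s s1 s2; rewrite oppr_le0 -/(theta s).
have s0' : 0 <= s by apply: pos; exact: le_trans s1.
have Ls : 0 < L s by rewrite subr_gt0 sep.
have X12 : X1 s <= X2 s by rewrite ltW// sep.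
have [hw mw wi gi] := sol_H1 hsol s0'.
have gi1 : integrable_on (X1 s) (X2 s) (Dx (u s)) by exact: sqr_integrable_integrable_on.
have gi2 : integrable_on (X1 s) (X2 s) (fun x => Dx (u s) x ^+ 2) by exact: integrable_integrable_on.
have fi : integrable_on (X1 s) (X2 s) (source u s).
  by apply: integrable_integrable_on; exact: (source_integrable hsol).
have pi : integrable_on (X1 s) (X2 s) (pressure u s).
  by apply: continuous_integrable_on; exact: (pressure_continuous hsol).
have CS := sqr_integ_le X12 gi1 gi2.
have [_ /(_ _ _ (lexx _) X12 (lexx _)) DE] := hw (X1 s) (X2 s).
rewrite -DE -/(D s) -/(L s) in CS.
have hf : 2^-1 * integ (X1 s) (X2 s) (fun x => Dx (u s) x ^+ 2) <= integ (X1 s) (X2 s) (source u s).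
  rewrite -integZ//; apply: le_integ => //; first exact: integrable_onZ.
  by move=> x _ _; rewrite /source lerDr sqr_ge0.
have hp : integ (X1 s) (X2 s) (pressure u s) <= energy u * L s.
  rewrite -integ_cst//; apply: le_integ => //; first exact: integrable_on_cst.
  by move=> x _ _; have [] := pressure_bounds hsol hE x s0'.
rewrite integB//.
have [a0 a1] := theta1 s s1 s2.
move: CS hf hp Ls a0 a1; move: (integ _ _ _) (integ _ _ _) (integ _ _ _) => g2 f p.
move: (D s) (L s) (theta s) (energy u) => d l th E CS hf hp l0 a0 a1.
exact: riccati_pointwise hf hp l0 CS a0 a1.
Qed.


(** Source and pressure are at most 3 N^2 / 2, so |D'| <= (3 N^2 / 2) L. The rate
    2 N^2 of theta exceeds this by enough to absorb the term theta D, as long as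
    theta <= N / 2; hence neither D - theta L nor - D - theta L increases. *)
Lemma slope_contraction N : 0 < N -> t - s0 <= (4 * N)^-1 ->
  (forall s x y, s0 <= s -> s <= t -> `|u s x| <= N /\ `|u s x - u s y| <= N * `|x - y|) ->
  `|D t| <= N / 2 * L t.
Proof.
move=> N0 short bnd.
pose theta s := (2 * N ^+ 2) * (s - s0).
have htheta : primitive_on s0 t theta (fun=> 2 * N ^+ 2) by exact: affine_primitive.
have theta1 s : s0 <= s -> s <= t -> 0 <= theta s /\ theta s <= N / 2.
  move=> s1 s2; split; first by apply: mulr_ge0; [rewrite mulr_ge0 ?sqr_ge0|rewrite subr_ge0].
  have : s - s0 <= (4 * N)^-1 by apply: le_trans short; rewrite lerD2r.
  have N2 : 0 <= 2 * N ^+ 2 by rewrite mulr_ge0 ?sqr_ge0.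
  move=> /(ler_wpM2l N2)/le_trans; apply; apply: ler_of_eq; field.
  exact: lt0r_neq0.
have Lpos s : s0 <= s -> s <= t -> 0 < L s by move=> s1 s2; rewrite subr_gt0 sep.
have D'le s : s0 <= s -> s <= t ->
    `|integ (X1 s) (X2 s) (fun x => pressure u s x - source u s x)| <= 3 / 2 * N ^+ 2 * L s.
  move=> s1 s2; have X12 : X1 s <= X2 s by rewrite ltW// sep.
  have s0' : 0 <= s by apply: pos; exact: le_trans s1.
  have hf := source_le_ae s0' (fun x y => bnd s x y s1 s2).
  have c0 : 0 <= 3 / 2 * N ^+ 2 by rewrite mulr_ge0 ?sqr_ge0.
  have fi : integrable_on (X1 s) (X2 s) (source u s).
    by apply: integrable_integrable_on; exact: (source_integrable hsol).
  have pi : integrable_on (X1 s) (X2 s) (pressure u s).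
    by apply: continuous_integrable_on; exact: (pressure_continuous hsol).
  have hp x : pressure u s x <= 3 / 2 * N ^+ 2.
    by apply: kernel_conv_le_ae => //; [exact: source_ge0|exact: (source_integrable hsol)].
  rewrite ler_norml /L -!mulNr -!integ_cst//; apply/andP; split.
    apply: ae_le_integ; [exact: integrable_on_cst|exact: integrable_onB|].
    apply: (ae_impl _ hf) => x fx; have [P0 _] := pressure_bounds hsol hE x s0'.
    by move: fx P0; move: (N ^+ 2) (source u s x) (pressure u s x) => *; lra.
  apply: le_integ; [exact: integrable_onB|exact: integrable_on_cst|].
  by move=> x _ _; rewrite lerBlDr (le_trans (hp x))// lerDl source_ge0.
have Dle s : s0 <= s -> s <= t -> `|D s| <= N * L s.
  move=> s1 s2; have [_] := bnd s (X2 s) (X1 s) s1 s2.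
  by rewrite (gtr0_norm (Lpos s s1 s2)).
have Lt := Lpos t st (lexx t); have [th0 th1] := theta1 t st (lexx t).
have up : D t <= theta t * L t.
  have h := primitive_onB D_primitive (primitive_onM htheta L_primitive).
  have := primitive_on_le h st; rewrite D0 /theta subrr mulr0 mul0r subr0 -/(theta t) subr_le0.
  apply=> s s1 s2; rewrite -/(theta s).
  have := D'le s s1 s2; have := Dle s s1 s2; have := theta1 s s1 s2; have := Lpos s s1 s2.
  move: (integ _ _ _) => p l0 [a0 a1]; rewrite !ler_norml => /andP[d1 d2] /andP[p1 p2].
  by apply: (contraction_pointwise l0 a0 a1 d1 _ N0); rewrite lerNl.
have down : - D t <= theta t * L t.
  have h := primitive_onB (primitive_onN D_primitive) (primitive_onM htheta L_primitive).
  have := primitive_on_le h st; rewrite D0 oppr0 /theta subrr mulr0 mul0r subr0 -/(theta t) subr_le0.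
  apply=> s s1 s2; rewrite -/(theta s) opprK.
  have := D'le s s1 s2; have := Dle s s1 s2; have := theta1 s s1 s2; have := Lpos s s1 s2.
  move: (integ _ _ _) => p l0 [a0 a1]; rewrite !ler_norml => /andP[d1 d2] /andP[p1 p2].
  exact: (contraction_pointwise l0 a0 a1 d1 p2 N0).
have : theta t * L t <= N / 2 * L t by rewrite ler_wpM2r// ltW.
by rewrite ler_norml => h; apply/andP; split; [rewrite lerNl|]; apply: le_trans h.
Qed.

End pair.

Lemma value_contraction s0 t x N : tau <= s0 -> s0 <= t -> 0 < N -> t - s0 <= (4 * N)^-1 ->
  (forall x, u s0 x = 0) ->
  (forall s x y, s0 <= s -> s <= t -> `|u s x| <= N /\ `|u s x - u s y| <= N * `|x - y|) ->
  `|u t x| <= N / 2.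
Proof.
move=> ts st N0 short vanish bnd.
have t0 : 0 <= t by exact: le_trans (pos ts) st.
have [X Xt hX] := backward_characteristic hsol hE x t0.
have hU := primitive_onS (pos ts) (lexx t) (characteristic_acceleration hsol hE (lexx 0) t0 hX).
have [ui /(_ s0 t (lexx s0) st (lexx t))] := hU; rewrite Xt vanish subr0 => ->.
apply: (@le_trans _ _ (3 / 2 * N ^+ 2 * (t - s0))).
  apply: le_norm_integ_cst => // s s1 s2; rewrite normrN.
  have s0' : 0 <= s by apply: pos; exact: le_trans s1.
  have hf := source_le_ae s0' (fun x y => bnd s x y s1 s2).
  have fi := source_integrable hsol s0'.
  apply: (le_trans (kernel_conv'_le (source_ge0 u s) _)).
  by apply: kernel_conv_le_ae => //; [exact: source_ge0|rewrite mulr_ge0 ?sqr_ge0].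
have c0 : 0 <= 3 / 2 * N ^+ 2 by rewrite mulr_ge0 ?sqr_ge0.
apply: (le_trans (ler_wpM2l c0 short)).
have -> : 3 / 2 * N ^+ 2 / (4 * N) = 3 / 8 * N by field; exact: lt0r_neq0.
lra.
Qed.

(** Value and slope are halved over and over again: the admissible length of time
    only grows as the bound N shrinks. *)
Lemma zero_on_short_interval s0 eta N : tau <= s0 -> 0 < N -> eta <= (4 * N)^-1 ->
  (forall x, u s0 x = 0) ->
  (forall s x y, s0 <= s -> s <= s0 + eta ->
     `|u s x| <= N /\ `|u s x - u s y| <= N * `|x - y|) ->
  forall s x, s0 <= s -> s <= s0 + eta -> u s x = 0.
Proof.
move=> ts N0 short vanish bnd.
have H k s x y : s0 <= s -> s <= s0 + eta ->
   `|u s x| <= N / 2 ^+ k /\ `|u s x - u s y| <= N / 2 ^+ k * `|x - y|.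
  elim: k s x y => [|k IH] s x y s1 s2; first by rewrite expr0 divr1; exact: bnd.
  have Nk : 0 < N / 2 ^+ k by rewrite divr_gt0// exprn_gt0.
  have short' : s - s0 <= (4 * (N / 2 ^+ k))^-1.
    apply: (@le_trans _ _ eta); first by rewrite lerBlDl.
    apply: (le_trans short); rewrite lef_pV2 ?posrE ?mulr_gt0// ler_pM2l//.
    rewrite ler_pdivrMr ?exprn_gt0//; apply: ler_peMr; first exact: ltW.
    by rewrite exprn_ege1// ler1n.
  have IH' r z w : s0 <= r -> r <= s ->
      `|u r z| <= N / 2 ^+ k /\ `|u r z - u r w| <= N / 2 ^+ k * `|z - w|.
    by move=> r1 r2; apply: IH => //; exact: le_trans s2.
  have -> : N / 2 ^+ k.+1 = N / 2 ^+ k / 2 by rewrite exprSr invfM mulrA.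
  split; first exact: value_contraction s1 Nk short' vanish IH'.
  wlog xy : x y / x < y => [hwlog|].
    have [lt|lt|->] := ltgtP x y; first exact: hwlog.
      by rewrite distrC (distrC x); exact: hwlog.
    by rewrite !subrr normr0 mulr0.
  have [X1 [X2 [hX1 hX2 X1s X2s sep]]] := backward_pair ts s1 xy.
  have := slope_contraction ts s1 hX1 hX2 sep vanish Nk short' IH'.
  by rewrite X1s X2s distrC (distrC x) (gtr0_norm (_ : 0 < y - x)) ?subr_gt0.
move=> s x s1 s2; apply/eqP; rewrite -normr_le0.
apply: (@le0_eps_mul _ _ 1) => e e0; rewrite mulr1.
pose k := (Num.trunc (N / e)).+1.
have [hk _] := H k s x x s1 s2; apply: (le_trans hk).
rewrite ler_pdivrMr ?exprn_gt0// mulrC -ler_pdivrMr//.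
apply: (@le_trans _ _ k%:R); first by apply: ltW; exact: truncnS_gt.
by rewrite -natrX ler_nat; apply: ltnW; exact: ltn_expl.
Qed.

(** The length of the time step depends only on the energy and on the one-sided
    bound, so that finitely many steps reach any given time. *)
Lemma zero_after : (forall x, u tau x = 0) -> forall t x, tau <= t -> u t x = 0.
Proof.
move=> vanish.
have E0 : 0 <= energy u := energy_ge0 u.
pose N := Num.max 1 (Num.max K1 (speed u)).
have N1 : 1 <= N by rewrite /N le_max lexx.
have NK : K1 <= N by rewrite /N !le_max lexx orbT.
have NS : speed u <= N by rewrite /N !le_max lexx !orbT.
have N0 : 0 < N by apply: lt_le_trans N1.
pose eta := Num.min (energy u + 1)^-1 (4 * N)^-1.
have eta0 : 0 < eta by rewrite /eta lt_min !invr_gt0 mulr_gt0// ltr_wpDl.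
have step s0 : tau <= s0 -> (forall x, u s0 x = 0) ->
    forall s x, s0 <= s -> s <= s0 + eta -> u s x = 0.
  move=> ts v0; apply: (@zero_on_short_interval s0 eta N) => //.
    by rewrite /eta ge_min lexx orbT.
  move=> s x y s1 s2; split.
    by apply: le_trans NS; apply: (sol_bound hsol hE); apply: pos; exact: le_trans s1.
  wlog xy : x y / x < y => [hwlog|].
    have [lt|lt|->] := ltgtP x y; first exact: hwlog.
      by rewrite distrC (distrC x); exact: hwlog.
    by rewrite !subrr normr0 mulr0.
  have [X1 [X2 [hX1 hX2 X1s X2s sep]]] := backward_pair ts s1 xy.
  have short : s - s0 <= (energy u + 1)^-1.
    by apply: (@le_trans _ _ eta); [rewrite lerBlDl|rewrite /eta ge_min lexx].
  have := slope_lower_bound ts s1 hX1 hX2 sep v0 short; rewrite X1s X2s => lb.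
  have tss : tau <= s := le_trans ts s1.
  have ub := one_sided tss (ltW xy).
  rewrite distrC (distrC x) (gtr0_norm (_ : 0 < y - x)) ?subr_gt0//.
  have yx : 0 <= y - x by rewrite subr_ge0 ltW.
  rewrite ler_norml; apply/andP; split.
    by apply: le_trans lb; rewrite lerN2 ler_peMl.
  by apply: (le_trans ub); rewrite ler_wpM2r.
have all n : forall s x, tau <= s -> s <= tau + n%:R * eta -> u s x = 0.
  elim: n => [|n IH] s x s1 s2.
    have -> : s = tau by apply/eqP; rewrite eq_le s1 andbT; rewrite mul0r addr0 in s2.
    exact: vanish.
  have [le|lt] := leP s (tau + n%:R * eta); first exact: IH.
  have tn : tau <= tau + n%:R * eta by rewrite lerDl mulr_ge0// ltW.
  apply: (step _ tn) => //; [by move=> z; exact: IH|exact: ltW|].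
  by rewrite -addrA; move: s2; rewrite -natr1 mulrDl mul1r.
move=> t x tt; apply: (all (Num.trunc ((t - tau) / eta)).+1) => //.
by rewrite -lerBlDl -ler_pdivrMr//; apply: ltW; exact: truncnS_gt.
Qed.

End fixed.
End After.

(** * The dichotomy and uniqueness *)

Section Main.
Context {R : realType}.
Local Notation mu := (@lebesgue_measure R).

Lemma one_sided_lipschitz (u0 : R -> R) u tau : dissipative_solution u0 u -> 0 < tau ->
  exists2 k, 0 <= k & forall t x y, tau <= t -> x <= y -> u t y - u t x <= k * (y - x).
Proof.
move=> [us [C hC] _] tau0.
have c0 : 0 <= `|C| * (1 + tau^-1) by rewrite mulr_ge0// addr_ge0// invr_ge0 ltW.
exists (`|C| * (1 + tau^-1)) => // t x y tt xy.
have t0 : 0 < t := lt_le_trans tau0 tt.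
have [hw mw _ wi] := sol_H1 us (ltW t0).
have [gi /(_ x y (lexx x) xy (lexx y)) ->] := hw x y.
rewrite -integ_cst//; apply: ae_le_integ => //; first exact: integrable_on_cst.
apply: (ae_impl _ (hC t t0)) => z /le_trans; apply.
apply: (@le_trans _ _ (`|C| * (1 + t^-1))).
  by rewrite ler_wpM2r ?ler_norm// addr_ge0// invr_ge0 ltW.
by rewrite ler_wpM2l// lerD2l lef_pV2.
Qed.

Variables (p0 q0 : R).
Hypothesis (hp0 : 0 < p0) (hq0 : 0 < q0).
Local Notation u0 := (peakon_antipeakon p0 q0).

Lemma run_or_collision u T : dissipative_solution u0 u -> 0 <= T ->
  (exists X1 X2, peakon_run p0 q0 u T X1 X2) \/
  exists tau X1 X2, [/\ 0 < tau, tau <= T,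
    characteristic u 0 tau X1 /\ characteristic u 0 tau X2, X1 tau = X2 tau &
    forall t, 0 <= t -> t < tau -> peakon_run p0 q0 u t X1 X2].
Proof.
move=> [us _ uE] T0.
have [X1 X10 hX1] := forward_characteristic us uE (- q0) T.
have [X2 X20 hX2] := forward_characteristic us uE q0 T.
have [sep|] := pselect (forall t, 0 <= t -> t <= T -> X1 t < X2 t).
  by left; exists X1, X2; split.
move=> /existsNP[s /not_implyP[s0 /not_implyP[sT /negP]]].
rewrite -leNgt -subr_le0 => hs.
have cL : {within `[0, T], continuous (fun t => X2 t - X1 t)}.
  apply: primitive_on_continuous.
  exact: primitive_onB (characteristic_primitive us (lexx 0) hX2)
    (characteristic_primitive us (lexx 0) hX1).
have L0 : 0 < X2 0 - X1 0 by rewrite X10 X20 opprK addr_gt0.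
have [tau [tau0 ts Xtau sep]] := first_zero cL L0 s0 sT hs.
have tT := le_trans ts sT.
right; exists tau, X1, X2; split => //.
- by split; exact: characteristicS hX1 || exact: characteristicS hX2.
- by apply/esym/eqP; rewrite -subr_eq0 Xtau.
move=> t t0 tt; have tT' := le_trans (ltW tt) tT.
split => //; [exact: characteristicS hX1|exact: characteristicS hX2|].
by move=> r r0 rt; rewrite -subr_gt0; apply: sep => //; exact: le_lt_trans tt.
Qed.

Lemma zero_after_collision u T tau X1 X2 : dissipative_solution u0 u -> 0 < tau ->
  tau <= T -> characteristic u 0 tau X1 -> characteristic u 0 tau X2 ->
  X1 tau = X2 tau ->
  (forall t, 0 <= t -> t < tau -> peakon_run p0 q0 u t X1 X2) ->
  forall x, u T x = 0.
Proof.
move=> hu tau0 tT hX1 hX2 Xtau hrun x.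
have [us _ uE] := hu.
have [k k0 hk] := one_sided_lipschitz hu tau0.
apply: (zero_after us uE tau0 hk _ x tT) => y.
have [_ _ _ _ X10 X20 _] := hrun 0 (lexx 0) tau0.
apply: (vanishing_at_collision hq0 tau0 us uE hX1 hX2 X10 X20 Xtau).
by move=> t t0 tt; have [_ _ _ _ _ _] := hrun t t0 tt; exact.
Qed.

(** Before its own collision a solution moves like the other one, so that one
    of them cannot collide while the other is still separated. *)
Lemma no_early_collision u v T X1 X2 tau Y1 Y2 : peakon_run p0 q0 u T X1 X2 ->
  0 < tau -> tau <= T -> CH_solution u0 v ->
  characteristic v 0 tau Y1 -> characteristic v 0 tau Y2 ->
  Y1 tau = Y2 tau ->
  (forall t, 0 <= t -> t < tau -> peakon_run p0 q0 v t Y1 Y2) -> False.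
Proof.
move=> [us uE hX1 hX2 X10 X20 sep] tau0 tT vs hY1 hY2 Ytau hrun.
have eqXY t : 0 <= t -> t < tau -> X2 t - X1 t = Y2 t - Y1 t.
  move=> t0 tt; have Rv := hrun t t0 tt.
  have Ru : peakon_run p0 q0 u t X1 X2.
    have tT' := le_trans (ltW tt) tT.
    split => //; [exact: characteristicS hX1|exact: characteristicS hX2|].
    by move=> r r0 rt; apply: sep => //; exact: le_trans tT'.
  by have [-> ->] := peakon_run_positions hp0 hq0 t0 Ru Rv t0 (lexx t).
have l0 : 0 < X2 tau - X1 tau by rewrite subr_gt0 sep// ltW.
have h := primitive_onB
  (primitive_onB (characteristic_primitive us (lexx 0) (characteristicS (lexx 0) tT hX2))
    (characteristic_primitive us (lexx 0) (characteristicS (lexx 0) tT hX1)))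
  (primitive_onB (characteristic_primitive vs (lexx 0) hY2)
    (characteristic_primitive vs (lexx 0) hY1)).
have [d d0 Hd] := primitive_onP h (ltW tau0) (lexx _) l0.
pose s := Num.max 0 (tau - d / 2).
have s0 : 0 <= s by rewrite le_max lexx.
have st : s < tau by rewrite gt_max tau0/=; lra.
have sd : `|s - tau| < d.
  rewrite ltr0_norm ?subr_lt0// opprB.
  have : tau - d / 2 <= s by rewrite /s le_max lexx orbT.
  lra.
have := Hd s s0 (ltW st) sd.
by rewrite /= eqXY// subrr Ytau subrr subr0 sub0r normrN gtr0_norm ?ltxx.
Qed.

End Main.

Theorem theorem1p2 (R : realType) (p0 q0 : R) (hp0 : 0 < p0) (hq0 : 0 < q0)
    (u v : R -> R -> R)
    (hu : dissipative_solution (peakon_antipeakon p0 q0) u)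
    (hv : dissipative_solution (peakon_antipeakon p0 q0) v) :
  forall t x : R, 0 <= t -> u t x = v t x.
Proof.
move=> t x t0; have [us _ uE] := hu; have [vs _ vE] := hv.
have [[X1 [X2 Ru]]|[tu [X1 [X2 [tu0 tut [hX1 hX2] Xt Ru]]]]] := run_or_collision hq0 hu t0;
have [[Y1 [Y2 Rv]]|[tv [Y1 [Y2 [tv0 tvt [hY1 hY2] Yt Rv]]]]] := run_or_collision hq0 hv t0.
- exact: (peakon_run_unique hp0 hq0 t0 Ru Rv).
- by have := no_early_collision hp0 hq0 Ru tv0 tvt vs hY1 hY2 Yt Rv.
- by have := no_early_collision hp0 hq0 Rv tu0 tut us hX1 hX2 Xt Ru.
- rewrite (zero_after_collision hq0 hu tu0 tut hX1 hX2 Xt Ru).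
  by rewrite (zero_after_collision hq0 hv tv0 tvt hY1 hY2 Yt Rv).
Qed.
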